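(* Assume that $E=\mathbb{R}^d$ or that $E$ is an open, connected and bounded subset of $\mathbb{R}^d$ with smooth boundary. For $\pi\in\mathbf{P}(\mathbf{P}(E))$ define $$\mathcal{I}(\pi):=\int_{\mathbf{P}(E)}I(\rho)\,\pi(d\rho).$$ (1) The functional $\mathcal{I}:\mathbf{P}(\mathbf{P}(E))\to\mathbb{R}\cup\{\infty\}$ is affine, nonnegative and lower semicontinuous for the weak convergence. Moreover, for any $\pi\in\mathbf{P}(\mathbf{P}(E))$, $$\mathcal{I}(\pi)=\sup_{j\in\mathbb{N}^*}I(\pi_j)=\lim_{j\to\infty}I(\pi_j).$$ (2) Let $(F^N)$ be a sequence with $F^N\in\mathbf{P}_{sym}(E^N)$ and $\pi\in\mathbf{P}(\mathbf{P}(E))$ be such that $F^N_j\rightharpoonup\pi_j$ weakly in $\mathbf{P}(E^j)$ as $N\to\infty$ for every $j\ge1$. Then $$\mathcal{I}(\pi)\le\liminf_{N\to\infty}I(F^N).$$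
   Context: $\mathbf{P}(Z)$: Borel probability measures on $Z$; $\mathbf{P}_{sym}(E^N)$: those on $E^N$ invariant under permutations of coordinates; $F^N_j$: marginal of $F^N$ on the first $j$ coordinates. For $\pi\in\mathbf{P}(\mathbf{P}(E))$, $\pi_j:=\int_{\mathbf{P}(E)}\rho^{\otimes j}\pi(d\rho)\in\mathbf{P}_{sym}(E^j)$. $I$ is the normalized Fisher information: for $F\in\mathbf{P}(E^j)$, $I(F):=\frac1j\int_{E^j}\frac{|\nabla F|^2}{F}$ if $F\in W^{1,1}(E^j)$ (identifying $F$ with its density), and $I(F):=+\infty$ otherwise. *)

(* Defs.v *)
From HB Require Import structures.
From mathcomp Require Import all_boot all_order all_algebra perm.
From mathcomp Require Import all_classical all_reals all_analysis measurable_realfun giry.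

Set Implicit Arguments.
Unset Strict Implicit.
Unset Printing Implicit Defensive.
Import Order.TTheory GRing.Theory Num.Theory.
Import numFieldNormedType.Exports.

Local Open Scope classical_set_scope.
Local Open Scope ring_scope.

Definition borel (Z : ptopologicalType) : measurableType _ :=
  g_sigma_algebraType (@open Z).

Section continuous_borel.
Context {R : realType}.

Lemma borel_open (Z : ptopologicalType) (A : set Z) :
  open A -> measurable (A : set (borel Z)).
Proof. exact: sub_sigma_algebra. Qed.

Lemma continuous_borel (Y Z : ptopologicalType) (f : Y -> Z) :
  continuous f -> measurable_fun [set: borel Y] (f : borel Y -> borel Z).
Proof.
move=> /continuousP cf.
apply: (@measurability _ _ (borel Y) (borel Z) setT f (@open Z)).
  by [].
by move=> A [B oB BA]; rewrite -BA setTI; apply: borel_open; exact: cf.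
Qed.

Lemma continuous_borelR (Y : ptopologicalType) (f : Y -> R) :
  continuous f -> measurable_fun [set: borel Y] f.
Proof.
move=> /continuousP cf.
apply: (measurability _ (RGenOInfty.measurableE R)).
by move=> A [B [x ->] BA]; rewrite -BA setTI; apply: borel_open; apply: cf; exact: interval_open.
Qed.

End continuous_borel.

Section subtype.
Context {T : Type} {A : set T}.

(* The points of a non-empty set as a type. Measurable types are pointed, hence
   the proof of non-emptiness; the distinguished point plays no other role. *)
Definition pts of A !=set0 : Type := A.

Definition pts_val (A0 : A !=set0) : pts A0 -> T := @set_val T A.

End subtype.

HB.instance Definition _ (T : choiceType) (A : set T) (A0 : A !=set0) :=
  Choice.on (pts A0).
HB.instance Definition _ (T : choiceType) (A : set T) (A0 : A !=set0) :=
  isPointed.Build (pts A0) 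
    (exist (fun x => x \in A) _ (mem_set (projT2 (cid A0)))).
HB.instance Definition _ (T : topologicalType) (A : set T) (A0 : A !=set0) :=
  Topological.on (pts A0).
HB.instance Definition _ (T : uniformType) (A : set T) (A0 : A !=set0) :=
  Uniform.on (pts A0).
HB.instance Definition _ (R : realType) (T : pseudoMetricType R) (A : set T)
  (A0 : A !=set0) := PseudoMetric.on (pts A0).

Section prob.
Context {R : realType}.

Definition bcfun (Z : topologicalType) : Type :=
  {f : Z -> R | continuous f /\ exists M : R, forall x, `|f x| <= M}.

HB.instance Definition _ (Z : topologicalType) := gen_eqMixin (bcfun Z).
HB.instance Definition _ (Z : topologicalType) := gen_choiceMixin (bcfun Z).

(* [probability] does not constrain its values on non-measurable sets, so two
   Borel probabilities are to be compared on measurable sets only. Everything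
   below (integrals, densities, the weak topology) depends only on these. *)
Definition prob_eval (Z : ptopologicalType) (mu : probability (borel Z) R) :
  {ptws bcfun Z -> R} := fun f => \int[mu]_x (sval f x).

End prob.

(* Borel probability measures on Z with the weak topology, i.e. the coarsest one
   making mu |-> \int f dmu continuous for every bounded continuous f. It is
   again a [ptopologicalType], so that [Prob R (Prob R Z)] makes sense. *)
Definition Prob (R : realType) (Z : ptopologicalType) : Type :=
  initial_topology (@prob_eval R Z).

HB.instance Definition _ (R : realType) (Z : ptopologicalType) :=
  PointedTopological.on (Prob R Z).

Section matrix_borel.
Context {R : realType} {j d : nat}.

Lemma measurable_mx disp (T : measurableType disp)
    (g : T -> borel 'M[R]_(j, d)) :
  (forall i k, measurable_fun [set: T] (fun t => (g t : 'M[R]_(j, d)) i k)) ->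
  measurable_fun [set: T] g.
Proof.
move=> mg.
apply: (@measurability _ _ T (borel 'M[R]_(j, d)) setT g open).
  by [].
move=> A [V oV VA]; rewrite -VA setTI => {VA}.
pose Box (ab : 'M[rat]_(j, d) * 'M[rat]_(j, d)) : set 'M[R]_(j, d) :=
  [set M | forall i k, ratr (ab.1 i k) < M i k < ratr (ab.2 i k)].
have VE : V = \bigcup_(ab in [set ab | Box ab `<=` V]) Box ab.
  apply/seteqP; split => [M VM|M [ab /= + BM]]; last exact.
  have /nbhs_ballP[e /= e0 eV] : nbhs M V by apply: open_nbhs_nbhs.
  have ha i k : exists q : rat, M i k - e < ratr q < M i k.
    have /rat_in_itvoo[q qe] : M i k - e < M i k by rewrite ltrBlDr ltrDl.
    by exists q; rewrite in_itv in qe.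
  have hb i k : exists q : rat, M i k < ratr q < M i k + e.
    have /rat_in_itvoo[q qe] : M i k < M i k + e by rewrite ltrDl.
    by exists q; rewrite in_itv in qe.
  exists (\matrix_(i, k) sval (cid (ha i k)), \matrix_(i, k) sval (cid (hb i k))).
    move=> N /= BN; apply: eV; split => // i k.
    have := BN i k; rewrite !mxE; case: cid => a /= /andP[a1 a2].
    case: cid => b /= /andP[b1 b2] /andP[aN Nb].
    rewrite /ball /= ltr_norml; apply/andP; split.
      by rewrite ltrNl opprB ltrBlDr addrC (lt_trans Nb).
    by rewrite ltrBlDr addrC -ltrBlDr (lt_trans a1).
  move=> i k /=; rewrite !mxE; case: cid => a /= /andP[a1 ->].
  by case: cid => b /= /andP[-> _].
rewrite VE preimage_bigcup bigcup_mkcond.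
apply: countable_bigcupT_measurable => [|ab]; first exact: countableP.
case: ifP => // _.
rewrite [X in measurable X](_ : _ = \bigcap_(i in [set: 'I_j])
    \bigcap_(k in [set: 'I_d]) ((fun t => (g t : 'M[R]_(j, d)) i k) @^-1`
       `]ratr (ab.1 i k), ratr (ab.2 i k)[%classic)).
  apply: fin_bigcap_measurable => [|i _]; first exact: finite_finset.
  apply: fin_bigcap_measurable => [|k _]; first exact: finite_finset.
  by rewrite -[X in measurable X]setTI; apply: mg => //; exact: measurable_itv.
apply/seteqP; split => [t /= Bt i _ k _ /=|t Bt i k].
  by rewrite in_itv /=; exact: Bt.
by have := Bt i I k I; rewrite /= in_itv.
Qed.

Lemma pts_val_continuous (A : set 'M[R]_(j, d)) (A0 : A !=set0) :
  continuous (@pts_val _ A A0).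
Proof. exact: initial_continuous. Qed.

Lemma measurable_pts_coord (A : set 'M[R]_(j, d)) (A0 : A !=set0) i k :
  measurable_fun [set: borel (pts A0)]
    (fun X : pts A0 => pts_val X i k).
Proof.
apply: continuous_borelR => X.
apply: (@continuous_comp (pts A0) 'M[R]_(j, d) R (pts_val (A0 := A0))
  (fun M => M i k)); first exact: pts_val_continuous.
exact: coord_continuous.
Qed.

Lemma measurable_pts (A : set 'M[R]_(j, d)) (A0 : A !=set0)
    disp (T : measurableType disp) (g : T -> borel (pts A0)) :
  (forall i k, measurable_fun [set: T]
    (fun t => pts_val (g t : pts A0) i k)) ->
  measurable_fun [set: T] g.
Proof.
move=> /(@measurable_mx _ _ (fun t => pts_val (g t : pts A0))) mg.
apply: (@measurability _ _ T (borel (pts A0)) setT g open).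
  by [].
move=> B [V [U oU <-] <-]; rewrite setTI.
rewrite -[X in measurable X]setTI; apply: (mg measurableT U).
exact: borel_open.
Qed.

End matrix_borel.

Section eval_measurable.
Context {R : realType}.

Lemma continuous_bc_eval (Z : ptopologicalType) (f : bcfun (R := R) Z) :
  continuous (fun mu : Prob R Z => \int[mu]_x sval f x).
Proof.
move=> mu; apply: (@continuous_comp (Prob R Z) {ptws bcfun Z -> R} R
  (@prob_eval R Z) (fun h : {ptws bcfun Z -> R} => h f)).
  exact: initial_continuous.
exact: (@proj_continuous (bcfun Z) (fun _ => R) f).
Qed.

Lemma bcfun_integral_measurable (Z : ptopologicalType) (f : bcfun (R := R) Z) :
  measurable_fun [set: borel (Prob R Z)]
    (fun mu : Prob R Z => \int[mu]_x (sval f x)%:E : \bar R)%E.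
Proof.
have -> : (fun mu : Prob R Z => \int[mu]_x (sval f x)%:E)%E =
    (EFin \o (fun mu : Prob R Z => \int[mu]_x sval f x)).
  apply/funext => mu /=; rewrite /Rintegral fineK//.
  case: f => f [cf [M fM]] /=.
  apply: integrable_fin_num => //.
  apply: (@le_integrable _ _ _ _ _ _ _ (EFin \o cst M)) => //=.
  - by apply/measurable_EFinP; exact: continuous_borelR.
  - by move=> x _; rewrite /= lee_fin (le_trans (fM x))// ler_norm.
  - exact: finite_measure_integrable_cst.
by apply/measurable_EFinP; apply: continuous_borelR; exact: continuous_bc_eval.
Qed.

Lemma measurable_eval (Z : pseudoPMetricType R) (A : set (borel Z)) :
  measurable A ->
  measurable_fun [set: borel (Prob R Z)] (fun mu : Prob R Z => mu A : \bar R).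
Proof.
move: A; apply: (@dynkin_induction _ (borel Z) open
  (fun A => measurable_fun [set: borel (Prob R Z)] (fun mu : Prob R Z => mu A : \bar R))) => //.
- by move=> A B; exact: openI.
- apply: (eq_measurable_fun (cst 1%E)) => // mu _.
  by rewrite /= probability_setT.
- move=> A oA.
  pose d (x : Z) : \bar R := edist_inf (~` A) x.
  have d0 x : (0 <= d x)%E by exact: edist_inf_ge0.
  pose d1 (x : Z) : R := fine (Order.min 1%E (d x)).
  have d1E x : (d1 x)%:E = Order.min 1%E (d x).
    rewrite /d1 fineK// fin_numElt; apply/andP; split.
      by rewrite lt_min ltNyr/= (lt_le_trans _ (d0 x)).
    by rewrite gt_min ltry.
  have d1_ge0 x : 0 <= d1 x by rewrite -lee_fin d1E le_min lee01/=.
  have d1c : continuous d1.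
    move=> x; have := edist_inf_continuous (A := ~` A) (x := x); rewrite -/d.
    have [dx|dx] := eqVneq (d x) +oo%E.
      rewrite /continuous_at -/(d x) dx => /cvgeyPge/(_ 1) d_ge.
      have -> : d1 x = 1 by rewrite /d1 dx min_l ?leey.
      apply: cvg_near_cst; move: d_ge; apply: filterS => y d_ge.
      by rewrite /d1 min_l.
    have dfin : d x \is a fin_num by rewrite ge0_fin_numE// ltey.
    rewrite /continuous_at -/(d x) -(fineK dfin) => /fine_cvgP[nfin cfin].
    have -> : d1 x = Num.min 1 (fine (d x)).
      by apply: EFin_inj; rewrite d1E EFin_min fineK.
    have cm : (fun y => Num.min 1 (fine (d y))) @ x --> Num.min 1 (fine (d x)).
      apply: (@continuous_min _ _ (cst 1) (fine \o d) x) => //.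
      exact: cvg_cst.
    apply: cvg_trans cm; apply: near_eq_cvg.
    move: nfin; apply: filterS => y dyfin.
    by apply: EFin_inj; rewrite d1E EFin_min fineK.
  pose h (n : nat) (x : Z) : R := Num.min 1 (n%:R * d1 x).
  have h0 n x : 0 <= h n x by rewrite le_min ler01 mulr_ge0.
  have h1 n x : h n x <= 1 by rewrite ge_min lexx.
  have hc n : continuous (h n).
    move=> x; apply: (@continuous_min _ _ (cst 1) (fun x => n%:R * d1 x) x).
      exact: cvg_cst.
    by apply: cvgM; [exact: cvg_cst|exact: d1c].
  have hb n : continuous (h n) /\ exists M : R, forall x, `|h n x| <= M.
    by split => //; exists 1 => x; rewrite ger0_norm.
  have hA x : (fun n => (h n x)%:E) @ \oo --> ((\1_A x)%:E : \bar R).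
    apply/cvg_EFin; first by near=> n.
    have [Ax|Ax] := pselect (A x); last first.
      have -> : \1_A x = 0 :> R by rewrite indicE memNset.
      have d1x : d1 x = 0.
        by apply: EFin_inj; rewrite d1E /d edist_inf0// min_r// lee01.
      by apply: cvg_near_cst; near=> n; rewrite /= /h d1x mulr0 min_r.
    have -> : \1_A x = 1 :> R by rewrite indicE mem_set.
    have /nbhs_ballP[e /= e0 eA] : nbhs x A by apply: open_nbhs_nbhs.
    have dx : (e%:E <= d x)%E.
      apply: le_ereal_inf_tmp => _ [a nAa <-].
      rewrite leNgt; apply/negP => /edist_lt_ball /= bxa.
      exact/nAa/eA.
    have d1x : 0 < d1 x.
      by rewrite -lte_fin d1E lt_min lte01/= (lt_le_trans _ dx)// lte_fin.
    apply: cvg_near_cst; near=> n; rewrite /= /h min_l//.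
    rewrite -ler_pdivrMr// div1r ltW//; near: n; exact: nbhs_infty_gtr.
  apply: (@emeasurable_fun_cvg _ (borel (Prob R Z)) R setT
    (fun n (mu : Prob R Z) => \int[mu]_x (h n x)%:E)%E).
    by move=> n; exact: (bcfun_integral_measurable (exist _ _ (hb n))).
  move=> mu _.
  have -> : mu A = (\int[mu]_x (\1_A x)%:E)%E.
    by rewrite integral_indic ?setIT//; exact: borel_open.
  under [X in _ --> X]eq_integral.
    by move=> x _; rewrite -(cvg_lim _ (hA x))//; over.
  apply: cvg_monotone_convergence => //.
  - by move=> n; apply/measurable_EFinP; exact: continuous_borelR.
  - by move=> n x _; rewrite lee_fin.
  - move=> x _ m n mn; rewrite lee_fin /h le_min ge_min lexx/=.
    by rewrite ge_min ler_wpM2r ?ler_nat// orbT.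
- move=> A mA mE.
  apply: (eq_measurable_fun
    (fun mu : borel (Prob R Z) => 1 - (mu : Prob R Z) A)%E).
    by move=> mu _; rewrite probability_setC.
  exact: emeasurable_funB.
- move=> F mF tF mE.
  apply: (eq_measurable_fun (fun mu : borel (Prob R Z) =>
    \sum_(0 <= k <oo) (mu : Prob R Z) (F k))%E).
    by move=> mu _; rewrite measure_semi_bigcup//; exact: bigcup_measurable.
  exact: ge0_emeasurable_sum.
Unshelve. all: by end_near. Qed.

End eval_measurable.

Section push.
Context {R : realType} {d1 d2 : measure_display}.
Context {T1 : measurableType d1} {T2 : measurableType d2}.
Variables (f : T1 -> T2) (mf : measurable_fun [set: T1] f).

Section mpush.
Variable m : {measure set T1 -> \bar R}.

Let push := pushforward m f.
Let push0 : push set0 = 0%E. Proof. exact: measure0. Qed.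
Let push_ge0 A : (0 <= push A)%E. Proof. exact: measure_ge0. Qed.
Let push_sigma_additive : semi_sigma_additive push.
Proof. exact: measure_semi_sigma_additive. Qed.

HB.instance Definition _ :=
  isMeasure.Build _ _ _ push push0 push_ge0 push_sigma_additive.

Definition mpush : {measure set T2 -> \bar R} := push.

End mpush.

Section ppush.
Variable P : probability T1 R.

Let push : set T2 -> \bar R := mpush P.
Let push_setT : push setT = 1%E. Proof. exact: probability_setT. Qed.

HB.instance Definition _ := Measure.on push.
HB.instance Definition _ := Measure_isProbability.Build _ _ _ push push_setT.

Definition ppush : probability T2 R := push.

End ppush.

End push.

Section tensor_power.
Context {R : realType} {disp : measure_display} {T : measurableType disp}.

Definition tcons n (x : (T * n.-tuple T)%type) : n.+1.-tuple T :=
  [the n.+1.-tuple T of x.1 :: x.2].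

Lemma measurable_tcons n : measurable_fun [set: (T * n.-tuple T)%type] (@tcons n).
Proof. exact: measurable_cons. Qed.

Section sigma_finite_tcons.
Variable m : {sigma_finite_measure set T -> \bar R}.
Variables (n : nat) (p : {sigma_finite_measure set (n.-tuple T) -> \bar R}).

Let push : set (n.+1.-tuple T) -> \bar R :=
  mpush (@measurable_tcons n) (m \x p)%E.

Let push_sigma_finite : sigma_finite setT push.
Proof.
pose uncons (t : n.+1.-tuple T) := (thead t, [tuple of behead t]).
have muncons : measurable_fun [set: n.+1.-tuple T] uncons.
  apply/measurable_fun_pairP; split.
    exact: measurable_tnth.
  exact: measurable_behead.
have tconsK (x : (T * n.-tuple T)%type) : uncons (tcons x) = x.
  by case: x => a b; rewrite /uncons theadE; congr pair; apply/val_inj.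
have /sigma_finiteP[F [TF ndF Foo]] := sigma_finiteT m.
have /sigma_finiteP[G [TG ndG Goo]] := sigma_finiteT p.
exists (fun k => uncons @^-1` (F k `*` G k)).
  rewrite -preimage_bigcup (_ : \bigcup_k (F k `*` G k) = setT).
    by rewrite preimage_setT.
  rewrite -setXTT TF TG predeqE => -[x y]; split.
    by move=> [k _ []/= ? ?]; split; exists k.
  move=> [/= [k _ Fkx] [l _ Gly]]; exists (maxn k l) => //; split.
  - by move: x Fkx; exact/subsetPset/ndF/leq_maxl.
  - by move: y Gly; exact/subsetPset/ndG/leq_maxr.
move=> k; have [mF Fk] := Foo k; have [mG Gk] := Goo k.
have mFG : measurable (F k `*` G k) by exact: measurableX.
split; first by rewrite -[X in measurable X]setTI; exact: muncons.
rewrite /push /mpush /= /pushforward (_ : _ @^-1` _ = F k `*` G k).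
  by rewrite product_measure1E// lte_mul_pinfty// ge0_fin_numE.
by rewrite -comp_preimage (_ : uncons \o _ = id)//; exact/funext.
Qed.

HB.instance Definition _ := Measure.on push.
HB.instance Definition _ :=
  Measure_isSigmaFinite.Build _ _ _ push push_sigma_finite.

Definition push_tcons : {sigma_finite_measure set (n.+1.-tuple T) -> \bar R} :=
  push.

End sigma_finite_tcons.

Variable m : {sigma_finite_measure set T -> \bar R}.

Fixpoint tpower n : {sigma_finite_measure set (n.-tuple T) -> \bar R} :=
  match n with
  | 0 => \d_([tuple] : 0.-tuple T)
  | n'.+1 => push_tcons m (tpower n')
  end.

End tensor_power.

(* Lebesgue measure on R^(j x d) is the (j * d)-fold product of the one on R,
   transported by the indexing [mxvec_index] of the entries of a matrix. *)
Definition mx_of_tuple {R : realType} {j d : nat} (t : (j * d).-tuple (measurableTypeR R)) :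
  borel 'M[R]_(j, d) := \matrix_(i, k) tnth t (mxvec_index i k).

Lemma measurable_mx_of_tuple {R : realType} {j d : nat} :
  measurable_fun [set: (j * d).-tuple (measurableTypeR R)] (@mx_of_tuple R j d).
Proof.
apply: measurable_mx => i k; under eq_fun do rewrite mxE.
exact: measurable_tnth.
Qed.

Definition lebesgue_mx (R : realType) (j d : nat) :
    {measure set (borel 'M[R]_(j, d)) -> \bar R} :=
  mpush measurable_mx_of_tuple (tpower (@lebesgue_measure R) (j * d)).

Section tpower_probability.
Context {R : realType} {disp : measure_display} {T : measurableType disp}.

Lemma tpower_probability_setT (P : probability T R) n :
  tpower P n setT = 1%E.
Proof.
elim: n => [|n ih] /=; first by rewrite diracT.
rewrite /push_tcons /= /mpush /= /pushforward preimage_setT -setXTT.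
by rewrite product_measure1E// probability_setT mul1e ih.
Qed.

Lemma measurable_tpower disp' (S : measurableType disp')
    (P : S -> probability T R) :
  (forall A, measurable A -> measurable_fun [set: S] (P ^~ A)) ->
  forall n (A : set (n.-tuple T)), measurable A ->
  measurable_fun [set: S] (fun s => tpower (P s) n A).
Proof.
move=> mP.
pose gP (s : S) : giry T R := P s.
have mgP : measurable_fun [set: S] gP by exact: measurable_giry_codensity.
pose gpow := fix F n (s : S) : giry (n.-tuple T) R := match n with
  | 0 => giry_ret ([tuple] : 0.-tuple T)
  | n'.+1 => giry_map (@measurable_tcons _ T n') (giry_prod (gP s, F n' s))
  end.
have gpowE n s : gpow n s = tpower (P s) n :> (set _ -> \bar R).
  elim: n => [//|n ih]; apply/funext => A.
  rewrite /= /push_tcons /= /mpush /giry_map /= /pushforward.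
  by rewrite /giry_prod /product_subprobability /= /product_measure1 /= ih.
have mgpow n : measurable_fun [set: S] (gpow n).
  elim: n => [|n ih] /=; first exact: measurable_cst.
  apply: (measurableT_comp (measurable_giry_map _)).
  apply: (measurableT_comp measurable_giry_prod).
  exact: measurable_fun_pair.
move=> n A mA.
apply: (eq_measurable_fun (fun s => giry_ev (gpow n s) A)).
  by move=> s _; rewrite /giry_ev gpowE.
exact: (measurableT_comp (measurable_giry_ev mA) (mgpow n)).
Qed.

End tpower_probability.

(* A point of E^j is a j x d matrix whose rows are its j components in E. Since
   'rV_d is 'M_(1, d), the sets E and [powE E j] are both sets of matrices. *)
Definition powE {R : realType} {d : nat} (E : set 'rV[R]_d) (j : nat) :
    set 'M[R]_(j, d) := [set X | forall i, E (row i X)].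
Arguments powE {R d} E j.

Lemma powE0 {R : realType} {d : nat} (E : set 'rV[R]_d) (E0 : E !=set0) j :
  powE E j !=set0.
Proof.
by case: E0 => x Ex; exists (\matrix_i x) => i; rewrite rowK.
Qed.

Section powers_of_E.
Context {R : realType} {d : nat} {E : set 'rV[R]_d} (E0 : E !=set0).

Lemma tuple_powE_sub j (t : j.-tuple (borel (pts E0))) :
  powE E j (\matrix_i pts_val (tnth t i : pts E0)).
Proof. by move=> i; rewrite rowK; exact: set_valP. Qed.

Definition tuple_powE j (t : j.-tuple (borel (pts E0))) :
    borel (pts (powE0 E0 j)) :=
  exist (fun X => X \in powE E j)
    (\matrix_i pts_val (tnth t i : pts E0)) (mem_set (tuple_powE_sub t)).

Lemma measurable_tuple_powE j :
  measurable_fun [set: j.-tuple (borel (pts E0))] (@tuple_powE j).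
Proof.
apply: measurable_pts => i k.
rewrite (_ : (fun t => _) = (fun t : j.-tuple (borel (pts E0)) =>
    pts_val (tnth t i : pts E0) ord0 k)).
  exact: (measurableT_comp (measurable_pts_coord (A0 := E0) ord0 k)
    (@measurable_tnth _ (borel (pts E0)) j i)).
by apply/funext => t /=; rewrite /pts_val /= mxE.
Qed.

Section tensor_prob.
Variables (rho : Prob R (pts E0)) (j : nat).

Let tensor : set (borel (pts (powE0 E0 j))) -> \bar R :=
  mpush (@measurable_tuple_powE j) (tpower rho j).

Let tensor_setT : tensor setT = 1%E.
Proof. by rewrite /tensor /mpush /= /pushforward preimage_setT tpower_probability_setT. Qed.

HB.instance Definition _ := Measure.on tensor.
HB.instance Definition _ := Measure_isProbability.Build _ _ _ tensor tensor_setT.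

Definition tensor_prob : Prob R (pts (powE0 E0 j)) :=
  (tensor : probability (borel (pts (powE0 E0 j))) R).

End tensor_prob.

Lemma measurable_tensor_prob j (A : set (borel (pts (powE0 E0 j)))) :
  measurable A ->
  measurable_fun [set: borel (Prob R (pts E0))]
    (fun rho : Prob R (pts E0) => tensor_prob rho j A).
Proof.
move=> mA.
apply: (measurable_tpower (S := borel (Prob R (pts E0))) (P := fun rho => rho)).
  by move=> B; exact: measurable_eval.
by rewrite -[X in measurable X]setTI; exact: measurable_tuple_powE.
Qed.

(* pi_j, the set function A |-> \int rho^{(x) j}(A) pi(drho). *)
Section mixture.
Variables (pi : Prob R (Prob R (pts E0))) (j : nat).

Let mix (A : set (borel (pts (powE0 E0 j)))) : \bar R :=
  (\int[pi]_rho tensor_prob rho j A)%E.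

Let mix0 : mix set0 = 0%E.
Proof. by rewrite /mix integral0_eq. Qed.

Let mix_ge0 A : (0 <= mix A)%E.
Proof. by apply: integral_ge0. Qed.

Let mix_sigma_additive : semi_sigma_additive mix.
Proof.
move=> F mF tF _; rewrite [X in _ --> X](_ : _ =
    \int[pi]_rho (\sum_(0 <= k <oo) tensor_prob rho j (F k)))%E; last first.
  apply: eq_integral => rho _.
  by apply/esym/cvg_lim => //; exact: measure_sigma_additive.
rewrite [X in X @ _](_ : _ =
    (fun n => \int[pi]_rho (\sum_(0 <= i < n) tensor_prob rho j (F i)))%E);
  last first.
  apply/funext => n; rewrite -ge0_integral_sum//.
  by move=> ?; exact: measurable_tensor_prob.
apply: cvg_monotone_convergence => //.
- by move=> n; apply: emeasurable_sum => m; exact: measurable_tensor_prob.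
- by move=> n x _; rewrite sume_ge0.
- by move=> x _ m n mn; exact: ereal_nondecreasing_series.
Qed.

HB.instance Definition _ := isMeasure.Build _ _ _ mix
  mix0 mix_ge0 mix_sigma_additive.

Let mix_setT : mix setT = 1%E.
Proof.
rewrite /mix (eq_integral (cst 1%E)); last first.
  by move=> rho _; rewrite probability_setT.
by rewrite integral_cst// mul1e probability_setT.
Qed.

HB.instance Definition _ := Measure_isProbability.Build _ _ _ mix mix_setT.

Definition mixture : Prob R (pts (powE0 E0 j)) :=
  (mix : probability (borel (pts (powE0 E0 j))) R).

End mixture.

Lemma first_rows_sub j m (X : pts (powE0 E0 (j + m))) :
  powE E j (usubmx (pts_val X)).
Proof. by move=> i; rewrite row_usubmx; exact: (set_valP X). Qed.

Definition first_rows j m (X : borel (pts (powE0 E0 (j + m)))) :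
    borel (pts (powE0 E0 j)) :=
  exist (fun X => X \in powE E j) (usubmx (pts_val (X : pts _)))
    (mem_set (first_rows_sub X)).

Lemma measurable_first_rows j m :
  measurable_fun [set: borel (pts (powE0 E0 (j + m)))] (@first_rows j m).
Proof.
apply: measurable_pts => i k.
rewrite (_ : (fun X => _) = (fun X : pts (powE0 E0 (j + m)) =>
    pts_val X (lshift m i) k)); first exact: measurable_pts_coord.
by apply/funext => X /=; rewrite /pts_val /= mxE.
Qed.

Definition marginal j m (F : Prob R (pts (powE0 E0 (j + m)))) :
    Prob R (pts (powE0 E0 j)) :=
  ppush (@measurable_first_rows j m) F.

End powers_of_E.

(* Borel sets of E^N are the traces of Borel sets of the ambient matrix space. *)
Definition symmetric_prob {R : realType} {d : nat} {E : set 'rV[R]_d}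
    (E0 : E !=set0) N (F : Prob R (pts (powE0 E0 N))) : Prop :=
  forall (s : 'S_N) (A : set (borel 'M[R]_(N, d))), measurable A ->
    F [set X | A (row_perm s (pts_val X))] = F [set X | A (pts_val X)].

Section smooth.
Context {R : realType} {j d : nat}.

Definition partial (ik : 'I_j * 'I_d) (f : 'M[R]_(j, d) -> R) :
  'M[R]_(j, d) -> R := 'D_(delta_mx ik.1 ik.2) f.

Definition smooth (f : 'M[R]_(j, d) -> R) : Prop :=
  forall s : seq ('I_j * 'I_d),
    continuous (foldr partial f s) /\
    forall ik x, derivable (foldr partial f s) x (delta_mx ik.1 ik.2).

Definition test_function (Omega : set 'M[R]_(j, d)) (phi : 'M[R]_(j, d) -> R) :
    Prop :=
  smooth phi /\ exists K : set 'M[R]_(j, d),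
    [/\ compact K, K `<=` Omega & forall x, ~ K x -> phi x = 0].

End smooth.

(* Near each boundary point and for some coordinate k, E is one of the two sides
   of the graph of a smooth function of the other coordinates: gamma is
   evaluated after the k-th coordinate has been replaced by 0. *)
Definition smooth_boundary {R : realType} {d : nat} (E : set 'rV[R]_d) : Prop :=
  forall x, (closure E `\` E°) x ->
  exists (r : R) (k : 'I_d) (sgn : bool) (gamma : 'rV[R]_d -> R),
    [/\ 0 < r, smooth gamma &
      forall y, ball x r y ->
        (E y <-> gamma (\row_i if i == k then 0 else y ord0 i) <
          (-1) ^+ sgn * y ord0 k)].

Section fisher.
Context {R : realType} {j d : nat}.
Local Notation leb := (lebesgue_mx R j d).

Definition W11 (Omega : set 'M[R]_(j, d)) (f : 'M[R]_(j, d) -> R)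
    (g : 'M[R]_(j, d) -> 'M[R]_(j, d)) : Prop :=
  leb.-integrable Omega (EFin \o f) /\
  forall i k, leb.-integrable Omega (fun x => (g x i k)%:E) /\
    forall phi, test_function Omega phi ->
      \int[leb]_(x in Omega) (f x * partial (i, k) phi x) =
      - \int[leb]_(x in Omega) (g x i k * phi x).

Definition has_density {Omega : set 'M[R]_(j, d)} {Omega0 : Omega !=set0}
    (F : Prob R (pts Omega0)) (f : 'M[R]_(j, d) -> R) : Prop :=
  forall A : set (borel 'M[R]_(j, d)), measurable A ->
    F [set x | A (pts_val x)] = (\int[leb]_(x in Omega `&` A) (f x)%:E)%E.

(* With the usual convention, the integrand is 0 where f vanishes (x / 0 = 0);
   there the weak gradient vanishes almost everywhere. *)
Definition fisher_integral (Omega : set 'M[R]_(j, d)) (f : 'M[R]_(j, d) -> R)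
    (g : 'M[R]_(j, d) -> 'M[R]_(j, d)) : \bar R :=
  ((j%:R^-1)%:E * \int[leb]_(x in Omega)
    ((\sum_i \sum_k g x i k ^+ 2) / f x)%:E)%E.

(* Normalized by the number j of rows, in particular by 1 on E itself. The
   density f and its weak gradient g are unique up to null sets, so the choice
   made by [cid] does not affect the value. *)
Definition fisher {Omega : set 'M[R]_(j, d)} {Omega0 : Omega !=set0}
    (F : Prob R (pts Omega0)) : \bar R :=
  if pselect (exists fg, has_density F fg.1 /\ W11 Omega fg.1 fg.2) is left h
  then fisher_integral Omega (sval (cid h)).1 (sval (cid h)).2
  else +oo%E.

End fisher.

Definition mean_fisher {R : realType} {d : nat} {E : set 'rV[R]_d}
    {E0 : E !=set0} (pi : Prob R (Prob R (pts E0))) : \bar R :=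
  (\int[pi]_rho fisher rho)%E.

(* Main.v *)
Require Import Defs.
From HB Require Import structures.
From mathcomp Require Import all_boot all_order all_algebra perm.
From mathcomp Require Import all_classical all_reals all_analysis measurable_realfun giry ring lra.

Set Implicit Arguments.
Unset Strict Implicit.
Unset Printing Implicit Defensive.
Import Order.TTheory GRing.Theory Num.Theory.
Import numFieldNormedType.Exports.

Local Open Scope classical_set_scope.
Local Open Scope ring_scope.

(** For a law F on E^j the Fisher information has a dual formula, [fisher_dual]: it
    is 1/j times the supremum, over the vector fields psi of test functions, of the
    integral of - div psi - |psi|^2 / 4 against F. For a density f with weak
    gradient g, integration by parts turns this integral into that of g . psi - f
    |psi|^2 / 4, which is at most the integral of |g|^2 / f by Young's inequality.
    Conversely, if these integrals are bounded above, then F is absolutely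
    continuous because its distributional derivatives are bounded measures
    ([null_of_bounded_derivative]), and a Hilbert space argument shows that its
    distributional gradient is H F with H in L^2 (F) ([dual_bounded_gradient]). The
    dual formula exhibits I as a supremum of integrals of continuous functions with
    compact support, and a sequence of them is enough ([dense_fields]). So I is the
    increasing limit of bounded weakly continuous functionals [lower_fisher n] on
    P(E), namely maxima of the means of finitely many integrands theta_k. By
    monotone convergence the mean Fisher information is the increasing limit of the
    integrals of the [lower_fisher n]. It is therefore lower semicontinuous; being
    the integral of a measurable nonnegative function, it is affine and nonnegative.

    I (pi_j) <= mean_fisher pi ([fisher_mixture_le]): in the dual formula for pi_j,
    the block of a test field that corresponds to the i-th point is, once the other
    points are frozen, a test field on E. When the points are independent with law
    rho, the i-th one has law rho given the others, so that this block contributes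
    at most I (rho).

    Lower bounds come from one construction ([fisher_ge_max_avg]). Let theta_k be
    the dual integrand of a field psi_k on E, k < n, and let U_k be its empirical
    mean over the N points. Insert in the dual formula for F^N the field that moves
    every point along the convex combination of the psi_k with weights softmax (lam
    U_k), cut off near the boundary. Moving one point changes the U_k by O(1/N), so
    that the derivatives of the weights contribute O(1/N) after normalization, and I
    (F^N) is at least the F^N-integral of max_k U_k minus n / lam minus C / N, where
    C does not depend on F^N.

    For F^j = pi_j this integral is at least that of [lower_fisher n] against pi, by
    Jensen's inequality. Let j, then lam and n tend to infinity: I (pi_j) tends to
    mean_fisher pi, which is also the supremum. For a sequence of symmetric F^N, the
    empirical means over all N points are close to those over the first j points, in
    mean square and uniformly in N ([exchangeable_variance]); the integral of the
    maximum over the first j points depends on F^N through its marginal F^N_j only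
    and converges to its value at pi_j as N tends to infinity. This gives the lower
    bound for the inferior limit.

    Throughout, laws on E^j are transported to the ambient space of matrices
    ([amb]). *)

(** * Smooth functions of a matrix *)

Section continuous_real.
Context {R : realType} {T : topologicalType}.
Implicit Types f g : T -> R.

Lemma continuous_addr f g : continuous f -> continuous g ->
  continuous (fun x => f x + g x).
Proof. by move=> cf cg x; apply: cvgD; [exact: cf|exact: cg]. Qed.

Lemma continuous_mulr f g : continuous f -> continuous g ->
  continuous (fun x => f x * g x).
Proof. by move=> cf cg x; apply: cvgM; [exact: cf|exact: cg]. Qed.

Lemma continuous_invr f : (forall x, f x != 0) -> continuous f ->
  continuous (fun x => (f x)^-1).
Proof. by move=> f0 cf x; apply: cvgV => //; exact: cf. Qed.

End continuous_real.

Section directional_derivative.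
Context {R : realType} {V : normedModType R}.
Implicit Types (f g : V -> R) (v x : V).

Lemma derive_slope f v x (h : R) :
  h^-1 *: ((f \o shift x) (h *: v) - f x) =
  h^-1 *: (((fun s : R => f (s *: v + x)) \o shift 0) (h *: (1 : R)) -
    (fun s : R => f (s *: v + x)) 0).
Proof. by rewrite /= addr0 scale0r add0r /shift /= [h *: 1]mulr1. Qed.

(** Derivatives of functions of a matrix reduce to derivatives of functions of a real
    variable along lines. *)
Lemma is_derive_line f v x (df : R) :
  is_derive x v f df <-> is_derive (0 : R) 1 (fun s : R => f (s *: v + x)) df.
Proof.
have E : (fun h : R => h^-1 *: ((f \o shift x) (h *: v) - f x)) =
  (fun h : R => h^-1 *: (((fun s : R => f (s *: v + x)) \o shift 0) (h *: (1 : R)) -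
    (fun s : R => f (s *: v + x)) 0)).
  by apply/funext => h; exact: derive_slope.
split=> -[cf lf]; split.
- by rewrite /derivable -E.
- by rewrite /derive -E.
- by rewrite /derivable E.
- by rewrite /derive E.
Qed.

Lemma is_derive_line_at f v x (s df : R) :
  is_derive (s *: v + x) v f df -> is_derive s 1 (fun s : R => f (s *: v + x)) df.
Proof.
move=> /is_derive_line H.
have E : (fun s : R => f (s *: v + x)) =
    (fun t : R => f (t *: v + (s *: v + x))) \o (fun r : R => r - s).
  by apply/funext => r /=; rewrite addrA -scalerDl subrK.
rewrite E.
have H' : is_derive (s - s) (1 : R) (fun t : R => f (t *: v + (s *: v + x))) df.
  by rewrite subrr.
have H2 : is_derive s (1 : R) (fun r : R => r - s) 1.
  by apply: is_derive_eq; rewrite subr0.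
have := @is_derive1_comp _ _ (fun r : R => r - s) s df 1 H' H2.
by rewrite mulr1.
Qed.

Lemma is_derive_comp_real (g : R -> R) f v x (dg df : R) :
  is_derive (f x) 1 g dg -> is_derive x v f df ->
  is_derive x v (g \o f) (dg * df).
Proof.
move=> H1 /is_derive_line H2; apply/is_derive_line.
apply: (@is_derive1_comp _ g (fun s : R => f (s *: v + x)) 0 dg df) => //.
by rewrite /= scale0r add0r.
Qed.

Lemma is_derive_translate f v x y df :
  is_derive (x + y) v f df -> is_derive x v (fun z => f (z + y)) df.
Proof.
move=> /is_derive_line H; apply/is_derive_line.
by under eq_fun do rewrite -addrA.
Qed.

End directional_derivative.

Section smooth_calculus.
Context {R : realType} {j d : nat}.
Local Notation M := 'M[R]_(j, d).
Implicit Types (f g : M -> R) (ik : 'I_j * 'I_d).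

Lemma partialE f ik g : (forall x, is_derive x (delta_mx ik.1 ik.2) f (g x)) ->
  partial ik f = g.
Proof. by move=> H; apply/funext => x; rewrite /partial derive_val. Qed.

Lemma smooth_step f : smooth f <->
  continuous f /\ forall ik, (forall x, derivable f x (delta_mx ik.1 ik.2)) /\
    smooth (partial ik f).
Proof.
split=> [sf|[cf sf] s].
  split; first exact: (sf [::]).1.
  move=> ik; split=> [x|s]; first exact: (sf [::]).2.
  by have := sf (rcons s ik); rewrite foldr_rcons.
elim/last_ind: s => [|s ik _] /=.
  by split=> // ik x; exact: (sf ik).1.
by rewrite foldr_rcons; exact: (sf ik).2.
Qed.

(** Smoothness of a function built by a formula is shown by induction on the
    number of derivatives still to be taken: the derivative is again built by
    such a formula. *)
Fixpoint diff_upto (n : nat) f : Prop :=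
  continuous f /\
  if n is n'.+1 then forall ik, (forall x, derivable f x (delta_mx ik.1 ik.2)) /\
    diff_upto n' (partial ik f)
  else True.

Lemma smooth_upto f : smooth f <-> forall n, diff_upto n f.
Proof.
split=> [sf n|Hf s].
  elim: n f sf => [|n ih] f /smooth_step[cf sf] //=; split=> // ik.
  by split; [exact: (sf ik).1|exact/ih/(sf ik).2].
elim/last_ind: s f Hf => [|s ik ih] f Hf.
  split; first exact: (Hf 0%N).1.
  by move=> ik x; exact: ((Hf 1%N).2 ik).1.
rewrite foldr_rcons; apply: ih => n.
exact: ((Hf n.+1).2 ik).2.
Qed.

Lemma diff_uptoS n f : diff_upto n.+1 f -> diff_upto n f.
Proof.
elim: n f => [|n ih] f [cf Hf]; split => // ik.
by split; [exact: (Hf ik).1|apply: ih; exact: (Hf ik).2].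
Qed.

Lemma diff_uptoSP n f (g : 'I_j * 'I_d -> M -> R) : continuous f ->
  (forall ik x, is_derive x (delta_mx ik.1 ik.2) f (g ik x)) ->
  (forall ik, diff_upto n (g ik)) -> diff_upto n.+1 f.
Proof.
by move=> cf Hf Hg; split => // ik; split=> //; rewrite (partialE (Hf ik)).
Qed.

Lemma diff_upto_derive n f ik x : diff_upto n.+1 f ->
  is_derive x (delta_mx ik.1 ik.2) f (partial ik f x).
Proof. by move=> [_ /(_ ik)[H _]]; exact/derivableP. Qed.

Lemma diff_upto_continuous n f : diff_upto n f -> continuous f.
Proof. by case: n => [|n] []. Qed.

Lemma diff_upto_cst n (c : R) : diff_upto n (fun _ : M => c).
Proof.
elim: n c => [|n ih] c /=; first by split => // x; exact: cst_continuous.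
by apply: (@diff_uptoSP n _ (fun _ _ => 0)) => // x; exact: cst_continuous.
Qed.

Lemma diff_uptoD n f g : diff_upto n f -> diff_upto n g ->
  diff_upto n (fun x => f x + g x).
Proof.
elim: n f g => [|n ih] f g Hf Hg.
  by split=> //; apply: continuous_addr; [exact: diff_upto_continuous Hf|exact: diff_upto_continuous Hg].
apply: (@diff_uptoSP n _ (fun ik x => partial ik f x + partial ik g x)).
- by apply: continuous_addr; [exact: diff_upto_continuous Hf|exact: diff_upto_continuous Hg].
- move=> ik x; have := diff_upto_derive ik x Hf; have := diff_upto_derive ik x Hg.
  by move=> ? ?; exact: is_deriveD.
- by move=> ik; apply: ih; [exact: (Hf.2 ik).2|exact: (Hg.2 ik).2].
Qed.

Lemma diff_uptoM n f g : diff_upto n f -> diff_upto n g ->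
  diff_upto n (fun x => f x * g x).
Proof.
elim: n f g => [|n ih] f g Hf Hg.
  by split=> //; apply: continuous_mulr; [exact: diff_upto_continuous Hf|exact: diff_upto_continuous Hg].
apply: (@diff_uptoSP n _ (fun ik x => f x * partial ik g x + g x * partial ik f x)).
- by apply: continuous_mulr; [exact: diff_upto_continuous Hf|exact: diff_upto_continuous Hg].
- move=> ik x; have := diff_upto_derive ik x Hf; have := diff_upto_derive ik x Hg.
  by move=> ? ?; exact: is_deriveM.
- move=> ik; apply: diff_uptoD; apply: ih.
  + exact: diff_uptoS.
  + exact: (Hg.2 ik).2.
  + exact: diff_uptoS.
  + exact: (Hf.2 ik).2.
Qed.

Lemma diff_upto_expR n f : diff_upto n f -> diff_upto n (fun x => expR (f x)).
Proof.
have cexp g : continuous g -> continuous (fun x : M => expR (g x)).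
  by move=> cg x; apply: (@continuous_comp _ _ _ g expR); [exact: cg|exact: continuous_expR].
elim: n f => [|n ih] f Hf.
  by split => //; apply: cexp; exact: diff_upto_continuous Hf.
apply: (@diff_uptoSP n _ (fun ik x => expR (f x) * partial ik f x)).
- by apply: cexp; exact: diff_upto_continuous Hf.
- move=> ik x; have Df := diff_upto_derive ik x Hf.
  exact: (is_derive_comp_real (is_derive_expR (f x)) Df).
- move=> ik; apply: diff_uptoM; first by apply: ih; exact: diff_uptoS.
  exact: (Hf.2 ik).2.
Qed.

Lemma diff_uptoV n f : (forall x, f x != 0) -> diff_upto n f ->
  diff_upto n (fun x => (f x)^-1).
Proof.
move=> f0.
elim: n f f0 => [|n ih] f f0 Hf.
  by split => //; apply: continuous_invr => //; exact: diff_upto_continuous Hf.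
apply: (@diff_uptoSP n _ (fun ik x => -1 * ((f x)^-1 * (f x)^-1) * partial ik f x)).
- by apply: continuous_invr => //; exact: diff_upto_continuous Hf.
- move=> ik x; have [D1 D2] := diff_upto_derive ik x Hf; split.
    exact: derivableV.
  rewrite (deriveV (f0 x) D1) D2 expr2 invfM mulN1r; exact: erefl.
- move=> ik; apply: diff_uptoM; last exact: (Hf.2 ik).2.
  have Hi : diff_upto n (fun x => (f x)^-1) by apply: ih => //; exact: diff_uptoS.
  by apply: diff_uptoM; [exact: diff_upto_cst|exact: diff_uptoM].
Qed.

(** [smooth] unfolds to a family of statements over sequences of directions,
    which proof search would explore at every step; this inductive copy of it
    is inert. *)
Inductive C_infty f : Prop := CInfty of smooth f.

Lemma C_inftyP f : C_infty f <-> smooth f.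
Proof. by split=> [[]|/CInfty]. Qed.

Lemma C_infty_upto f : C_infty f <-> forall n, diff_upto n f.
Proof. by split => [/C_inftyP/smooth_upto|/smooth_upto/C_inftyP]. Qed.

Lemma smooth_continuous f : C_infty f -> continuous f.
Proof. by move=> [/smooth_step[]]. Qed.

Lemma smooth_derivable f ik x : C_infty f -> derivable f x (delta_mx ik.1 ik.2).
Proof. by move=> [/smooth_step[_ /(_ ik)[]]]. Qed.

Lemma smooth_partial f ik : C_infty f -> C_infty (partial ik f).
Proof. by move=> [/smooth_step[_ /(_ ik)[_ /CInfty]]]. Qed.

Lemma smooth_is_derive f ik x : C_infty f ->
  is_derive x (delta_mx ik.1 ik.2) f (partial ik f x).
Proof. by move=> sf; apply/derivableP/smooth_derivable. Qed.

Lemma smooth_cst (c : R) : C_infty (fun _ : M => c).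
Proof. by apply/C_infty_upto => n; exact: diff_upto_cst. Qed.

Lemma smoothD f g : C_infty f -> C_infty g -> C_infty (fun x => f x + g x).
Proof. by move=> /C_infty_upto Hf /C_infty_upto Hg; apply/C_infty_upto => n; exact: diff_uptoD. Qed.

Lemma smoothM f g : C_infty f -> C_infty g -> C_infty (fun x => f x * g x).
Proof. by move=> /C_infty_upto Hf /C_infty_upto Hg; apply/C_infty_upto => n; exact: diff_uptoM. Qed.

Lemma smooth_expR f : C_infty f -> C_infty (fun x => expR (f x)).
Proof. by move=> /C_infty_upto Hf; apply/C_infty_upto => n; exact: diff_upto_expR. Qed.

Lemma smoothV f : (forall x, f x != 0) -> C_infty f -> C_infty (fun x => (f x)^-1).
Proof. by move=> f0 /C_infty_upto Hf; apply/C_infty_upto => n; exact: diff_uptoV. Qed.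

Lemma smoothZ c f : C_infty f -> C_infty (fun x => c * f x).
Proof. by move=> ?; apply: smoothM => //; exact: smooth_cst. Qed.

Lemma smoothN f : C_infty f -> C_infty (fun x => - f x).
Proof. by move=> sf; under eq_fun do rewrite -mulN1r; exact: smoothZ. Qed.

Lemma smoothB f g : C_infty f -> C_infty g -> C_infty (fun x => f x - g x).
Proof. by move=> sf sg; apply: smoothD => //; exact: smoothN. Qed.

Lemma smooth_sum (I : Type) (s : seq I) (F : I -> M -> R) :
  (forall i, C_infty (F i)) -> C_infty (fun x => \sum_(i <- s) F i x).
Proof.
move=> sF; elim: s => [|i s ih].
  by under eq_fun do rewrite big_nil; exact: smooth_cst.
by under eq_fun do rewrite big_cons; exact: smoothD.
Qed.

Lemma smooth_prod (I : Type) (s : seq I) (F : I -> M -> R) :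
  (forall i, C_infty (F i)) -> C_infty (fun x => \prod_(i <- s) F i x).
Proof.
move=> sF; elim: s => [|i s ih].
  by under eq_fun do rewrite big_nil; exact: smooth_cst.
by under eq_fun do rewrite big_cons; exact: smoothM.
Qed.

Lemma partialD f g ik : C_infty f -> C_infty g ->
  partial ik (fun x => f x + g x) = (fun x => partial ik f x + partial ik g x).
Proof.
move=> sf sg; apply: partialE => x.
by apply: is_deriveD; exact: smooth_is_derive.
Qed.

Lemma partialM f g ik : C_infty f -> C_infty g ->
  partial ik (fun x => f x * g x) = (fun x => f x * partial ik g x + g x * partial ik f x).
Proof.
move=> sf sg; apply: partialE => x.
by apply: is_deriveM; exact: smooth_is_derive.
Qed.

Lemma partial_cst (c : R) ik : partial ik (fun _ : M => c) = (fun=> 0).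
Proof. by apply: partialE => x; exact: is_derive_cst. Qed.

Lemma partialZ c f ik : C_infty f ->
  partial ik (fun x => c * f x) = (fun x => c * partial ik f x).
Proof.
move=> sf; rewrite partialM//; last exact: smooth_cst.
by rewrite partial_cst; apply/funext => x; rewrite mulr0 addr0.
Qed.

Lemma partial_sum (I : Type) (s : seq I) (F : I -> M -> R) ik :
  (forall i, C_infty (F i)) ->
  partial ik (fun x => \sum_(i <- s) F i x) = (fun x => \sum_(i <- s) partial ik (F i) x).
Proof.
move=> sF; elim: s => [|i s ih].
  under eq_fun do rewrite big_nil.
  by rewrite partial_cst; apply/funext => x; rewrite big_nil.
under eq_fun do rewrite big_cons.
rewrite partialD//; last exact: smooth_sum.
by rewrite ih; apply/funext => x; rewrite big_cons.
Qed.

Lemma partial_expR f ik : C_infty f ->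
  partial ik (fun x => expR (f x)) = (fun x => expR (f x) * partial ik f x).
Proof.
move=> sf; apply: partialE => x.
exact: (is_derive_comp_real (is_derive_expR (f x)) (smooth_is_derive ik x sf)).
Qed.

Lemma partialV f ik : (forall x, f x != 0) -> C_infty f ->
  partial ik (fun x => (f x)^-1) = (fun x => - (f x)^-1 * (f x)^-1 * partial ik f x).
Proof.
move=> f0 sf; apply: partialE => x.
have [D1 D2] := smooth_is_derive ik x sf; split; first exact: derivableV.
rewrite (deriveV (f0 x) D1) D2 expr2 invfM -mulNr; exact: erefl.
Qed.

Lemma near_partial f g ik x : (\forall y \near x, f y = g y) ->
  partial ik f x = partial ik g x.
Proof. by move=> fg; rewrite /partial; exact: near_eq_derive. Qed.

Lemma diff_upto_translate n f (y : M) : diff_upto n f ->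
  diff_upto n (fun x : M => f (x + y)).
Proof.
have ct (g : M -> R) : continuous g -> continuous (fun x : M => g (x + y)).
  move=> cg x; apply: (@continuous_comp _ _ _ (fun x : M => x + y) g); last exact: cg.
  by apply: (@continuousD _ _ _ (fun x : M => x) (fun=> y)); [move=> ?; exact|exact: cst_continuous].
elim: n f => [|n ih] f Hf; first by split=> //; apply: ct; exact: diff_upto_continuous Hf.
apply: (@diff_uptoSP n _ (fun ik x => partial ik f (x + y))).
- by apply: ct; exact: diff_upto_continuous Hf.
- by move=> ik x; apply: is_derive_translate; exact: (diff_upto_derive ik _ Hf).
- by move=> ik; apply: ih; exact: (Hf.2 ik).2.
Qed.

Lemma smooth_translate f y : C_infty f -> C_infty (fun x : M => f (x + y)).
Proof. by move=> /C_infty_upto Hf; apply/C_infty_upto => n; exact: diff_upto_translate. Qed.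

Lemma partial_translate f y ik : C_infty f ->
  partial ik (fun x : M => f (x + y)) = (fun x => partial ik f (x + y)).
Proof.
move=> sf; apply: partialE => x; apply: is_derive_translate.
exact: smooth_is_derive.
Qed.

End smooth_calculus.

(** * Bump functions and test functions *)

Section flat_function.
Context {R : realType}.

(** The functions x^-n exp (-1/x), extended by 0 to the negative half-line. They
    span a space stable under differentiation, which is how exp (-1/x) is seen
    to be smooth. *)
Definition flat (n : nat) (x : R) : R :=
  if 0 < x then x ^- n * expR (- x^-1) else 0.

Lemma flat_gt0 n x : 0 < x -> 0 < flat n x.
Proof. by move=> x0; rewrite /flat x0 mulr_gt0 ?expR_gt0// invr_gt0 exprn_gt0. Qed.

Lemma flat_le0 n x : x <= 0 -> flat n x = 0.
Proof. by move=> x0; rewrite /flat ltNge x0. Qed.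

Lemma flat_ge0 n x : 0 <= flat n x.
Proof. by have [/flat_le0->//|/(flat_gt0 n)/ltW] := leP x 0. Qed.

(** The quadratic bound that makes the functions [flat n] differentiable at 0. *)
Lemma flat_le n x : flat n x <= n.+2`!%:R * x ^+ 2.
Proof.
have [x0|x0] := leP x 0; first by rewrite flat_le0// mulr_ge0// sqr_ge0.
rewrite /flat x0 expRN.
have := @expR_ge1Dxn R x^-1 n.+1; rewrite invr_ge0 (ltW x0) => /(_ erefl) h.
have y0 : 0 < x^-1 ^+ n.+2 / n.+2`!%:R :> R.
  by rewrite divr_gt0// ?exprn_gt0 ?invr_gt0// ltr0n fact_gt0.
have /(ler_wpM2l (_ : 0 <= x ^- n)) : (expR x^-1)^-1 <= (x^-1 ^+ n.+2 / n.+2`!%:R)^-1.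
  rewrite lef_pV2 ?posrE ?expR_gt0//.
  by apply: le_trans h; rewrite lerDr.
rewrite invr_ge0 exprn_ge0 ?(ltW x0)// => /(_ erefl)/le_trans; apply.
rewrite invf_div exprVn invrK -(addn2 n) exprD mulrCA mulrA.
by rewrite -mulrA mulKf// expf_neq0// gt_eqF.
Qed.

Lemma is_derive_flat n x :
  is_derive x (1 : R) (flat n) (- n%:R * flat n.+1 x + flat n.+2 x).
Proof.
have [x0|x0|->] := ltgtP x 0.
- rewrite !flat_le0 ?ltW// mulr0 addr0.
  apply: (@near_eq_is_derive _ _ _ (cst 0)).
  near=> y; rewrite flat_le0//= ltW//.
  by near: y; exact: lt_nbhsl.
- have xn0 : x != 0 by rewrite gt_eqF.
  have DV : is_derive x (1 : R) (fun y => y^-1) (- x ^- 2).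
    have := @is_deriveV R id x 1 1 xn0 (is_derive_id _ _).
    by rewrite [_ *: _]mulr1.
  have D1 := is_deriveX n DV.
  have D2 : is_derive x (1 : R) (fun y => expR (- y^-1)) (expR (- x^-1) * x ^- 2).
    apply: (@is_derive1_comp _ expR (fun y => - y^-1)).
    by have := is_deriveN DV; rewrite opprK.
  have := is_deriveM D1 D2.
  move=> D3.
  apply: (near_eq_is_derive _ (is_derive_eq D3 _)).
    near=> y; have y0 : 0 < y by near: y; exact: lt_nbhsr.
    by rewrite /flat y0 mulrfctE exprfctE exprVn.
  rewrite exprfctE /flat x0 /GRing.scale /=.
  have xX m : x ^- m.+1 = x ^- m * x^-1 by rewrite -exprVn exprSr exprVn.
  rewrite !exprVn !xX.
  have nE : n%:R * x ^- n.-1 = n%:R * (x ^- n * x).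
    case: n {D1 D3} => [|n]; first by rewrite !mul0r.
    by rewrite xX divfK.
  rewrite mulNr nE expr0 invr1 mul1r; set a := x ^- n; set e := expR _.
  by field.
(* The difference quotient at 0 is at most a multiple of |h|, by [flat_le]. *)
- rewrite !flat_le0// mulr0 addr0.
  have H : (fun h : R => h^-1 *: ((flat n \o shift 0) (h *: (1 : R)) - flat n 0)) @ 0^' --> (0 : R).
    have E : (fun h : R => h^-1 *: ((flat n \o shift 0) (h *: (1 : R)) - flat n 0)) =
        (fun h => h^-1 * flat n h).
      by apply/funext => h; rewrite /= addr0 [h *: 1]mulr1 (flat_le0 n (lexx 0)) subr0.
    rewrite E.
    apply: norm_cvg0.
    apply: (@squeeze_cvgr _ _ _ _ (cst 0) (fun h : R => n.+2`!%:R * `|h|)).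
    + near=> h; rewrite normr_ge0 /= normrM (ger0_norm (flat_ge0 _ _)) normfV.
      have h0 : 0 < `|h| by rewrite normr_gt0; near: h; exact: nbhs_dnbhs_neq.
      rewrite ler_pdivrMl// mulrCA -expr2 real_normK ?num_real//.
      exact: flat_le.
    + exact: cvg_cst.
    + rewrite -[X in _ --> X](mulr0 n.+2`!%:R).
      apply: cvgM; first exact: cvg_cst.
      rewrite -[X in _ --> X](@normr0 _ R); apply: cvg_norm.
      exact: cvg_within.
  split; first by apply/cvg_ex; exists 0.
  exact: cvg_lim.
Unshelve. all: by end_near. Qed.

Lemma continuous_flat n : continuous (flat n).
Proof.
move=> x; apply/differentiable_continuous/derivable1_diffP.
by have [] := is_derive_flat n x.
Qed.

End flat_function.

Section bump.
Context {R : realType} {j d : nat}.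
Local Notation M := 'M[R]_(j, d).
Implicit Types (f g : M -> R) (c x : M) (r : R).

(** The derivative of [flat m] is a combination of functions of the same family, so
    that the induction on the number of derivatives is over all m at once. *)
Lemma diff_upto_flat n m f : diff_upto n f -> diff_upto n (fun x => flat m (f x)).
Proof.
have cflat m' g : continuous g -> continuous (fun x : M => flat m' (g x)).
  by move=> cg x; apply: (@continuous_comp _ _ _ g (flat m')); [exact: cg|exact: continuous_flat].
elim: n m f => [|n ih] m f Hf.
  by split => //; apply: cflat; exact: diff_upto_continuous Hf.
apply: (@diff_uptoSP _ _ _ n _ (fun ik x =>
    (- m%:R * flat m.+1 (f x) + flat m.+2 (f x)) * partial ik f x)).
- by apply: cflat; exact: diff_upto_continuous Hf.
- move=> ik x; have Df := diff_upto_derive ik x Hf.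
  exact: (is_derive_comp_real (is_derive_flat m (f x)) Df).
- move=> ik; apply: diff_uptoM; last exact: (Hf.2 ik).2.
  have Hn := diff_uptoS Hf.
  apply: diff_uptoD; last exact: ih.
  by apply: diff_uptoM; [exact: diff_upto_cst|exact: ih].
Qed.

Lemma smooth_flat m f : C_infty f -> C_infty (fun x => flat m (f x)).
Proof. by move=> /C_infty_upto Hf; apply/C_infty_upto => n; exact: diff_upto_flat. Qed.

Lemma is_derive_coord (i : 'I_j) (k : 'I_d) (v x : M) :
  is_derive x v (fun y : M => y i k) (v i k).
Proof.
apply/is_derive_line.
have -> : (fun s : R => (s *: v + x) i k) = (fun s : R => s * v i k + x i k).
  by apply/funext => s; rewrite !mxE.
have := is_deriveD (is_deriveM (@is_derive_id R R 0 1) (is_derive_cst (v i k : R) (0 : R) (1 : R)))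
  (is_derive_cst (x i k : R) (0 : R) (1 : R)).
by move/is_derive_eq; apply; rewrite addr0 /GRing.scale /= mulr0 add0r mulr1.
Qed.

Lemma smooth_coord (i : 'I_j) (k : 'I_d) : C_infty (fun y : M => y i k).
Proof.
apply/C_infty_upto => -[|n].
  by split=> //; exact: coord_continuous.
apply: (@diff_uptoSP _ _ _ n _ (fun ik _ => delta_mx ik.1 ik.2 i k)).
- exact: coord_continuous.
- by move=> ik x; exact: is_derive_coord.
- by move=> ik; exact: diff_upto_cst.
Qed.

(** A smooth transition from 0 on the negative half-line to 1 beyond 1. *)
Definition transition (t : R) : R := flat 0 t / (flat 0 t + flat 0 (1 - t)).

Lemma transition_den_gt0 (t : R) : 0 < flat 0 t + flat 0 (1 - t).
Proof.
have [t0|t0] := leP t 0.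
  by rewrite ltr_wpDl ?flat_ge0// flat_gt0// subr_gt0 (le_lt_trans t0).
by rewrite ltr_wpDr ?flat_ge0// flat_gt0.
Qed.

Lemma transition_le0 t : t <= 0 -> transition t = 0.
Proof. by move=> t0; rewrite /transition flat_le0// mul0r. Qed.

Lemma transition_ge1 t : 1 <= t -> transition t = 1.
Proof.
move=> t1; rewrite /transition (@flat_le0 _ _ (1 - t)) ?subr_le0// addr0 divff//.
by rewrite gt_eqF// flat_gt0// (lt_le_trans _ t1).
Qed.

Lemma transition01 t : 0 <= transition t <= 1.
Proof.
rewrite divr_ge0 ?flat_ge0 ?(ltW (transition_den_gt0 _))//=.
by rewrite ler_pdivrMr ?transition_den_gt0// mul1r lerDl flat_ge0.
Qed.

Lemma smooth_transition f : C_infty f -> C_infty (fun x => transition (f x)).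
Proof.
move=> sf; apply: smoothM; first exact: smooth_flat.
apply: smoothV => [x|]; first by rewrite gt_eqF// transition_den_gt0.
apply: smoothD; first exact: smooth_flat.
apply: smooth_flat; apply: smoothB => //; exact: smooth_cst.
Qed.

(** Equal to 1 on the ball of radius r / 2 around c, and supported in the closed
    ball of radius r. Balls are cubes, hence the product over the entries. *)
Definition bump (c : M) (r : R) (x : M) : R :=
  \prod_i \prod_k transition (2 - 4 * ((x i k - c i k) / r) ^+ 2).

Lemma smooth_bump c r : C_infty (bump c r).
Proof.
apply: smooth_prod => i; apply: smooth_prod => k; apply: smooth_transition.
apply: smoothB; first exact: smooth_cst.
apply: smoothZ; under eq_fun do rewrite expr2.
have H : C_infty (fun x : M => (x i k - c i k) / r).
  apply: smoothM; last exact: smooth_cst.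
  by apply: smoothB; [exact: smooth_coord|exact: smooth_cst].
exact: smoothM.
Qed.

Lemma prodr01 (I : Type) (s : seq I) (F : I -> R) :
  (forall i, 0 <= F i <= 1) -> 0 <= \prod_(i <- s) F i <= 1.
Proof.
move=> F01; elim: s => [|i s /andP[? ?]]; first by rewrite big_nil ler01 lexx.
by have /andP[? ?] := F01 i; rewrite big_cons mulr_ge0//= mulr_ile1.
Qed.

Lemma bump01 c r x : 0 <= bump c r x <= 1.
Proof. by apply: prodr01 => i; apply: prodr01 => k; exact: transition01. Qed.

Lemma bump1 c r x : 0 < r -> (forall i k, `|x i k - c i k| < r / 2) -> bump c r x = 1.
Proof.
move=> r0 H; rewrite /bump big1// => i _; rewrite big1// => k _.
rewrite transition_ge1//.
suff: ((x i k - c i k) / r) ^+ 2 <= (2^-1 : R) ^+ 2 by lra.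
rewrite -[leLHS]real_normK ?num_real// lerXn2r ?nnegrE//.
by rewrite normrM normfV (gtr0_norm r0) ler_pdivrMr// mulrC ltW.
Qed.

Lemma bump0 c r x i k : 0 < r -> r < `|x i k - c i k| -> bump c r x = 0.
Proof.
move=> r0 H; rewrite /bump (bigD1 i)//= (bigD1 k)//= transition_le0 ?mul0r//.
suff: (1 : R) ^+ 2 <= ((x i k - c i k) / r) ^+ 2 by lra.
rewrite -[leRHS]real_normK ?num_real// lerXn2r ?nnegrE//.
by rewrite normrM normfV (gtr0_norm r0) ler_pdivlMr// mul1r ltW.
Qed.

Lemma matrix_continuous (T : topologicalType) (f : T -> M) :
  (forall i k, continuous (fun t => f t i k)) -> continuous f.
Proof.
move=> cf t; apply/cvg_ballP => e e0.
have H : \forall t' \near t, forall ik : 'I_j * 'I_d, ball (f t ik.1 ik.2) e (f t' ik.1 ik.2).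
  apply: filter_forall => ik.
  by have /cvg_ballP/(_ _ e0) := cf ik.1 ik.2 t.
near=> t'; split => // i k.
by have := near H t'; move=> /(_ _)/(_ (i, k)); apply.
Unshelve. all: by end_near. Qed.

Definition cube (c : M) (r : R) : set M := [set x | forall i k, `|x i k - c i k| <= r].

Lemma compact_cube c r : compact (cube c r).
Proof.
pose B := [set v : 'rV[R]_(j * d) | forall l, v ord0 l \in `[(mxvec c ord0 l - r), (mxvec c ord0 l + r)]].
have cB : compact B.
  by apply: (@rV_compact R _ (fun l => `[(mxvec c ord0 l - r), (mxvec c ord0 l + r)]%classic)) => l; exact: segment_compact.
have -> : cube c r = (@vec_mx R j d) @` B.
  apply/seteqP; split=> [x xc|_ [v Bv <-] i k].
    exists (mxvec x); last by rewrite mxvecK.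
    move=> l /=; case/mxvec_indexP: l => i k; rewrite !mxvecE in_itv/=.
    by have := xc i k; rewrite ler_distl.
  have := Bv (mxvec_index i k); rewrite mxvecE in_itv/= => H.
  by rewrite mxE ler_distl.
apply: continuous_compact => //; apply: continuous_subspaceT.
apply: matrix_continuous => i k; under eq_fun do rewrite mxE.
exact: coord_continuous.
Qed.

Lemma bounded_closed_compact_mx (K : set M) (c : M) (r : R) :
  closed K -> K `<=` cube c r -> compact K.
Proof. by move=> cK Kc; apply: subclosed_compact Kc => //; exact: compact_cube. Qed.

Lemma ball_coordP (c x : M) r : 0 < r -> ball c r x <-> forall i k, `|x i k - c i k| < r.
Proof.
move=> r0; split=> [[_ H] i k|H]; first by have := H i k; rewrite /ball/= distrC.
by split => // i k; rewrite /ball/= distrC.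
Qed.

End bump.

Section test_functions.
Context {R : realType} {j d : nat}.
Local Notation M := 'M[R]_(j, d).
Implicit Types (phi psi : M -> R) (Omega : set M).

(** An inert copy of [test_function], for the same reason as [C_infty]. *)
Variant test Omega phi : Prop :=
  Test of C_infty phi & exists K : set M,
    [/\ compact K, K `<=` Omega & forall x, ~ K x -> phi x = 0].

Lemma testP Omega phi : test Omega phi <-> test_function Omega phi.
Proof. by split=> [[/C_inftyP]|[/C_inftyP]]. Qed.

Lemma test_smooth Omega phi : test Omega phi -> C_infty phi.
Proof. by case. Qed.

Lemma test_continuous Omega phi : test Omega phi -> continuous phi.
Proof. by case=> /smooth_continuous. Qed.

Lemma test0 Omega : test Omega (fun=> 0).
Proof.
split; first exact: smooth_cst.
by exists set0; split => //; exact: compact0.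
Qed.

Lemma testD Omega phi psi : test Omega phi -> test Omega psi ->
  test Omega (fun x => phi x + psi x).
Proof.
move=> [s1 [K1 [c1 K1O z1]]] [s2 [K2 [c2 K2O z2]]]; split; first exact: smoothD.
exists (K1 `|` K2); split; first exact: compactU.
  by rewrite subUset.
by move=> x /not_orP[? ?]; rewrite z1// z2// addr0.
Qed.

Lemma testMl Omega phi psi : test Omega phi -> C_infty psi ->
  test Omega (fun x => phi x * psi x).
Proof.
move=> [s1 [K1 [c1 K1O z1]]] s2; split; first exact: smoothM.
by exists K1; split => // x /z1->; rewrite mul0r.
Qed.

Lemma testMr Omega phi psi : C_infty psi -> test Omega phi ->
  test Omega (fun x => psi x * phi x).
Proof. by move=> ? ?; under eq_fun do rewrite mulrC; exact: testMl. Qed.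

Lemma testZ Omega c phi : test Omega phi -> test Omega (fun x => c * phi x).
Proof. by move=> ?; apply: testMr => //; exact: smooth_cst. Qed.

Lemma testN Omega phi : test Omega phi -> test Omega (fun x => - phi x).
Proof. by move=> H; under eq_fun do rewrite -mulN1r; exact: testZ. Qed.

Lemma testB Omega phi psi : test Omega phi -> test Omega psi ->
  test Omega (fun x => phi x - psi x).
Proof. by move=> ? ?; apply: testD => //; exact: testN. Qed.

Lemma test_sum (I : Type) (s : seq I) Omega (F : I -> M -> R) :
  (forall i, test Omega (F i)) -> test Omega (fun x => \sum_(i <- s) F i x).
Proof.
move=> sF; elim: s => [|i s ih].
  by under eq_fun do rewrite big_nil; exact: test0.
by under eq_fun do rewrite big_cons; exact: testD.
Qed.

Lemma subset_test Omega Omega' phi : Omega `<=` Omega' -> test Omega phi -> test Omega' phi.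
Proof.
move=> OO [s [K [cK KO z]]]; split => //.
by exists K; split => //; exact: subset_trans OO.
Qed.

Lemma compact_mx_closed (K : set M) : compact K -> closed K.
Proof. by apply: compact_closed; exact: norm_hausdorff. Qed.

Lemma test_partial Omega phi ik : test Omega phi -> test Omega (partial ik phi).
Proof.
move=> [s [K [cK KO z]]]; split; first exact: smooth_partial.
exists K; split => // x Kx.
rewrite (@near_partial _ _ _ _ (fun=> 0)).
  by rewrite partial_cst.
have : open (~` K) by rewrite openC; exact: compact_mx_closed.
by rewrite openE => /(_ _ Kx); apply: filterS => y /z.
Qed.

Lemma compact_support_bounded phi (K : set M) : continuous phi -> compact K ->
  (forall x, ~ K x -> phi x = 0) -> exists2 B : R, 0 <= B & forall x, `|phi x| <= B.
Proof.
move=> cphi cK z.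
have : compact (phi @` K).
  by apply: continuous_compact => //; exact: continuous_subspaceT.
move=> /compact_bounded[B [_ HB]].
exists (`|B| + 1); first by rewrite addr_ge0.
move=> x; have [Kx|/z->] := pselect (K x); last by rewrite normr0 addr_ge0.
apply: HB; first by rewrite (le_lt_trans (ler_norm _))// ltrDl.
by exists x.
Qed.

Lemma test_bounded Omega phi : test Omega phi ->
  exists2 B : R, 0 <= B & forall x, `|phi x| <= B.
Proof.
move=> [/smooth_continuous cphi [K [cK _ z]]]; exact: compact_support_bounded cK z.
Qed.

End test_functions.

(** * Exhaustion of an open set by test functions *)

Section exhaustion.
Context {R : realType} {j d : nat}.
Local Notation M := 'M[R]_(j, d).
Variable (Omega : set M) (oOmega : open Omega).

(** Rational centers and radii make the bumps countable, hence a sequence. *)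
Definition ball_code : Type := ('M[rat]_(j, d) * rat)%type.
Definition code_center (q : ball_code) : M := \matrix_(i, k) ratr (q.1 i k).
Definition code_radius (q : ball_code) : R := ratr q.2.
Definition admissible (q : ball_code) : Prop :=
  0 < code_radius q /\ cube (code_center q) (code_radius q) `<=` Omega.

Definition nth_bump (n : nat) (x : M) : R :=
  if @unpickle ('M[rat]_(j, d) * rat)%type n is Some q then
    if `[< admissible q >] then bump (code_center q) (code_radius q) x else 0
  else 0.

Lemma test_nth_bump n : test Omega (nth_bump n).
Proof.
rewrite /nth_bump; case: unpickle => [q|]; last exact: test0.
case: asboolP => [[r0 qO]|_]; last exact: test0.
split; first exact: smooth_bump.
exists (cube (code_center q) (code_radius q)); split => //.
  exact: compact_cube.
move=> x /existsNP[i /existsNP[k /negP]]; rewrite -ltNge => H.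
exact: bump0 H.
Qed.

Lemma nth_bump01 n x : 0 <= nth_bump n x <= 1.
Proof.
rewrite /nth_bump; case: unpickle => [q|]; last by rewrite lexx ler01.
by case: asboolP => _; [exact: bump01|rewrite lexx ler01].
Qed.

Lemma ratr_close (a e : R) : 0 < e -> exists q : rat, `|a - ratr q| < e.
Proof.
move=> e0; have /rat_in_itvoo[q] : a - e < a + e by lra.
by rewrite in_itv/= => /andP[h1 h2]; exists q; rewrite ltr_norml; apply/andP; split; lra.
Qed.

Lemma nth_bump_cover x : Omega x -> exists n, \forall y \near x, nth_bump n y = 1.
Proof.
move=> Ox; have /nbhs_ballP[e /= e0 eO] : nbhs x Omega by apply: open_nbhs_nbhs.
have /rat_in_itvoo[r] : e / 4 < e / 2 by lra.
rewrite in_itv/= => /andP[r1 r2].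
have hc i k : exists q : rat, `|x i k - ratr q| < e / 16 by apply: ratr_close; lra.
pose q : ball_code := (\matrix_(i, k) sval (cid (hc i k)), r).
have qc i k : `|x i k - code_center q i k| < e / 16.
  by rewrite !mxE; case: cid.
have r0 : 0 < code_radius q by rewrite /code_radius/=; lra.
exists (pickle (q : ('M[rat]_(j, d) * rat)%type)).
have : nbhs x (ball x (e / 16)) by apply: nbhsx_ballx; lra.
apply: filterS => y /ball_coordP bxy.
rewrite /nth_bump pickleK ifT; last first.
  apply/asboolP; split => // z zq; apply: eO; apply/ball_coordP => // i k.
  have := qc i k; have := zq i k; rewrite /code_radius /= => h1 h2.
  rewrite -(subrK (code_center q i k) (z i k)) -addrA.
  rewrite (le_lt_trans (ler_normD _ _))// [X in _ + X]distrC; lra.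
apply: bump1 => // i k.
have /(_ _ i k) := bxy; have := qc i k; rewrite /code_radius /= => h1 h2.
rewrite -(subrK (x i k) (y i k)) -addrA.
rewrite (le_lt_trans (ler_normD _ _))//.
have : `|y i k - x i k| < e / 16 by apply: h2; lra.
lra.
Qed.

(** Unlike a sum of bumps, this form keeps its values in the unit interval; it is 1
    wherever one of the first n bumps is. *)
Definition exhaustion (n : nat) (x : M) : R := 1 - \prod_(l < n) (1 - nth_bump l x).

Lemma exhaustion01 n x : 0 <= exhaustion n x <= 1.
Proof.
have /andP[? ?] : 0 <= \prod_(l < n) (1 - nth_bump l x) <= 1.
  by apply: prodr01 => l; have /andP[? ?] := nth_bump01 l x; apply/andP; split; lra.
by rewrite /exhaustion; apply/andP; split; lra.
Qed.

Lemma test_exhaustion n : test Omega (exhaustion n).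
Proof.
elim: n => [|n ih].
  have -> : exhaustion 0 = fun=> 0.
    by apply/funext => x; rewrite /exhaustion big_ord0 subrr.
  exact: test0.
have -> : exhaustion n.+1 = fun x => exhaustion n x + nth_bump n x - exhaustion n x * nth_bump n x.
  by apply/funext => x; rewrite /exhaustion big_ord_recr/=; ring.
apply: testB; first by apply: testD => //; exact: test_nth_bump.
by apply: testMl => //; apply: test_smooth; exact: test_nth_bump.
Qed.

Lemma exhaustion_mono n m x : (n <= m)%N -> exhaustion n x = 1 -> exhaustion m x = 1.
Proof.
move=> nm; rewrite /exhaustion => h; have {}h : \prod_(l < n) (1 - nth_bump l x) = 0 by lra.
rewrite -(subnKC nm) big_split_ord/= h mul0r subr0//.
Qed.

Lemma exhaustion_point x : Omega x -> exists n, forall m, (n <= m)%N ->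
  \forall y \near x, exhaustion m y = 1.
Proof.
move=> /nth_bump_cover[n Hn]; exists n.+1 => m nm.
apply: filterS Hn => y yn; apply: exhaustion_mono nm _.
by rewrite /exhaustion big_ord_recr/= yn subrr mulr0 subr0.
Qed.

(** Finitely many bumps are enough, by compactness. *)
Lemma exhaustion_compact (K : set M) : compact K -> K `<=` Omega ->
  exists n, forall m, (n <= m)%N -> forall x, K x -> \forall y \near x, exhaustion m y = 1.
Proof.
move=> cK KO.
pose U (n : nat) : set M := [set x | exhaustion n x = 1]°.
have cov : K `<=` \bigcup_(n in [set: nat]) U n.
  move=> x /KO/exhaustion_point[n Hn]; exists n => //.
  by rewrite /U /interior /=; exact: Hn.
have := cK; rewrite compact_cover => /(_ nat setT U).
move=> /(_ _ cov)[n _|D _ KD]; first exact: open_interior.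
exists (\max_(n <- finmap.enum_fset D) n)%N => m Dm x /KD[n nD].
rewrite /U /interior /=; apply: filterS => y yn; apply: exhaustion_mono yn.
by apply: leq_trans Dm; apply: leq_bigmax_seq.
Qed.

Lemma exhaustion_cvg x : exhaustion n x @[n --> \oo] --> (\1_Omega x : R).
Proof.
have [Ox|nOx] := pselect (Omega x).
  rewrite indicE mem_set//; have [n Hn] := exhaustion_point Ox.
  apply: cvg_near_cst; exists n => // m /= nm.
  by have := nbhs_singleton (Hn m nm).
rewrite indicE memNset//; apply: cvg_near_cst; exists 0%N => // m _.
by have [_ [K [_ KO ->]]] := test_exhaustion m; last by move=> /KO.
Qed.

Lemma plateau (K : set M) : compact K -> K `<=` Omega ->
  exists eta, [/\ test Omega eta, (forall x, 0 <= eta x <= 1) &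
    forall x, K x -> \forall y \near x, eta y = 1].
Proof.
move=> cK KO; have [n Hn] := exhaustion_compact cK KO.
exists (exhaustion n); split; first exact: test_exhaustion.
  exact: exhaustion01.
exact: Hn.
Qed.

End exhaustion.

Section translation_of_tests.
Context {R : realType} {j d : nat}.
Local Notation M := 'M[R]_(j, d).
Implicit Types (Omega : set M).

Lemma compact_margin Omega (K : set M) : open Omega -> compact K -> K `<=` Omega ->
  exists2 r : R, 0 < r & forall x y, K x -> `|y| < r -> Omega (x + y).
Proof.
move=> oO cK KO.
pose U (n : nat) : set M := [set x | forall y, `|y| < n.+1%:R^-1 -> Omega (x + y)]°.
have cov : K `<=` \bigcup_(n in [set: nat]) U n.
  move=> x /KO Ox; have /nbhs_ballP[e /= e0 eO] : nbhs x Omega by apply: open_nbhs_nbhs.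
  have [n ne] : exists n : nat, n.+1%:R^-1 < e / 2.
    exists (Num.truncn (e / 2)^-1); rewrite invf_plt ?posrE//; last by lra.
    exact: truncnS_gt.
  exists n => //; rewrite /U /interior /=.
  have : nbhs x (ball x (e / 2)) by apply: nbhsx_ballx; lra.
  apply: filterS => z xz y yn; apply: eO.
  move: xz; rewrite -!ball_normE /ball_ /= => xz.
  rewrite opprD addrA (le_lt_trans (ler_normB _ _))//.
  by apply: lt_le_trans (ltrD xz (lt_trans yn ne)) _; rewrite -splitr.
have := cK; rewrite compact_cover => /(_ nat setT U).
move=> /(_ _ cov)[n _|D _ KD]; first exact: open_interior.
exists ((\max_(n <- finmap.enum_fset D) n).+1%:R^-1); first by rewrite invr_gt0.
move=> x y /KD[n nD] Ux yn.
have := nbhs_singleton Ux; apply; apply: lt_le_trans yn _.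
rewrite lef_pV2 ?posrE// ler_nat ltnS.
by apply: leq_bigmax_seq.
Qed.

Lemma test_translate Omega Omega' phi (K : set M) y : C_infty phi -> compact K ->
  (forall x, ~ K x -> phi x = 0) -> (forall x, K x -> Omega' (x - y)) ->
  test Omega' (fun x => phi (x + y)).
Proof.
move=> sphi cK z KO; split; first exact: smooth_translate.
exists ((fun x : M => x - y) @` K); split.
- apply: continuous_compact => //; apply: continuous_subspaceT => x.
  by apply: (@continuousB _ _ _ (fun x : M => x) (fun=> y)); [move=> ?; exact|exact: cst_continuous].
- by move=> _ [x Kx <-]; exact: KO.
- move=> x Kx; apply: z => Kxy; apply: Kx; exists (x + y) => //.
  by rewrite addrK.
Qed.

End translation_of_tests.

(** * Integrals and Lebesgue measure on spaces of matrices *)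

Section integral_helpers.
Context {disp : measure_display} {T : measurableType disp} {R : realType}.
Variable mu : {measure set T -> \bar R}.
Implicit Types (D : set T) (f g h u : T -> R).

Lemma measurable_abs_EFin D f : measurable_fun D f ->
  measurable_fun D (fun x => (`|f x|)%:E : \bar R).
Proof. by move=> mf; apply/measurable_EFinP; exact: measurableT_comp. Qed.

Lemma le_integral_norm2 D f g h : measurable D ->
  measurable_fun D f -> measurable_fun D g -> measurable_fun D h ->
  (forall x, D x -> `|h x| <= `|f x| + `|g x|) ->
  (\int[mu]_(x in D) (`|h x|)%:E <=
   \int[mu]_(x in D) (`|f x|)%:E + \int[mu]_(x in D) (`|g x|)%:E)%E.
Proof.
move=> mD mf mg mh H; rewrite -ge0_integralD//; last 2 first.
- exact: measurable_abs_EFin.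
- exact: measurable_abs_EFin.
apply: ge0_le_integral => //.
- exact: measurable_abs_EFin.
- by apply: emeasurable_funD; exact: measurable_abs_EFin.
Qed.

Lemma le_integral_norm D f g : measurable D ->
  measurable_fun D f -> measurable_fun D g ->
  (forall x, D x -> `|f x| <= `|g x|) ->
  (\int[mu]_(x in D) (`|f x|)%:E <= \int[mu]_(x in D) (`|g x|)%:E)%E.
Proof.
by move=> mD mf mg H; apply: ge0_le_integral => //; exact: measurable_abs_EFin.
Qed.

Lemma dominated_cvg_norm0 D (u : nat -> T -> R) (G : T -> R) : measurable D ->
  (forall n, measurable_fun D (u n)) -> mu.-integrable D (EFin \o G) ->
  (forall n x, D x -> `|u n x| <= G x) ->
  (forall x, D x -> u n x @[n --> \oo] --> 0) ->
  (\int[mu]_(x in D) (`|u n x|)%:E @[n --> \oo] --> 0)%E.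
Proof.
move=> mD mu_ iG uG u0.
rewrite -(@integral0 _ _ _ mu D).
apply: (@dominated_cvg _ _ _ mu D mD (fun n x => (`|u n x|)%:E) (cst 0%E) (EFin \o G)) => //.
- by move=> n; exact: measurable_abs_EFin.
- move=> x Dx; apply: cvg_EFin; first by near=> n.
  rewrite -[X in _ --> X](@normr0 _ R).
  by apply: cvg_norm; exact: u0.
- by move=> n x Dx; rewrite /= lee_fin normr_id; exact: uG.
Unshelve. all: by end_near. Qed.

Lemma cvge0_lt (u : nat -> \bar R) (e : R) : (u n @[n --> \oo] --> 0)%E -> 0 < e ->
  exists n, forall m, (n <= m)%N -> (u m < e%:E)%E.
Proof.
move=> u0 e0.
have : \forall n \near \oo, (u n < e%:E)%E.
  apply: (u0 [set y | (y < e%:E)%E]); apply: open_nbhs_nbhs; split; first exact: open_ereal_lt_ereal.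
    by rewrite /= lte_fin.
by move=> [n _ Hn]; exists n => m nm; exact: Hn.
Qed.

(** Uniform integrability of a single function: up to a small error in the mean, g is
    bounded. *)
Lemma integrable_small D g (e : R) : measurable D -> mu.-integrable D (EFin \o g) ->
  0 < e -> exists2 del : R, 0 < del & forall u, measurable_fun D u ->
    (forall x, D x -> `|u x| <= 1) ->
    (\int[mu]_(x in D) (`|u x|)%:E < del%:E)%E ->
    (\int[mu]_(x in D) (`|g x * u x|)%:E < e%:E)%E.
Proof.
move=> mD ig e0.
have mg : measurable_fun D g by apply/measurable_EFinP/measurable_int; exact: ig.
pose v (n : nat) x := if `|g x| <= n%:R then 0 else g x.
have mv n : measurable_fun D (v n).
  apply: measurable_fun_if => //.
  - by apply: measurable_fun_ler => //; exact: measurableT_comp.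
  - by apply: measurable_funS mg.
have [n Hn] : exists n, forall m, (n <= m)%N -> (\int[mu]_(x in D) (`|v m x|)%:E < (e / 2)%:E)%E.
  apply: cvge0_lt; last by lra.
  apply: (@dominated_cvg_norm0 D v (fun x => `|g x|)) => //.
  - exact: integrable_norm.
  - by move=> m x _; rewrite /v; case: ifP => // _; rewrite normr0.
  - move=> x Dx; apply: cvg_near_cst.
    exists (Num.truncn `|g x|).+1 => // m /= nm.
    rewrite /v ifT// ltW// (lt_le_trans (truncnS_gt _))// ler_nat//.
exists (e / 2 / n.+1%:R); first by rewrite divr_gt0//; lra.
move=> u mu_ u1 udel.
have m1 : measurable_fun D (fun x => n.+1%:R * u x) by apply: measurable_funM.
have -> : e = e / 2 + e / 2 by lra.
apply: (@le_lt_trans _ _ (\int[mu]_(x in D) (`|n.+1%:R * u x|)%:E + \int[mu]_(x in D) (`|v n x|)%:E)%E).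
  apply: le_integral_norm2 => //; first exact: measurable_funM.
  move=> x Dx; rewrite /v !normrM; case: ifP => [gn|_].
    rewrite normr0 addr0 ler_wpM2r// (le_trans gn)// ger0_norm// ler_nat//.
  by rewrite ler_wpDl// ?mulr_ge0// ler_piMr// u1.
rewrite EFinD lteD//; last exact: Hn.
under eq_integral do rewrite normrM ger0_norm// EFinM.
rewrite ge0_integralZl_EFin//; last exact: measurable_abs_EFin.
rewrite muleC -lte_pdivlMr//.
Qed.

Lemma bounded_integrable D f (B : R) : measurable D -> (mu D < +oo)%E ->
  measurable_fun D f -> (forall x, D x -> `|f x| <= B) ->
  mu.-integrable D (EFin \o f).
Proof.
move=> mD muD mf fB; apply: measurable_bounded_integrable => //.
exists B; split; first exact: num_real.
by move=> M BM x Dx /=; rewrite (le_trans (fB _ Dx))// ltW.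
Qed.

End integral_helpers.

Section integral_mpush.
Context {R : realType} {d1 d2 : measure_display}.
Context {T1 : measurableType d1} {T2 : measurableType d2}.
Variables (phi : T1 -> T2) (mphi : measurable_fun [set: T1] phi).
Variable mu : {measure set T1 -> \bar R}.

Lemma ge0_integral_mpush (f : T2 -> \bar R) : measurable_fun [set: T2] f ->
  (forall y, 0 <= f y)%E -> (\int[mpush mphi mu]_y f y = \int[mu]_x f (phi x))%E.
Proof.
by move=> mf f0; rewrite (ge0_integral_pushforward mphi mu measurableT mf)// => ? _.
Qed.

Lemma integral_mpush (f : T2 -> R) : measurable_fun [set: T2] f ->
  mu.-integrable setT (EFin \o (f \o phi)) ->
  (\int[mpush mphi mu]_y (f y)%:E = \int[mu]_x (f (phi x))%:E)%E.
Proof.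
move=> mf intf.
by rewrite (@integral_pushforward _ _ _ _ _ phi mphi mu setT (EFin \o f))//; exact/measurable_EFinP.
Qed.

Lemma xsection_setE (A : set (T1 * T2)) x : xsection A x = [set t | A (x, t)].
Proof. by apply/seteqP; split=> t; rewrite /xsection /= in_setE. Qed.

End integral_mpush.

Section lebesgue_translation.
Context {R : realType}.
Local Notation leb1 := (@lebesgue_measure R).
Local Notation R1 := (measurableTypeR R).

Lemma measurable_addR (v : R) : measurable_fun [set: R1] (fun x : R1 => (x + v : R1)).
Proof. by apply: measurable_funD => //; exact: measurable_id. Qed.

Lemma lebesgue_translate (v : R) (A : set R1) : measurable A ->
  leb1 [set x | A (x + v)] = leb1 A.
Proof.
move=> mA; apply/esym.
apply: (@lebesgue_measure_unique R (mpush (measurable_addR v) leb1)) => // X /ocitvP[->|[[a b] /= ab ->]].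
  exact: etrans (measure0 _) (esym (measure0 (mpush (measurable_addR v) leb1))).
rewrite /mpush /= /pushforward.
rewrite (_ : _ @^-1` _ = `](a - v), (b - v)]%classic); last first.
  by apply/seteqP; split=> x /=; rewrite !in_itv/= => /andP[? ?]; apply/andP; split; lra.
rewrite !lebesgue_measure_itv/= !lte_fin ab ltrD2r ab.
by rewrite -!EFinB; congr (_%:E); lra.
Qed.

Lemma integral_translate1 (v : R) (f : R1 -> \bar R) : measurable_fun setT f ->
  (forall x, 0 <= f x)%E ->
  (\int[leb1]_x f (x + v)%R = \int[leb1]_x f x)%E.
Proof.
move=> mf f0.
rewrite -(ge0_integral_mpush (measurable_addR v))//.
by apply: eq_measure_integral => A mA _; exact: lebesgue_translate.
Qed.

Definition shift_tuple n (v t : n.-tuple R) : n.-tuple R1 :=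
  [tuple tnth t l + tnth v l | l < n].

(** By induction on n, from the translation invariance of each factor and of the
    measures of the sections. *)
Lemma tpower_translate n (v : n.-tuple R) (A : set (n.-tuple R1)) : measurable A ->
  tpower leb1 n [set t | A (shift_tuple v t)] = tpower leb1 n A.
Proof.
elim: n v A => [|n ih] v A mA.
  rewrite /=; congr (dirac _ _); apply/seteqP; split=> t /=.
    by rewrite (tuple0 t) (tuple0 (shift_tuple _ _)).
  by rewrite (tuple0 t) (tuple0 (shift_tuple _ _)).
have [v0 [v' ->]] : exists (v0 : R) (v' : n.-tuple R), v = [tuple of v0 :: v'].
  by exists (thead v), [tuple of behead v]; exact: tuple_eta.
have shiftE (x : R1) (t : n.-tuple R1) :
    shift_tuple [tuple of v0 :: v'] (tcons (x, t)) = tcons (x + v0, shift_tuple v' t).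
  apply: eq_from_tnth => l; rewrite tnth_mktuple; case: (unliftP ord0 l) => [l' ->|->].
    by rewrite !tnthS tnth_mktuple.
  by rewrite !tnth0.
have mt := @measurable_tcons _ R1 n.
have mtA : measurable (@tcons _ R1 n @^-1` A) by rewrite -[X in measurable X]setTI; exact: mt.
pose phi (x : R1) := tpower leb1 n (xsection (@tcons _ R1 n @^-1` A) x).
have mphi : measurable_fun [set: R1] phi.
  exact: (measurable_fun_xsection (tpower leb1 n) mtA).
rewrite /= /push_tcons /= /mpush /pushforward /= /product_measure1.
transitivity (\int[leb1]_x phi (x + v0)%R)%E.
  apply: eq_integral => x _ /=.
  rewrite /phi -[RHS](ih v'); last exact: measurable_xsection.
  congr (tpower leb1 n _); rewrite !xsection_setE.
  by apply/seteqP; split=> t /=; rewrite shiftE.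
by rewrite integral_translate1.
Qed.

End lebesgue_translation.

Section lebesgue_matrix.
Context {R : realType} {j d : nat}.
Local Notation M := 'M[R]_(j, d).
Local Notation leb := (lebesgue_mx R j d).

Lemma measurable_shift_mx (y : M) : measurable_fun [set: borel M] (fun x : borel M => (x + y : M) : borel M).
Proof.
apply: continuous_borel => x.
by apply: (@continuousD _ _ _ (fun x : M => x) (fun=> y)); [move=> ?; exact|exact: cst_continuous].
Qed.

Lemma lebesgue_mx_translate (y : M) (A : set (borel M)) : measurable A ->
  leb [set x : M | A (x + y)] = leb A.
Proof.
move=> mA; rewrite /lebesgue_mx /mpush /= /pushforward.
have mt := @measurable_mx_of_tuple R j d.
rewrite -[in RHS](@tpower_translate R _ [tuple mxvec y ord0 l | l < (j * d)%N]); last first.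
  by rewrite -[X in measurable X]setTI; exact: mt.
congr (tpower _ _ _).
have E (t : (j * d).-tuple (measurableTypeR R)) : (mx_of_tuple t : M) + y =
    mx_of_tuple (shift_tuple [tuple mxvec y ord0 l | l < (j * d)%N] t).
  by apply/matrixP => i k; rewrite !mxE !tnth_mktuple mxvecE.
by apply/seteqP; split=> t /=; rewrite E.
Qed.

Lemma integral_translate (y : M) (f : borel M -> \bar R) : measurable_fun setT f ->
  (forall x, 0 <= f x)%E ->
  (\int[leb]_x f ((x : M) + y : M)%R = \int[leb]_x f x)%E.
Proof.
move=> mf f0.
rewrite -(ge0_integral_mpush (measurable_shift_mx y))//.
by apply: eq_measure_integral => A mA _; exact: lebesgue_mx_translate.
Qed.

Lemma tpower_cube n (v : n.-tuple R) (r : R) : 0 <= r ->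
  tpower (@lebesgue_measure R) n [set t | forall l, `|tnth t l - tnth v l| <= r] =
  ((2 * r) ^+ n)%:E.
Proof.
move=> r0; elim: n v => [|n ih] v.
  by rewrite /= diracE mem_set// => -[].
have [v0 [v' ->]] : exists (v0 : R) (v' : n.-tuple R), v = [tuple of v0 :: v'].
  by exists (thead v), [tuple of behead v]; exact: tuple_eta.
rewrite /= /push_tcons /= /mpush /pushforward /=.
rewrite (_ : _ @^-1` _ = `[(v0 - r), (v0 + r)]%classic `*`
    [set t : n.-tuple (measurableTypeR R) | forall l, `|tnth t l - tnth v' l| <= r]); last first.
  apply/seteqP; split=> -[x t] /= => [H|[H1 H2] l].
    split; first by have := H ord0; rewrite !tnth0 in_itv/= ler_distl.
    by move=> l; have := H (lift ord0 l); rewrite !tnthS.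
  case: (unliftP ord0 l) => [l' ->|->]; first by rewrite !tnthS.
  by rewrite !tnth0; move: H1; rewrite in_itv/= ler_distl.
rewrite product_measure1E//; last first.
  rewrite (_ : mkset _ = \bigcap_(l in [set: 'I_n]) ((fun t : n.-tuple (measurableTypeR R) => tnth t l) @^-1`
     `[(tnth v' l - r), (tnth v' l + r)]%classic)); last first.
    apply/seteqP; split=> t /= H l.
      by move=> _; have := H l; rewrite /= in_itv/= ler_distl.
    by have := H l I; rewrite /= in_itv/= ler_distl.
  apply: fin_bigcap_measurable => [|l _]; first exact: finite_finset.
  by rewrite -[X in measurable X]setTI; exact: measurable_tnth.
rewrite ih exprS EFinM; congr (_ * _)%E.
rewrite [LHS]lebesgue_measure_itv/= lte_fin.
case: ifPn => [_|]; first by rewrite -EFinB; congr (_%:E); lra.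
by rewrite -leNgt => h; congr (_%:E); lra.
Qed.

Lemma lebesgue_cube (c : M) (r : R) : 0 <= r ->
  leb (cube c r) = ((2 * r) ^+ (j * d))%:E.
Proof.
move=> r0; rewrite -(@tpower_cube _ [tuple mxvec c ord0 l | l < (j * d)%N] r r0).
rewrite /lebesgue_mx /mpush /= /pushforward; congr (tpower _ _ _).
apply/seteqP; split=> t /= H.
  by move=> l; case/mxvec_indexP: l => i k; have := H i k; rewrite !mxE tnth_mktuple mxvecE.
by move=> i k; have := H (mxvec_index i k); rewrite !mxE tnth_mktuple mxvecE.
Qed.

Lemma closed_cube (c : M) r : closed (cube c r).
Proof. exact: (compact_mx_closed (@compact_cube _ _ _ c r)). Qed.

Lemma measurable_closed (K : set M) : closed K -> measurable (K : set (borel M)).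
Proof.
by move=> cK; rewrite -[K]setCK; apply: measurableC; apply: borel_open; rewrite openC.
Qed.

Lemma measurable_cube (c : M) r : measurable (cube c r : set (borel M)).
Proof. exact: (measurable_closed (@closed_cube c r)). Qed.

Lemma bounded_cube (K : set M) : compact K -> exists2 r : R, 0 <= r & K `<=` cube 0 r.
Proof.
move=> /compact_bounded[B [_ HB]]; exists (`|B| + 1); first by rewrite addr_ge0.
move=> x Kx i k; rewrite mxE subr0.
have := HB (`|B| + 1); rewrite (le_lt_trans (ler_norm _)) ?ltrDl// => /(_ erefl x Kx).
apply: le_trans.
have /mapP[l Hl ->] : `|x i k| \in [seq `|x y.1 y.2| | y : 'I_j * 'I_d].
  by apply/mapP; exists (i, k) => //=; rewrite mem_enum.
by rewrite [leRHS]/Num.norm /= mx_normrE; apply/bigmax_geP; right => /=; exists l.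
Qed.

Lemma lebesgue_compact_lty (K : set M) : compact K -> (leb K < +oo)%E.
Proof.
move=> cK; have [r r0 Kr] := bounded_cube cK.
apply: (@le_lt_trans _ _ (leb (cube 0 r))).
  apply: (@le_measure _ _ _ leb); rewrite ?inE//; last exact: measurable_cube.
  exact: (measurable_closed (compact_mx_closed cK)).
by rewrite lebesgue_cube// ltry.
Qed.

Let lebs : set (borel M) -> \bar R := leb.

Let lebs_sigma_finite : sigma_finite setT lebs.
Proof.
exists (fun n => cube 0 n%:R : set (borel M)).
  apply/seteqP; split => // x _.
  have [r r0 Hr] := bounded_cube (@compact_set1 M x).
  exists (Num.truncn r).+1 => // i k.
  by rewrite (le_trans (Hr x erefl i k))// ltW// truncnS_gt.
by move=> n; split; [exact: measurable_cube|rewrite /lebs lebesgue_cube// ltry].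
Qed.

HB.instance Definition _ := Measure.on lebs.
HB.instance Definition _ := Measure_isSigmaFinite.Build _ _ _ lebs lebs_sigma_finite.

(** Lebesgue measure with its structure of sigma-finite measure, for the theorems of
    Fubini and Radon-Nikodym. *)
Definition lebesgue_sf : {sigma_finite_measure set (borel M) -> \bar R} := lebs.

End lebesgue_matrix.

(** * Approximation of Borel sets by test functions *)

Section density_of_tests.
Context {R : realType} {j d : nat}.
Local Notation M := 'M[R]_(j, d).
Variable mu : {finite_measure set (borel M) -> \bar R}.
Variables (Omega : set M) (oOmega : open Omega).

Let mOmega : measurable (Omega : set (borel M)).
Proof. exact: borel_open. Qed.

Lemma measurable_continuous (f : M -> R) (D : set (borel M)) : continuous f -> measurable_fun D f.
Proof. by move=> cf; apply: measurable_funTS; exact: continuous_borelR. Qed.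

Lemma measurable_test (U : set M) (f : M -> R) (D : set (borel M)) : test U f -> measurable_fun D f.
Proof. by move=> /test_continuous; exact: measurable_continuous. Qed.

Definition test_approximable (A : set (borel M)) : Prop := forall e : R, 0 < e ->
  exists phi : M -> R, [/\ test Omega phi, (forall x, 0 <= phi x <= 1) &
    (\int[mu]_(x in Omega) (`|\1_A x - phi x|)%:E < e%:E)%E].

Lemma test_approximable_open (U : set M) : open U -> test_approximable U.
Proof.
move=> oU e e0.
have oUO : open (U `&` Omega) by exact: openI.
have [n Hn] : exists n, forall m, (n <= m)%N ->
    (\int[mu]_(x in Omega) (`|\1_U x - exhaustion (U `&` Omega) m x|)%:E < e%:E)%E.
  apply: cvge0_lt => //.
  apply: (@dominated_cvg_norm0 _ _ _ mu Omega (fun m x => \1_U x - exhaustion (U `&` Omega) m x) (cst 1)) => //.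
  - move=> n; apply: measurable_funB.
      by apply: measurable_indic; exact: borel_open.
    by apply: measurable_test; exact: test_exhaustion.
  - exact: finite_measure_integrable_cst.
  - move=> n x _; rewrite indicE; have /andP[? ?] := exhaustion01 (U `&` Omega) n x.
    by rewrite ler_norml /=; case: (x \in U) => /=; apply/andP; split; lra.
  - move=> x Ox; have -> : \1_U x = \1_(U `&` Omega) x :> R.
      by rewrite !indicE in_setI (mem_set Ox) andbT.
    rewrite -[X in _ --> X](subrr (\1_(U `&` Omega) x)).
    by apply: cvgB; [exact: cvg_cst|exact: exhaustion_cvg].
exists (exhaustion (U `&` Omega) n); split; last exact: Hn.
- apply: (subset_test _ (test_exhaustion (U `&` Omega) n)).
  exact: subIsetr.
- exact: exhaustion01.
Qed.

Lemma test_approximableC (A : set (borel M)) : measurable A ->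
  test_approximable A -> test_approximable (~` A).
Proof.
move=> mA HA e e0; have e20 : 0 < e / 2 by lra.
have [phi [tphi phi01 phie]] := HA _ e20.
have [eta [teta eta01 etae]] := test_approximable_open openT e20.
exists (fun x => eta x * (1 - phi x)); split.
- apply: testMl => //; apply: smoothB; first exact: smooth_cst.
  exact: test_smooth tphi.
- move=> x; have /andP[? ?] := phi01 x; have /andP[? ?] := eta01 x.
  by rewrite mulr_ge0 ?subr_ge0//= mulr_ile1// ?subr_ge0// gerBl.
- rewrite [e]splitr EFinD; apply: le_lt_trans (lteD etae phie).
  have m1 : measurable_fun (Omega : set (borel M)) (eta : borel M -> R) by exact: measurable_test teta.
  have m2 : measurable_fun (Omega : set (borel M)) (phi : borel M -> R) by exact: measurable_test tphi.
  apply: le_integral_norm2 => //.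
  + by apply: measurable_funB.
  + by apply: measurable_funB => //; exact: measurable_indic.
  + apply: measurable_funB; first by apply: measurable_indic; exact: measurableC.
    by apply: measurable_funM => //; apply: measurable_funB.
  + move=> x Ox; rewrite indicT /=.
    have -> : \1_(~` A) x - eta x * (1 - phi x) =
      (1 - \1_A x) * (1 - eta x) + eta x * (phi x - \1_A x) :> R.
      by rewrite !indicE in_setC; case: (x \in A) => /=; ring.
    rewrite (le_trans (ler_normD _ _))// lerD//.
      rewrite normrM ler_piMl// indicE; case: (x \in A) => /=.
        by rewrite subrr normr0.
      by rewrite subr0 normr1.
    have /andP[h1 h2] := eta01 x.
    by rewrite normrM distrC ler_piMl// ger0_norm.
Qed.

Lemma test_approximableU (A B : set (borel M)) : measurable A -> measurable B ->
  test_approximable A -> test_approximable B -> test_approximable (A `|` B).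
Proof.
move=> mA mB HA HB e e0; have e20 : 0 < e / 2 by lra.
have [phi [tphi phi01 phie]] := HA _ e20.
have [psi [tpsi psi01 psie]] := HB _ e20.
exists (fun x => phi x + psi x - phi x * psi x); split.
- apply: testB; first exact: testD.
  by apply: testMl => //; exact: test_smooth tpsi.
- move=> x; have /andP[? ?] := phi01 x; have /andP[? ?] := psi01 x.
  by apply/andP; split; nra.
- rewrite [e]splitr EFinD; apply: le_lt_trans (lteD phie psie).
  have m1 : measurable_fun (Omega : set (borel M)) (phi : borel M -> R) by exact: measurable_test tphi.
  have m2 : measurable_fun (Omega : set (borel M)) (psi : borel M -> R) by exact: measurable_test tpsi.
  apply: le_integral_norm2 => //.
  + by apply: measurable_funB => //; exact: measurable_indic.
  + by apply: measurable_funB => //; exact: measurable_indic.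
  + apply: measurable_funB; first by apply: measurable_indic; exact: measurableU.
    by apply: measurable_funB; [exact: measurable_funD|exact: measurable_funM].
  + move=> x Ox.
    have -> : \1_(A `|` B) x = \1_A x + \1_B x - \1_A x * \1_B x :> R.
      rewrite !indicE in_setU; case: (x \in A); case: (x \in B) => /=; lra.
    have -> : \1_A x + \1_B x - \1_A x * \1_B x - (phi x + psi x - phi x * psi x) =
      (\1_A x - phi x) * (1 - \1_B x) + (\1_B x - psi x) * (1 - phi x) :> R by ring.
    rewrite (le_trans (ler_normD _ _))// lerD//.
      rewrite normrM ler_piMr// indicE; case: (x \in B) => /=.
        by rewrite subrr normr0.
      by rewrite subr0 normr1.
    have /andP[h1 h2] := phi01 x.
    by rewrite normrM ler_piMr// ger0_norm; lra.
Qed.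

Lemma test_approximable_limit (A : (set (borel M))^nat) (B : set (borel M)) :
  (forall n, measurable (A n)) -> measurable B ->
  (forall x, \1_(A n) x @[n --> \oo] --> (\1_B x : R)) ->
  (forall n, test_approximable (A n)) -> test_approximable B.
Proof.
move=> mA mB AB HA e e0; have e20 : 0 < e / 2 by lra.
have [n Hn] : exists n, forall m, (n <= m)%N ->
    (\int[mu]_(x in Omega) (`|\1_B x - \1_(A m) x : R|)%:E < (e / 2)%:E)%E.
  apply: cvge0_lt => //.
  apply: (@dominated_cvg_norm0 _ _ _ mu Omega (fun m x => \1_B x - \1_(A m) x) (cst 1)) => //.
  - by move=> n; apply: measurable_funB; exact: measurable_indic.
  - exact: finite_measure_integrable_cst.
  - move=> n x _; rewrite !indicE ler_norml /=.
    by case: (x \in B); case: (x \in A n) => /=; apply/andP; split; lra.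
  - move=> x Ox; rewrite -[X in _ --> X](subrr (\1_B x)).
    by apply: cvgB; [exact: cvg_cst|exact: AB].
have [phi [tphi phi01 phie]] := HA n _ e20.
exists phi; split => //.
rewrite [e]splitr EFinD; apply: le_lt_trans (lteD (Hn n (leqnn n)) phie).
apply: le_integral_norm2 => //.
+ by apply: measurable_funB; exact: measurable_indic.
+ by apply: measurable_funB; [exact: measurable_indic|exact: measurable_test tphi].
+ by apply: measurable_funB; [exact: measurable_indic|exact: measurable_test tphi].
+ move=> x _; rewrite -[X in `|X| <= _](_ : \1_B x - \1_(A n) x + (\1_(A n) x - phi x) = _); last by ring.
  exact: ler_normD.
Qed.

(** The sets approximated in measure by test functions form a Dynkin system that
    contains the open sets, for which the exhaustion gives the approximation. *)
Lemma test_approximation (A : set (borel M)) : measurable A -> test_approximable A.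
Proof.
apply: (@dynkin_induction _ (borel M) open test_approximable) => //.
- by move=> B C; exact: openI.
- exact: test_approximable_open openT.
- by move=> B oB; exact: test_approximable_open.
- by move=> B mB; exact: test_approximableC.
- move=> F mF _ HF.
  apply: (@test_approximable_limit (fun n => \big[setU/set0]_(k < n) F k)) => //.
  + by move=> n; exact: bigsetU_measurable.
  + exact: bigcup_measurable.
  + move=> x; apply: cvg_near_cst; have [[n _ Fnx]|nF] := pselect ((\bigcup_k F k) x).
      exists n.+1 => // m /= nm; rewrite !indicE !mem_set//; first by exists n.
      by rewrite -bigcup_mkord; exists n.
    exists 0%N => // m _; rewrite /= !indicE !memNset// -bigcup_mkord => -[n _ Fnx].
    by apply: nF; exists n.
  + elim=> [|n ih].
      by rewrite big_ord0; exact: test_approximable_open open0.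
    rewrite big_ord_recr/=; apply: test_approximableU => //.
    exact: bigsetU_measurable.
Qed.

End density_of_tests.

Section finite_sum_measure.
Context {disp : measure_display} {T : measurableType disp} {R : realType}.
Variables nu1 nu2 : {finite_measure set T -> \bar R}.

Let add : set T -> \bar R := measure_add nu1 nu2.

Let add_fin : fin_num_fun add.
Proof.
by move=> U mU; rewrite /add measure_addE fin_numD !fin_num_measure.
Qed.

HB.instance Definition _ := Measure.on add.
HB.instance Definition _ := Measure_isFinite.Build _ _ _ add add_fin.

Definition fin_measure_add : {finite_measure set T -> \bar R} := add.

Lemma ge0_integral_fin_measure_add (D : set T) (f : T -> \bar R) : measurable D ->
  measurable_fun D f -> (forall x, D x -> 0 <= f x)%E ->
  (\int[fin_measure_add]_(x in D) f x =
   \int[nu1]_(x in D) f x + \int[nu2]_(x in D) f x)%E.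
Proof. by move=> mD mf f0; exact: ge0_integral_measure_add. Qed.

End finite_sum_measure.

Section restricted_integral.
Context {disp : measure_display} {T : measurableType disp} {R : realType}.
Variables (mu : {measure set T -> \bar R}) (B : set T) (mB : measurable B).
Hypothesis muB : (mu B < +oo)%E.

Lemma le_integral_mfrestr (D : set T) (f : T -> \bar R) : measurable D ->
  measurable_fun D f -> (forall x, D x -> 0 <= f x)%E ->
  (\int[mu]_(x in D `&` B) f x <= \int[mfrestr mB muB]_(x in D) f x)%E.
Proof.
move=> mD mf f0.
apply: (@le_trans _ _ (\int[mfrestr mB muB]_(x in D `&` B) f x)%E).
  rewrite le_eqVlt; apply/orP; left; apply/eqP; apply: eq_measure_integral => A mA AD.
  have AB : A `&` B = A by rewrite setIidl// => x /AD[].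
  by rewrite -[in LHS]AB.
by apply: ge0_subset_integral => //; exact: measurableI.
Qed.

End restricted_integral.

Section approximation_near_compact.
Context {R : realType} {j d : nat}.
Local Notation M := 'M[R]_(j, d).
Local Notation leb := (lebesgue_mx R j d).
Variable nu : {finite_measure set (borel M) -> \bar R}.
Variables (Omega : set M) (oOmega : open Omega) (K : set M).
Hypotheses (cK : compact K) (KO : K `<=` Omega).

(** Localized form of [test_approximation], for a finite measure and Lebesgue measure
    at the same time: multiply by a plateau, whose support does not depend on the
    precision. *)
Lemma test_approximation_compact : exists2 K' : set M, compact K' /\ K' `<=` Omega &
  forall (A : set (borel M)) (e : R), measurable A -> A `<=` K -> 0 < e ->
  exists phi : M -> R, [/\ test Omega phi, (forall x, 0 <= phi x <= 1),
    (forall x, ~ K' x -> phi x = 0),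
    (\int[nu]_(x in Omega) (`|\1_A x - phi x|)%:E < e%:E)%E &
    (\int[leb]_(x in Omega) (`|\1_A x - phi x|)%:E < e%:E)%E].
Proof.
have [eta [teta eta01 eta1]] := plateau oOmega cK KO.
have [seta [K' [cK' K'O z]]] := teta.
exists K' => // A e mA AK e0.
have mK' : measurable (K' : set (borel M)) by exact: (measurable_closed (compact_mx_closed cK')).
have lK' := lebesgue_compact_lty cK'.
have mO : measurable (Omega : set (borel M)) by exact: borel_open.
(* Restricted to the support of eta, Lebesgue measure is finite. *)
pose mu := fin_measure_add nu (mfrestr mK' lK').
have [phi0 [t0 phi01 Hphi]] := test_approximation mu oOmega mA e0.
have mphi0 : measurable_fun (Omega : set (borel M)) (phi0 : borel M -> R) by exact: measurable_test t0.
have meta : measurable_fun (Omega : set (borel M)) (eta : borel M -> R) by exact: measurable_test teta.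
have m1 : measurable_fun (Omega : set (borel M)) (fun x : borel M => \1_A x - phi0 x : R).
  by apply: measurable_funB => //; exact: measurable_indic.
have m2 : measurable_fun (Omega : set (borel M)) (fun x : borel M => \1_A x - eta x * phi0 x : R).
  by apply: measurable_funB; [exact: measurable_indic|exact: measurable_funM].
rewrite /mu ge0_integral_fin_measure_add// in Hphi; last exact: measurable_abs_EFin.
have E x : \1_A x - eta x * phi0 x = eta x * (\1_A x - phi0 x) :> R.
  rewrite mulrBr; congr (_ - _); rewrite indicE; case: (boolP (x \in A)) => [|_].
    by rewrite inE => /AK/eta1/nbhs_singleton->; rewrite mul1r.
  by rewrite mulr0.
have le1 x : `|\1_A x - eta x * phi0 x| <= `|\1_A x - phi0 x| :> R.
  rewrite E normrM; have /andP[h1 h2] := eta01 x.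
  by rewrite ger0_norm// ler_piMl.
exists (fun x => eta x * phi0 x); split.
- by apply: testMl => //; exact: test_smooth t0.
- move=> x; have /andP[? ?] := phi01 x; have /andP[? ?] := eta01 x.
  by rewrite mulr_ge0//= mulr_ile1.
- by move=> x /z ->; rewrite mul0r.
- apply: le_lt_trans Hphi.
  apply: (@le_trans _ _ (\int[nu]_(x in Omega) (`|\1_A x - phi0 x|)%:E)%E).
    by apply: le_integral_norm.
  by rewrite leeDl// integral_ge0.
- apply: le_lt_trans Hphi.
  apply: (@le_trans _ _ (\int[leb]_(x in Omega `&` K') (`|\1_A x - phi0 x|)%:E)%E); last first.
    apply: le_trans (le_integral_mfrestr _ _ _ _ _) _ => //.
      exact: measurable_abs_EFin.
    by rewrite leeDr// integral_ge0.
  rewrite [leLHS](_ : _ = \int[leb]_(x in Omega `&` K') (`|\1_A x - eta x * phi0 x|)%:E)%E.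
    apply: le_integral_norm => //; first exact: measurableI.
    + by apply: measurable_funS m2 => //; exact: subIsetl.
    + by apply: measurable_funS m1 => //; exact: subIsetl.
  rewrite [RHS]integral_mkcondr; apply: eq_integral => x _.
  rewrite patchE; case: ifPn => //; rewrite notin_setE => /z etax.
  by rewrite E etax mul0r normr0.
Qed.

End approximation_near_compact.

(** * Translations of test functions *)

Section shifts_of_tests.
Context {R : realType} {j d : nat}.
Local Notation M := 'M[R]_(j, d).
Local Notation leb := (lebesgue_mx R j d).
Implicit Types (Omega : set M) (phi : M -> R) (ik : 'I_j * 'I_d).
Local Notation dir ik := (delta_mx ik.1 ik.2 : M).

Lemma continuous_bounded_integrable (mu : {finite_measure set (borel M) -> \bar R})
    (u : M -> R) (B : R) : continuous u -> (forall x, `|u x| <= B) ->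
  mu.-integrable setT (EFin \o u).
Proof.
move=> cu uB; apply: (@bounded_integrable _ _ _ mu setT u B) => //.
  by rewrite -ge0_fin_numE// fin_num_measure.
exact: measurable_continuous.
Qed.

Lemma test_integrable (mu : {finite_measure set (borel M) -> \bar R}) Omega phi :
  test Omega phi -> mu.-integrable setT (EFin \o phi).
Proof.
move=> t; have [B _ HB] := test_bounded t.
exact: continuous_bounded_integrable (test_continuous t) HB.
Qed.

Lemma is_derive_test_line Omega phi ik x (s : R) : test Omega phi ->
  is_derive s 1 (fun s : R => phi (x + s *: dir ik)) (partial ik phi (x + s *: dir ik)).
Proof.
move=> t; under eq_fun do rewrite addrC.
rewrite addrC; apply: is_derive_line_at.
exact: smooth_is_derive (test_smooth t).
Qed.

Lemma continuous_line (u : M -> R) ik x : continuous u ->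
  continuous (fun s : R => u (x + s *: dir ik)).
Proof.
move=> cu s; apply: (@continuous_comp _ _ _ (fun s : R => x + s *: dir ik) u); last exact: cu.
apply: (@continuousD _ _ _ (fun=> x) (fun s : R => s *: dir ik)).
  exact: cst_continuous.
exact: scalel_continuous.
Qed.

Lemma continuous_translate (u : M -> R) (y : M) : continuous u ->
  continuous (fun x : M => u (x + y)).
Proof.
move=> cu x; apply: (@continuous_comp _ _ _ (fun x : M => x + y) u); last exact: cu.
by apply: (@continuousD _ _ _ (fun x : M => x) (fun=> y)); [move=> ?; exact|exact: cst_continuous].
Qed.

Section mean_value.
Variables (mu : {finite_measure set (borel M) -> \bar R}).
Variables (Omega : set M) (phi : M -> R) (ik : 'I_j * 'I_d).
Hypothesis tphi : test Omega phi.

Let h (s : R) : R := \int[mu]_x phi (x + s *: dir ik).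

Lemma is_derive_shift_integral (s : R) :
  is_derive s 1 h (\int[mu]_x partial ik phi (x + s *: dir ik)).
Proof.
have [B B0 HB] := test_bounded (test_partial ik tphi).
have [C C0 HC] := test_bounded tphi.
have d1E s' (y : M) : partial1of2 (fun s (x : borel M) => phi ((x : M) + s *: dir ik)) s' y =
    partial ik phi (y + s' *: dir ik).
  rewrite partial1of2E.
  by have [_ ->] := is_derive_test_line ik y s' tphi.
have Is : `]s - 1, s + 1[%classic s by rewrite /= in_itv/=; apply/andP; split; lra.
have intf x : mu.-integrable setT (EFin \o (fun y : borel M => phi ((y : M) + x *: dir ik))).
  apply: (@continuous_bounded_integrable mu _ C) => //.
  exact: continuous_translate (test_continuous tphi).
have D x (y : borel M) : derivable (fun s : R => phi ((y : M) + s *: dir ik)) x 1.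
  by have [] := is_derive_test_line ik y x tphi.
have iB : mu.-integrable setT (EFin \o cst B) by exact: finite_measure_integrable_cst.
have HB' x (y : borel M) : `|partial1of2 (fun s (x : borel M) => phi ((x : M) + s *: dir ik)) x y| <= B.
  by rewrite d1E.
have := @derivable_under_integral _ _ _ mu (fun s (x : borel M) => phi ((x : M) + s *: dir ik))
  setT measurableT s _ _ Is (fun x _ => intf x) (fun x y _ _ => D x y) (cst B) (fun=> B0) iB
  (fun x y _ _ => HB' x y).
have := @differentiation_under_integral _ _ _ mu (fun s (x : borel M) => phi ((x : M) + s *: dir ik))
  setT measurableT s _ _ Is (fun x _ => intf x) (fun x y _ _ => D x y) (cst B) (fun=> B0) iB
  (fun x y _ _ => HB' x y).
move=> H1 H2; split; first exact: H2.
have -> : 'D_1 h s = derive1 h s by rewrite derive1E.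
apply: etrans; first exact: H1.
by apply: eq_Rintegral => y _; exact: d1E.
Qed.

(** The integral over the translates of a test function is differentiable in the size
    of the translation, by dominated convergence. *)
Lemma shift_mean_value (t : R) : exists2 s : R, `|s| <= `|t| &
  \int[mu]_x phi (x + t *: dir ik) - \int[mu]_x phi x =
  t * \int[mu]_x partial ik phi (x + s *: dir ik).
Proof.
have h0 : \int[mu]_x phi x = h 0.
  by apply: eq_Rintegral => x _; rewrite scale0r addr0.
have ch : continuous h.
  move=> s; apply/differentiable_continuous/derivable1_diffP.
  by have [] := is_derive_shift_integral s.
rewrite h0 -/(h t); have [t0|t0] := leP 0 t.
  have [//|s' _||s] := @MVT_segment _ h (fun s => \int[mu]_x partial ik phi (x + s *: dir ik)) 0 t.
  - exact: is_derive_shift_integral.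
  - exact: continuous_subspaceT.
  rewrite in_itv/= => /andP[s0 st] ->; exists s; first by rewrite !ger0_norm.
  by rewrite subr0 mulrC.
have [|s' _||s] := @MVT_segment _ h (fun s => \int[mu]_x partial ik phi (x + s *: dir ik)) t 0.
- exact: ltW.
- exact: is_derive_shift_integral.
- exact: continuous_subspaceT.
rewrite in_itv/= => /andP[s0 st] E; exists s.
  by rewrite (ltr0_norm t0) ler0_norm// lerN2.
by rewrite -[LHS]opprB E sub0r mulrN opprK mulrC.
Qed.

End mean_value.

Lemma norm_dir ik : `|dir ik| <= 1.
Proof.
rewrite [leLHS]/Num.norm /= mx_normrE; apply/bigmax_leP; split => // -[i k] _ /=.
by rewrite mxE; case: (_ && _); rewrite ?normr1 ?normr0.
Qed.

Lemma shift_lipschitz Omega phi ik : test Omega phi ->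
  exists2 B : R, 0 <= B & forall x (s : R), `|phi (x + s *: dir ik) - phi x| <= B * `|s|.
Proof.
move=> t; have [B B0 HB] := test_bounded (test_partial ik t).
exists B => // x s.
pose g (s : R) := phi (x + s *: dir ik).
have cg : continuous g by exact: continuous_line (test_continuous t).
have Dg s' := is_derive_test_line ik x s' t.
have g0 : phi x = g 0 by rewrite /g scale0r addr0.
rewrite g0 -/(g s); have [s0|s0] := leP 0 s.
  have [//||c _ ->] := @MVT_segment _ g (fun s => partial ik phi (x + s *: dir ik)) 0 s.
  - exact: continuous_subspaceT.
  by rewrite subr0 normrM ler_wpM2r.
have [||c _ E] := @MVT_segment _ g (fun s => partial ik phi (x + s *: dir ik)) s 0.
- exact: ltW.
- exact: continuous_subspaceT.
by rewrite distrC E sub0r normrM normrN ler_wpM2r.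
Qed.

(** A test function is Lipschitz, and the differences vanish off a fixed cube. *)
Lemma shift_L1_lipschitz Omega phi ik : test Omega phi -> exists2 C : R, 0 <= C &
  forall s : R, `|s| <= 1 ->
  (\int[leb]_x (`|phi ((x : M) + s *: dir ik) - phi x|)%:E <= (C * `|s|)%:E)%E.
Proof.
move=> t; have [B B0 HB] := shift_lipschitz ik t.
have [_ [K [cK _ z]]] := t.
have [r r0 Kr] := bounded_cube cK.
have r10 : 0 <= r + 1 by rewrite addr_ge0.
exists (B * (2 * (r + 1)) ^+ (j * d)); first by rewrite mulr_ge0// exprn_ge0// mulr_ge0.
(* The extra margin 1 contains the supports of all the translates considered. *)
move=> s s1; pose Q : set (borel M) := cube 0 (r + 1).
have mQ : measurable Q by exact: measurable_cube.
have zQ (x : M) : ~ Q x -> `|phi (x + s *: dir ik) - phi x| = 0.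
  move=> nQx.
  have z1 : phi x = 0.
    by apply: z => /Kr Kx; apply: nQx => i k; rewrite (le_trans (Kx i k))// lerDl.
  have z2 : phi (x + s *: dir ik) = 0.
    apply: z => /Kr Kx; apply: nQx => i k.
    have := Kx i k; rewrite !mxE !subr0 => H.
    rewrite -(addrK (s * (delta_mx ik.1 ik.2 : M) i k) (x i k)).
    rewrite (le_trans (ler_normB _ _))//.
    move: H; rewrite !mxE => H; apply: lerD => //.
    case: (_ && _); first by rewrite mulr1.
    by rewrite mulr0 normr0.
  by rewrite z1 z2 subrr normr0.
have m1 : measurable_fun [set: borel M] (fun x : borel M => phi ((x : M) + s *: dir ik) - phi x).
  apply: measurable_funB; last exact: measurable_test t.
  by apply: measurable_continuous; exact: continuous_translate (test_continuous t).
apply: (@le_trans _ _ (\int[leb]_(x in Q) (`|phi ((x : M) + s *: dir ik) - phi x|)%:E)%E).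
  rewrite [leRHS]integral_mkcond le_eqVlt; apply/orP; left; apply/eqP.
  apply: eq_integral => x _; rewrite patchE; case: ifPn => //.
  by rewrite notin_setE => /zQ->.
apply: (@le_trans _ _ (\int[leb]_(x in Q) (B * `|s|)%:E)%E).
  apply: ge0_le_integral => //.
  - by apply: measurable_funTS; exact: measurable_abs_EFin.
  - by move=> x _; rewrite lee_fin.
rewrite integral_cst//.
have -> : leb Q = ((2 * (r + 1)) ^+ (j * d))%:E by exact: lebesgue_cube.
by rewrite -EFinM lee_fin mulrAC.
Qed.

Lemma test_shift_margin Omega (K : set M) : open Omega -> compact K -> K `<=` Omega ->
  exists2 r : R, 0 < r & forall phi, C_infty phi -> (forall x, ~ K x -> phi x = 0) ->
    forall y, `|y| < r -> test Omega (fun x => phi (x + y)).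
Proof.
move=> oO cK KO; have [r r0 Hr] := compact_margin oO cK KO.
exists r => // phi sphi z y yr.
by apply: (@test_translate _ _ _ Omega Omega _ K) => // x Kx; apply: Hr => //; rewrite normrN.
Qed.

End shifts_of_tests.

(** * Null sets and distributional derivatives *)

Section weak_derivative_null_sets.
Context {R : realType} {j d : nat}.
Local Notation M := 'M[R]_(j, d).
Local Notation leb := (lebesgue_mx R j d).
Local Notation dir ik := (delta_mx ik.1 ik.2 : M).
Variable m : {finite_measure set (borel M) -> \bar R}.
Variables (Omega : set M) (oOmega : open Omega).
Variables (K : set M) (cK : compact K) (KO : K `<=` Omega).

Let mO : measurable (Omega : set (borel M)).
Proof. exact: borel_open. Qed.

Lemma integrable_mul_bounded (g u : M -> R) (D : set (borel M)) : measurable D ->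
  leb.-integrable D (EFin \o g) -> measurable_fun D (u : borel M -> R) ->
  (exists B : R, forall x, D x -> `|u x| <= B) ->
  leb.-integrable D (EFin \o (fun x => g x * u x)).
Proof.
move=> mD ig mu_ [B HB].
have mg : measurable_fun D (g : borel M -> R) by apply/measurable_EFinP/measurable_int; exact: ig.
apply: (@le_integrable _ _ _ leb D mD _ (EFin \o (fun x => B * g x))).
- by apply/measurable_EFinP; exact: measurable_funM.
- move=> x Dx; rewrite /= lee_fin !normrM mulrC ler_wpM2r// (le_trans (HB x Dx))//.
  exact: ler_norm.
- exact: (@integrableZl _ _ _ leb D mD B _ ig).
Qed.

Lemma test_integral_near_null (mu : {measure set (borel M) -> \bar R}) (A : set (borel M))
    (phi : M -> R) : measurable A -> A `<=` Omega -> mu A = 0%E -> test Omega phi ->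
  (forall x, 0 <= phi x) ->
  (\int[mu]_x (phi x)%:E <= \int[mu]_(x in Omega) (`|\1_A x - phi x|)%:E)%E.
Proof.
move=> mA AO muA tphi phi0.
have mphi D : measurable_fun (D : set (borel M)) (phi : borel M -> R) by exact: measurable_test tphi.
have -> : (\int[mu]_x (phi x)%:E = \int[mu]_(x in Omega) (`|phi x|)%:E)%E.
  rewrite [RHS]integral_mkcond; apply: eq_integral => x _; rewrite patchE.
  case: ifPn => [_|]; first by rewrite ger0_norm.
  have [_ [K' [_ K'O z]]] := tphi.
  by rewrite notin_setE => nOx; rewrite z// => /K'O.
apply: (@le_trans _ _ (\int[mu]_(x in Omega) (`|\1_A x - phi x|)%:E +
    \int[mu]_(x in Omega) (`|\1_A x : R|)%:E)%E).
  apply: le_integral_norm2 => //.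
  - by apply: measurable_funB => //; exact: measurable_indic.
  - move=> x _; have := ler_normB (\1_A x - phi x) (\1_A x).
    by rewrite addrAC subrr sub0r normrN.
rewrite [X in (_ + X)%E](_ : _ = 0%E) ?adde0//.
under eq_integral do rewrite ger0_norm//.
by rewrite integral_indic// setIidl.
Qed.

Section weak_derivative.
Variables (g : M -> R) (ik : 'I_j * 'I_d).
Hypothesis ig : leb.-integrable (Omega : set (borel M)) (EFin \o g).
Hypothesis weak : forall phi, test Omega phi ->
  \int[m]_x partial ik phi x = - \int[leb]_(x in Omega) (g x * phi x).

Let mg : measurable_fun (Omega : set (borel M)) (g : borel M -> R).
Proof. by apply/measurable_EFinP/measurable_int; exact: ig. Qed.

Let G (u : M -> R) : R := \int[leb]_(x in Omega) (g x * u x).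

Let G_close (u v : M -> R) (e : R) :
  measurable_fun (Omega : set (borel M)) (u : borel M -> R) ->
  measurable_fun (Omega : set (borel M)) (v : borel M -> R) ->
  (forall x, 0 <= u x <= 1) -> (forall x, 0 <= v x <= 1) ->
  (\int[leb]_(x in Omega) (`|g x * (u x - v x)|)%:E < e%:E)%E -> `|G u - G v| <= e.
Proof.
move=> mu_ mv u01 v01 H.
have iu : leb.-integrable (Omega : set (borel M)) (EFin \o (fun x => g x * u x)).
  by apply: integrable_mul_bounded => //; exists 1 => x _; have /andP[h1 h2] := u01 x; rewrite ger0_norm.
have iv : leb.-integrable (Omega : set (borel M)) (EFin \o (fun x => g x * v x)).
  by apply: integrable_mul_bounded => //; exists 1 => x _; have /andP[h1 h2] := v01 x; rewrite ger0_norm.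
rewrite /G -RintegralB//.
have -> : \int[leb]_(x in Omega) (g x * u x - g x * v x) =
   \int[leb]_(x in Omega) (g x * (u x - v x)).
  by apply: eq_Rintegral => x _; rewrite mulrBr.
have iuv : leb.-integrable (Omega : set (borel M)) (EFin \o (fun x => g x * (u x - v x))).
  apply: integrable_mul_bounded => //; first exact: measurable_funB.
  exists 1 => x _; have /andP[h1 h2] := v01 x; have /andP[h3 h4] := u01 x.
  by rewrite ler_norml; apply/andP; split; lra.
apply: le_trans (le_normr_Rintegral mO iuv) _.
rewrite -lee_fin /Rintegral fineK; first exact: ltW.
by apply: integrable_fin_num => //; exact: integrable_norm.
Qed.

(** A test function phi close to the indicator of A has a small m-integral, which a
    translation by t along ik, in one sense or the other, can lower by no more than
    that amount. By the mean value theorem, the integral of g against some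
    intermediate translate of phi is then almost nonnegative and almost nonpositive,
    and for small t this translate is still close to the indicator of A. *)
Lemma weak_derivative_null_compact (A : set (borel M)) : measurable A -> A `<=` K ->
  m A = 0%E -> \int[leb]_(x in A) g x = 0.
Proof.
move=> mA AK mA0.
have -> : \int[leb]_(x in A) g x = G \1_A.
  rewrite /G [RHS](_ : _ = \int[leb]_(x in Omega) (g \_ A) x); last first.
    apply: eq_Rintegral => x _; rewrite patchE indicE.
    by case: ifP => _; rewrite ?mulr1 ?mulr0.
  by rewrite -Rintegral_mkcondr setIidr// => x /AK/KO.
have ind01 (x : M) : 0 <= (\1_A x : R) <= 1.
  by rewrite indicE; case: (x \in A) => /=; apply/andP; split.
have mind : measurable_fun (Omega : set (borel M)) (\1_A : borel M -> R) by exact: measurable_indic.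
suff H (sg : bool) (e : R) : 0 < e -> - (3 * e) <= (-1) ^+ sg * G \1_A.
  apply/eqP; rewrite eq_le; apply/andP; split; apply/ler_addgt0Pr => e e0.
    by have := H true (e / 3); rewrite divr_gt0// => /(_ erefl); rewrite expr1; lra.
  by have := H false (e / 3); rewrite divr_gt0// => /(_ erefl); rewrite expr0; lra.
move=> e0; have [del del0 Hdel] := integrable_small mO ig e0.
have [K' [cK' K'O] HK'] := test_approximation_compact m oOmega cK KO.
have [r r0 Hr] := test_shift_margin oOmega cK' K'O.
(* phi0 is fixed before the step t, which depends on its modulus of continuity in the
   mean; phi is chosen last, with an m-integral of at most t e. *)
have del8 : 0 < del / 8 by lra.
have [phi0 [t0 phi001 z0 _ d0]] := HK' A _ mA AK del8.
have [C C0 HC] := shift_L1_lipschitz ik t0.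
pose t := Num.min 1 (Num.min (r / 2) (del / (4 * (C + 1)))).
have t_gt0 : 0 < t.
  by rewrite /t !lt_min ltr01/=; apply/andP; split; rewrite divr_gt0//; lra.
have t_le1 : t <= 1 by rewrite ge_min lexx.
have t_ltr : t < r.
  rewrite /t !gt_min; apply/orP; right; apply/orP; left; lra.
have Ct : C * t <= del / 4.
  have : t <= del / (4 * (C + 1)) by rewrite /t !ge_min lexx !orbT.
  rewrite ler_pdivlMr//; last by lra.
  nra.
have e1 : 0 < Num.min (del / 8) (t * e) by rewrite lt_min del8/= mulr_gt0.
have [phi [tphi phi01 z nu1 d1]] := HK' A _ mA AK e1.
have mphi D : measurable_fun (D : set (borel M)) (phi : borel M -> R) by exact: measurable_test tphi.
have mphi0 D : measurable_fun (D : set (borel M)) (phi0 : borel M -> R) by exact: measurable_test t0.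
have phi_small : \int[m]_x phi x <= t * e.
  rewrite -lee_fin /Rintegral fineK; last first.
    by apply: integrable_fin_num => //; exact: test_integrable tphi.
  have AO : A `<=` Omega by move=> x /AK/KO.
  apply: le_trans (test_integral_near_null mA AO mA0 tphi _) _.
    by move=> x; have /andP[] := phi01 x.
  by rewrite (le_trans (ltW nu1))// lee_fin ge_min lexx orbT.
have close s : `|s| <= t -> `|G (fun x => phi (x + s *: dir ik)) - G \1_A| <= 2 * e.
  move=> st.
  pose phis (x : M) := phi (x + s *: dir ik).
  pose phi0s (x : M) := phi0 (x + s *: dir ik).
  have mphis D : measurable_fun (D : set (borel M)) (phis : borel M -> R).
    by apply: measurable_continuous; exact: continuous_translate (test_continuous tphi).
  have mphi0s D : measurable_fun (D : set (borel M)) (phi0s : borel M -> R).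
    by apply: measurable_continuous; exact: continuous_translate (test_continuous t0).
  have d1' : (\int[leb]_(x in Omega) (`|\1_A x - phi x|)%:E < (del / 8)%:E)%E.
    by apply: lt_le_trans d1 _; rewrite lee_fin ge_min lexx.
  have dd : (\int[leb]_(x in Omega) (`|phi x - phi0 x|)%:E < (del / 4)%:E)%E.
    have -> : del / 4 = del / 8 + del / 8 by lra.
    rewrite EFinD; apply: le_lt_trans (lteD d1' d0).
    apply: le_integral_norm2 => //.
    - exact: measurable_funB.
    - exact: measurable_funB.
    - exact: measurable_funB.
    - move=> x _; rewrite [X in `|X| <= _](_ : _ = (\1_A x - phi0 x) - (\1_A x - phi x)); last by ring.
      by rewrite [leRHS]addrC; exact: ler_normB.
  have dds : (\int[leb]_(x in Omega) (`|phis x - phi0s x|)%:E < (del / 4)%:E)%E.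
    apply: le_lt_trans dd.
    apply: (@le_trans _ _ (\int[leb]_x (`|phis x - phi0s x|)%:E)%E).
      apply: ge0_subset_integral => //.
      by apply: measurable_abs_EFin; exact: measurable_funB.
    rewrite (@integral_translate R j d (s *: dir ik) (fun x => (`|phi x - phi0 x|)%:E))//; last first.
      by apply: measurable_abs_EFin; exact: measurable_funB.
    rewrite [leRHS]integral_mkcond le_eqVlt; apply/orP; left; apply/eqP.
    apply: eq_integral => x _; rewrite patchE; case: ifPn => //.
    rewrite notin_setE => nOx.
    have nK'x : ~ K' x by move=> /K'O.
    by rewrite z// z0// subrr normr0.
  have d0s : (\int[leb]_(x in Omega) (`|phi0s x - phi0 x|)%:E <= (del / 4)%:E)%E.
    apply: (@le_trans _ _ (\int[leb]_x (`|phi0s x - phi0 x|)%:E)%E).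
      apply: ge0_subset_integral => //.
      by apply: measurable_abs_EFin; exact: measurable_funB.
    apply: le_trans (HC s _) _; first by rewrite (le_trans st).
    by rewrite lee_fin (le_trans _ Ct)// ler_wpM2l.
  have d0phi : (\int[leb]_(x in Omega) (`|phi0s x - phi x|)%:E <= (del / 4 + del / 4)%:E)%E.
    apply: (@le_trans _ _ (\int[leb]_(x in Omega) (`|phi0s x - phi0 x|)%:E +
       \int[leb]_(x in Omega) (`|phi x - phi0 x|)%:E)%E).
      apply: le_integral_norm2 => //.
      - exact: measurable_funB.
      - exact: measurable_funB.
      - exact: measurable_funB.
      - move=> x _; rewrite [X in `|X| <= _](_ : _ = (phi0s x - phi0 x) - (phi x - phi0 x)); last by ring.
        exact: ler_normB.
    by rewrite EFinD; apply: leeD => //; exact: ltW.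
  have dphi : (\int[leb]_(x in Omega) (`|phis x - phi x|)%:E < del%:E)%E.
    have -> : del = (del / 4 + del / 4) + (del / 4 + del / 4) by lra.
    apply: (@le_lt_trans _ _ (\int[leb]_(x in Omega) (`|phis x - phi0s x|)%:E +
       \int[leb]_(x in Omega) (`|phi0s x - phi x|)%:E)%E).
      apply: le_integral_norm2 => //.
      - exact: measurable_funB.
      - exact: measurable_funB.
      - exact: measurable_funB.
      - move=> x _; rewrite [X in `|X| <= _](_ : _ = (phis x - phi0s x) + (phi0s x - phi x)); last by ring.
        exact: ler_normD.
    have -> : del / 4 + del / 4 + (del / 4 + del / 4) = del / 4 + (del / 4 + del / 4 + del / 4) by lra.
    rewrite EFinD; apply: lte_leD => //.
      by rewrite ge0_fin_numE ?integral_ge0// (le_lt_trans d0phi)// ltry.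
    by rewrite (le_trans d0phi)// lee_fin; lra.
  have h1 : `|G phis - G phi| <= e.
    apply: G_close => //; first by move=> x; exact: phi01.
    apply: (Hdel (fun x => phis x - phi x)) => //; first exact: measurable_funB.
    move=> x _; have /andP[? ?] := phi01 x; have /andP[? ?] := phi01 (x + s *: dir ik).
    by rewrite ler_norml /phis; apply/andP; split; lra.
  have h2 : `|G \1_A - G phi| <= e.
    apply: G_close => //.
    apply: (Hdel (fun x => \1_A x - phi x)) => //; first exact: measurable_funB.
      move=> x _; have /andP[? ?] := phi01 x; have /andP[? ?] := ind01 x.
      by rewrite ler_norml; apply/andP; split; lra.
    by apply: lt_le_trans d1' _; rewrite lee_fin; lra.
  rewrite -/phis (_ : _ - _ = (G phis - G phi) - (G \1_A - G phi)); last by ring.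
  by rewrite (le_trans (ler_normB _ _))//; lra.
(* The sense of the translation decides on the sign of the bound obtained. *)
pose t' := - ((-1) ^+ sg * t).
have t'E : `|t'| = t by rewrite /t' normrN normrMsign gtr0_norm.
have [s st E] := shift_mean_value m ik tphi t'.
rewrite t'E in st.
have ts : test Omega (fun x : M => phi (x + s *: dir ik)).
  apply: Hr => //; first exact: test_smooth tphi.
  rewrite normrZ (le_lt_trans _ t_ltr)// (le_trans _ st)// ler_piMr//; exact: norm_dir.
have W := weak ts.
rewrite partial_translate in W; last exact: test_smooth tphi.
rewrite W -/(G _) in E.
have pos : 0 <= \int[m]_x phi (x + t' *: dir ik).
  by apply: Rintegral_ge0 => x _; have /andP[] := phi01 (x + t' *: dir ik).
pose Gs := G (fun x : M => phi (x + s *: dir ik)).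
have {}E : \int[m]_x phi (x + t' *: dir ik) - \int[m]_x phi x = t * ((-1) ^+ sg * Gs).
  by rewrite E /t' mulrN mulNr opprK mulrCA mulrA.
have : - e <= (-1) ^+ sg * Gs.
  by rewrite -(ler_pM2l t_gt0) -E; lra.
have := close s st; rewrite -/Gs ler_norml => /andP[].
have [->|->] : (-1) ^+ sg = 1 :> R \/ (-1) ^+ sg = -1 :> R by case: (sg); [right|left].
  all: lra.
Qed.

End weak_derivative.

Section absolute_continuity.
Variables (C : R) (C0 : 0 <= C).
Hypothesis bounded_derivative : forall phi ik, test Omega phi ->
  (forall x, `|phi x| <= 1) -> `|\int[m]_x partial ik phi x| <= C.

(** Translate along one entry after the other and apply the mean value theorem each
    time. *)
Lemma shift_integral_close (phi : M -> R) (K' : set M) (r rho : R) :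
  C_infty phi -> (forall x, ~ K' x -> phi x = 0) -> (forall x, 0 <= phi x <= 1) ->
  (forall phi, C_infty phi -> (forall x, ~ K' x -> phi x = 0) ->
    forall y, `|y| < r -> test Omega (fun x => phi (x + y))) ->
  0 <= rho -> (j * d)%:R * rho < r -> forall y, cube 0 rho y ->
  `|\int[m]_x phi (x + y : M) - \int[m]_x phi x| <= C * ((j * d)%:R * rho).
Proof.
move=> sphi z phi01 Hr rho0 rhor y yrho.
pose ys (s : seq ('I_j * 'I_d)) : M := \sum_(ik <- s) y ik.1 ik.2 *: dir ik.
have nys s : `|ys s| <= (size s)%:R * rho.
  rewrite /ys; elim: s => [|ik s ih]; first by rewrite big_nil normr0 mul0r.
  rewrite big_cons /= -natr1 mulrDl mul1r addrC; apply: le_trans (ler_normD _ _) _.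
  apply: lerD => //; rewrite normrZ; have := yrho ik.1 ik.2; rewrite mxE subr0 => H.
  by apply: le_trans H; rewrite ler_piMr//; exact: norm_dir.
have step s : (size s <= j * d)%N ->
    `|\int[m]_x phi (x + ys s : M) - \int[m]_x phi x| <= C * ((size s)%:R * rho).
  elim: s => [_|ik s ih /= ss].
    rewrite /ys big_nil /= mul0r mulr0; under eq_Rintegral do rewrite addr0.
    by rewrite subrr normr0.
  have {}ih := ih (ltnW ss).
  have tys : test Omega (fun x : M => phi (x + ys s)).
    apply: Hr => //; apply: le_lt_trans (nys s) _; apply: le_lt_trans rhor.
    by rewrite ler_wpM2r// ler_nat ltnW.
  have [s' s'y E] := shift_mean_value m ik tys (y ik.1 ik.2).
  have y_rho : `|y ik.1 ik.2| <= rho by have := yrho ik.1 ik.2; rewrite mxE subr0.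
  have tys' : test Omega (fun x : M => phi (x + s' *: dir ik + ys s)).
    under eq_fun do rewrite -addrA.
    apply: Hr => //; apply: le_lt_trans (ler_normD _ _) _.
    apply: (@le_lt_trans _ _ (rho + (size s)%:R * rho)).
      apply: lerD => //; rewrite normrZ (le_trans _ y_rho)// (le_trans _ s'y)// ler_piMr//.
      exact: norm_dir.
    apply: le_lt_trans rhor; rewrite -[X in X + _]mul1r -mulrDl ler_wpM2r//.
    by rewrite nat1r ler_nat.
  have Hb : `|\int[m]_x partial ik (fun x : M => phi (x + s' *: dir ik + ys s)) x| <= C.
    apply: bounded_derivative => // x.
    by have /andP[h1 h2] := phi01 (x + s' *: dir ik + ys s); rewrite ger0_norm.
  rewrite -natr1 mulrDl mul1r mulrDr.
  have -> : \int[m]_x phi (x + ys (ik :: s) : M) - \int[m]_x phi x =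
     (\int[m]_x phi (x + ys s : M) - \int[m]_x phi x) +
     (\int[m]_x phi (x + y ik.1 ik.2 *: dir ik + ys s : M) - \int[m]_x phi (x + ys s : M)).
    have -> : \int[m]_x phi (x + ys (ik :: s) : M) =
        \int[m]_x phi (x + y ik.1 ik.2 *: dir ik + ys s : M).
      by apply: eq_Rintegral => x _; rewrite /ys big_cons addrA.
    by ring.
  apply: le_trans (ler_normD _ _) _; apply: lerD => //.
  rewrite E normrM mulrC.
  rewrite (@partial_translate R j d (fun x => phi (x + ys s)) (s' *: dir ik)) in Hb; last exact: test_smooth tys.
  exact: ler_pM.
have yE : y = ys (enum [set: 'I_j * 'I_d]%SET).
  rewrite /ys big_enum /= {1}(matrix_sum_delta y) pair_big.
  by apply: eq_big => // ik; rewrite inE.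
have se : size (enum [set: 'I_j * 'I_d]%SET) = (j * d)%N.
  by rewrite -cardE cardsT card_prod !card_ord.
have := step (enum [set: 'I_j * 'I_d]%SET).
by rewrite -yE se => /(_ (leqnn _)).
Qed.

(** Average [shift_integral_close] over the translations by a small cube: the averages
    of a test function over the cubes are bounded by its Lebesgue integral divided by
    the volume of the cube. *)
Lemma average_shift_integral (phi : M -> R) (K' : set M) (r rho : R) :
  C_infty phi -> (forall x, ~ K' x -> phi x = 0) -> (forall x, 0 <= phi x <= 1) ->
  (forall phi, C_infty phi -> (forall x, ~ K' x -> phi x = 0) ->
    forall y, `|y| < r -> test Omega (fun x => phi (x + y))) ->
  0 <= rho -> (j * d)%:R * rho < r ->
  (((2 * rho) ^+ (j * d))%:E * \int[m]_x (phi x)%:E <=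
    m setT * \int[leb]_x (phi x)%:E +
    ((2 * rho) ^+ (j * d) * (C * ((j * d)%:R * rho)))%:E)%E.
Proof.
move=> sphi z phi01 Hr rho0 rhor.
have r0 : 0 < r by apply: le_lt_trans rhor; rewrite mulr_ge0.
have tphi : test Omega phi.
  have -> : phi = fun x => phi (x + 0) by apply/funext => x; rewrite addr0.
  by apply: Hr => //; rewrite normr0.
have phi_ge0 x : 0 <= phi x by have /andP[] := phi01 x.
have ints y : m.-integrable setT (EFin \o (fun x : M => phi (x + y))).
  apply: (@continuous_bounded_integrable _ _ _ m _ 1).
    exact: continuous_translate (test_continuous tphi).
  by move=> x; rewrite ger0_norm//; have /andP[] := phi01 (x + y).
have close y : cube 0 rho y ->
   (\int[m]_x (phi x)%:E <= \int[m]_x (phi ((x : M) + y)%R)%:E + (C * ((j * d)%:R * rho))%:E)%E.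
  move=> yr; have := shift_integral_close sphi z phi01 Hr rho0 rhor yr.
  rewrite ler_norml => /andP[h _].
  rewrite -(@fineK _ (\int[m]_x (phi x)%:E)%E); last first.
    by apply: integrable_fin_num => //; exact: test_integrable tphi.
  rewrite -(@fineK _ (\int[m]_x (phi ((x : M) + y)%R)%:E)%E); last first.
    by apply: integrable_fin_num => //; exact: ints.
  by rewrite -EFinD lee_fin; move: h; rewrite /Rintegral; lra.
pose Q : set (borel M) := cube 0 rho.
have mQ : measurable Q by exact: measurable_cube.
have lebQ : leb Q = ((2 * rho) ^+ (j * d))%:E by exact: lebesgue_cube.
have msum : measurable_fun [set: (borel M * borel M)%type]
    (fun z : (borel M * borel M)%type => ((z.1 : M) + (z.2 : M) : M) : borel M).
  apply: measurable_mx => i k; under eq_fun do rewrite mxE.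
  apply: measurable_funD.
    apply: (@measurableT_comp _ _ _ _ _ _ (fun x : borel M => (x : M) i k)) => //.
    by apply: measurable_continuous; exact: coord_continuous.
  apply: (@measurableT_comp _ _ _ _ _ _ (fun x : borel M => (x : M) i k)) => //.
  by apply: measurable_continuous; exact: coord_continuous.
have mf : measurable_fun [set: (borel M * borel M)%type]
    (fun z : (borel M * borel M)%type => (phi ((z.1 : M) + (z.2 : M)))%:E).
  apply/measurable_EFinP; apply: (@measurableT_comp _ _ _ _ _ _ (phi : borel M -> R) _
    (fun z : (borel M * borel M)%type => ((z.1 : M) + (z.2 : M) : M) : borel M)) => //.
  exact: measurable_test tphi.
have f0 (w : (borel M * borel M)%type) : (0 <= (phi ((w.1 : M) + (w.2 : M)))%:E)%E by rewrite lee_fin.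
have mG : measurable_fun [set: borel M] (fun y : borel M => \int[m]_x (phi ((x : M) + y)%R)%:E)%E.
  exact: (@measurable_fun_fubini_tonelli_G _ _ (borel M) (borel M) R m _ mf f0).
have mul_cst : (\int[leb]_(y in Q) (C * ((j * d)%:R * rho))%:E =
    ((2 * rho) ^+ (j * d) * (C * ((j * d)%:R * rho)))%:E)%E.
  by rewrite integral_cst// lebQ -EFinM mulrC.
rewrite -mul_cst -lebQ.
have -> : (leb Q * \int[m]_x (phi x)%:E = \int[leb]_(y in Q) \int[m]_x (phi x)%:E)%E.
  by rewrite [RHS]integral_cst// muleC.
have Im0 : (0 <= \int[m]_x (phi x)%:E)%E by apply: integral_ge0 => x _; rewrite lee_fin.
apply: (@le_trans _ _ (\int[leb]_(y in Q) (\int[m]_x (phi ((x : M) + y)%R)%:E + (C * ((j * d)%:R * rho))%:E)%E)%E).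
  apply: ge0_le_integral => //.
  by apply: emeasurable_funD => //; exact: measurable_funTS.
rewrite ge0_integralD//; last 3 first.
- by move=> y _; apply: integral_ge0 => x _; rewrite lee_fin.
- exact: measurable_funTS.
- by move=> y _; rewrite lee_fin !mulr_ge0.
apply: leeD => //.
apply: (@le_trans _ _ (\int[lebesgue_sf]_y (\int[m]_x (phi ((x : M) + y)%R)%:E))%E).
  apply: ge0_subset_integral => //.
  by move=> y _; apply: integral_ge0 => x _; rewrite lee_fin.
(* After exchanging the integrals, translation invariance makes the inner one
   independent of x. *)
have FT := @fubini_tonelli _ _ (borel M) (borel M) R m lebesgue_sf (fun w => (phi ((w.1 : M) + (w.2 : M)))%:E) mf f0.
apply: (@le_trans _ _ (\int[m]_x \int[leb]_y (phi ((x : M) + (y : M))%R)%:E)%E).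
  by rewrite le_eqVlt; apply/orP; left; apply/eqP/esym; exact: FT.
have -> : (\int[m]_x \int[leb]_y (phi ((x : M) + (y : M))%R)%:E = \int[m]_x (cst (\int[leb]_y (phi y)%:E) x))%E.
  apply: eq_integral => x _ /=.
  transitivity (\int[leb]_y (phi ((y : M) + (x : M))%R)%:E)%E.
    by apply: eq_integral => y _; rewrite addrC.
  apply: (@integral_translate R j d x (fun x => (phi x)%:E)).
    by apply/measurable_EFinP; exact: measurable_test tphi.
  by move=> y; rewrite lee_fin.
by rewrite integral_cst// muleC.
Qed.

(** By [average_shift_integral], test functions close to the indicator of a Lebesgue
    null set have small m-integrals. *)
Lemma null_of_bounded_derivative_compact (A : set (borel M)) : measurable A -> A `<=` K ->
  leb A = 0%E -> m A = 0%E.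
Proof.
move=> mA AK lA.
have AO : A `<=` Omega by move=> x /AK/KO.
have mAfin : m A \is a fin_num by exact: fin_num_measure.
have mTfin : m setT \is a fin_num by exact: fin_num_measure.
set a := fine (m A); set b := fine (m setT).
have mAE : m A = a%:E by rewrite fineK.
have mTE : m setT = b%:E by rewrite fineK.
have a0 : 0 <= a by apply: fine_ge0.
have b0 : 0 <= b by apply: fine_ge0.
suff : ~ 0 < a.
  by move=> /negP; rewrite -leNgt mAE => h; congr (_%:E); apply/eqP; rewrite eq_le h a0.
move=> a_gt0.
have [K' [cK' K'O] HK'] := test_approximation_compact m oOmega cK KO.
have [r r0 Hr] := test_shift_margin oOmega cK' K'O.
set N : R := (j * d)%:R; have N0 : 0 <= N by rewrite /N.
have N1 : 0 < N + 1 by lra.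
have C1 : 0 < C + 1 by rewrite ltr_wpDl.
(* The choices of rho and of the precision e below lead to a <= a / 2. *)
pose rho := Num.min (r / (2 * (N + 1))) (a / (4 * (C + 1) * (N + 1))).
have rho0 : 0 < rho.
  by rewrite lt_min !divr_gt0// !mulr_gt0.
have rhor : N * rho < r.
  have : rho <= r / (2 * (N + 1)) by rewrite ge_min lexx.
  rewrite ler_pdivlMr; last by lra.
  nra.
have Crho : C * (N * rho) <= a / 4.
  have : rho <= a / (4 * (C + 1) * (N + 1)) by rewrite ge_min lexx orbT.
  rewrite ler_pdivlMr; last by rewrite !mulr_gt0.
  move=> h; have h1 : C * (N * rho) <= (C + 1) * ((N + 1) * rho).
    by apply: ler_pM; rewrite ?mulr_ge0// ?(ltW rho0)//; nra.
  nra.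
set c : R := (2 * rho) ^+ (j * d); have c0 : 0 < c by rewrite exprn_gt0// mulr_gt0.
have e0 : 0 < a / (4 * (b / c + 1)).
  have bc : 0 <= b / c by rewrite divr_ge0// ltW.
  by rewrite divr_gt0//; lra.
have [phi [tphi phi01 z n1 n2]] := HK' A _ mA AK e0.
set e := a / (4 * (b / c + 1)) in e0 n1 n2.
have phi_ge0 x : 0 <= phi x by have /andP[] := phi01 x.
have H := average_shift_integral (test_smooth tphi) z phi01 Hr (ltW rho0) rhor.
have iphi : (\int[m]_x (phi x)%:E)%E \is a fin_num.
  by apply: integrable_fin_num => //; exact: test_integrable tphi.
have H1 : (\int[leb]_x (phi x)%:E <= e%:E)%E.
  exact: le_trans (test_integral_near_null mA AO lA tphi phi_ge0) (ltW n2).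
have H2 : (m A <= \int[m]_x (phi x)%:E + e%:E)%E.
  have mphi D : measurable_fun (D : set (borel M)) (phi : borel M -> R) by exact: measurable_test tphi.
  have -> : m A = (\int[m]_(x in Omega) (`|\1_A x : R|)%:E)%E.
    under eq_integral do rewrite ger0_norm//.
    by rewrite integral_indic// setIidl.
  apply: (@le_trans _ _ (\int[m]_(x in Omega) (`|phi x|)%:E + \int[m]_(x in Omega) (`|\1_A x - phi x|)%:E)%E).
    apply: le_integral_norm2 => //.
    - by apply: measurable_funB => //; exact: measurable_indic.
    - move=> x _; rewrite addrC -[X in `|X| <= _](subrK (phi x)).
      exact: ler_normD.
  apply: leeD; last exact: ltW.
  under eq_integral do rewrite ger0_norm//.
  apply: ge0_subset_integral => //; first exact/measurable_EFinP.
  by move=> x _; rewrite lee_fin.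
move: H H2; rewrite -(fineK iphi); set I := fine _; rewrite -/c -/N.
move=> H; rewrite mAE -EFinD lee_fin => H2.
have H3 : c * I <= b * e + c * (C * (N * rho)).
  rewrite -lee_fin EFinM; apply: le_trans H _; rewrite EFinD leeD2r// mTE EFinM.
  by rewrite lee_wpmul2l// lee_fin.
have ec : (b / c + 1) * e = a / 4.
  have bc1 : b / c + 1 != 0 by rewrite gt_eqF// ltr_wpDl// divr_ge0// ltW.
  by rewrite /e mulrC invfM mulrA divfK.
have H4 : I <= b / c * e + C * (N * rho).
  have cn0 : c != 0 by rewrite gt_eqF.
  have -> : b / c * e + C * (N * rho) = (b * e + c * (C * (N * rho))) / c by field.
  by rewrite ler_pdivlMr// mulrC.
by move: ec; rewrite mulrDl mul1r; lra.
Qed.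

End absolute_continuity.

End weak_derivative_null_sets.

(** * Limits in the mean *)

Section measurable_inverse.
Context {R : realType}.

Lemma cvg_harmonicS : (n.+1%:R^-1 : R) @[n --> \oo] --> 0.
Proof. exact: cvg_harmonic. Qed.

(** With the convention that 0 has inverse 0, the inverse is the pointwise limit
    of the continuous functions x / (x^2 + 1/n). *)
Lemma measurable_invr : measurable_fun [set: R] (fun x : R => x^-1).
Proof.
pose h (n : nat) (x : R) := x * (x ^+ 2 + n.+1%:R^-1)^-1.
have hpos n (x : R) : 0 < x ^+ 2 + n.+1%:R^-1 by rewrite ltr_wpDl ?sqr_ge0// invr_gt0.
apply: (@measurable_fun_cvg _ _ _ setT h).
  move=> n; apply: continuous_measurable_fun.
  apply: (@continuous_mulr R R (fun x => x) (fun x => (x ^+ 2 + n.+1%:R^-1)^-1)).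
    by move=> x; exact: cvg_id.
  apply: continuous_invr => [x|]; first by rewrite gt_eqF.
  apply: continuous_addr; last by move=> x; exact: cvg_cst.
  exact: exprn_continuous.
move=> x _; have [->|x0] := eqVneq x 0.
  by rewrite invr0; apply: cvg_near_cst; near=> n; rewrite /h mul0r.
have -> : x^-1 = x * (x ^+ 2 + 0)^-1 by rewrite addr0 expr2 invfM mulrA divff// mul1r.
apply: cvgM; first exact: cvg_cst.
apply: cvgV; first by rewrite addr0 expf_neq0.
by apply: cvgD; [exact: cvg_cst|exact: cvg_harmonicS].
Unshelve. all: by end_near. Qed.

End measurable_inverse.

Section L1_completeness.
Context {disp : measure_display} {T : measurableType disp} {R : realType}.
Variable mu : {finite_measure set T -> \bar R}.
Variables (u : nat -> T -> R) (C : R).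
Hypothesis mu_ : forall n, measurable_fun setT (u n).
Hypothesis iu : mu.-integrable setT (EFin \o u 0%N).
Hypothesis fast : forall n,
  (\int[mu]_x (`|u n.+1 x - u n x|)%:E <= (C / 2 ^+ n)%:E)%E.

Let G x := (\sum_(n <oo) (`|u n.+1 x - u n x|)%:E)%E.

Let mdiff n : measurable_fun setT (fun x => (`|u n.+1 x - u n x|)%:E : \bar R).
Proof. by apply: measurable_abs_EFin; exact: measurable_funB. Qed.

Let G0 x : (0 <= G x)%E. Proof. exact: nneseries_ge0. Qed.

Let mG : measurable_fun setT G.
Proof. by apply: ge0_emeasurable_sum. Qed.

Let C0 : 0 <= C.
Proof.
have := fast 0; rewrite expr0 divr1 => h; rewrite -lee_fin; apply: le_trans h.
exact: integral_ge0.
Qed.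

Let G_int : (\int[mu]_x G x < +oo)%E.
Proof.
rewrite /G integral_nneseries//.
apply: (@le_lt_trans _ _ (\sum_(0 <= n <oo) (C / (2 ^ n.+1)%:R * 2)%:E)%E).
  apply: lee_nneseries => [n _ _|n _]; first exact: integral_ge0.
  apply: le_trans (fast n) _; rewrite lee_fin expnS natrM invfM mulrA.
  by rewrite mulrAC divfK// natrX.
under eq_eseriesr do rewrite EFinM muleC.
rewrite nneseriesZl; last by move=> n _; rewrite lee_fin divr_ge0.
rewrite lte_mul_pinfty//.
have := @epsilon_trick R (fun=> 0%E) C xpredT (fun _ => lexx _) C0.
rewrite [X in (_ <= X + _)%E](_ : _ = 0%E) ?add0e; last by rewrite eseries0.
move=> h; apply: le_lt_trans (ltry C).
apply: le_trans h; apply: lee_nneseries => [n _ _|n _]; last by rewrite add0e.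
by rewrite lee_fin divr_ge0// ler0n.
Qed.

Let iG : mu.-integrable setT G.
Proof.
apply/integrableP; split => //; rewrite (eq_integral G)// => x _.
by rewrite gee0_abs.
Qed.

Let D := [set x | (G x < +oo)%E].

Let mD : measurable D.
Proof. by rewrite -[D]setTI; exact: emeasurable_fun_infty_o. Qed.

Let muD : mu (~` D) = 0%E.
Proof.
have [N [mN N0 HN]] := integrable_ae measurableT iG.
apply/eqP; rewrite eq_le measure_ge0 andbT -N0.
apply: le_measure; rewrite ?inE//; first exact: measurableC.
apply: subset_trans HN => x /= nDx /(_ I) fin; apply: nDx.
by rewrite /D /= -ge0_fin_numE.
Qed.

Let h x := if x \in D then lim (u n x @[n --> \oo]) else 0.

Let cvg_u x : D x -> u n x @[n --> \oo] --> h x.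
Proof.
move=> Dx; rewrite /h mem_set//.
have cs : cvgn [normed series (fun n => u n.+1 x - u n x)].
  apply: nondecreasing_is_cvgn.
    by apply: nondecreasing_series => n _ _; exact: normr_ge0.
  exists (fine (G x)) => _ [n _ <-].
  rewrite -lee_fin fineK; last by rewrite ge0_fin_numE.
  rewrite /series /= -sumEFin.
  exact: nneseries_lim_ge.
have : cvgn (series (fun n => u n.+1 x - u n x)) by exact: normed_cvg.
have -> : series (fun n => u n.+1 x - u n x) = (fun n => u n x - u 0%N x).
  by apply/funext => n; rewrite /series /= telescope_sumr.
move=> /cvg_ex[l Hl]; apply/cvg_ex; exists (l + u 0%N x).
have -> : (fun n => u n x) = (fun n => u n x - u 0%N x + u 0%N x).
  by apply/funext => n; rewrite subrK.
by apply: cvgD => //; exact: cvg_cst.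
Qed.

Let v n x := u n x * \1_D x.

Let cvg_v x : v n x @[n --> \oo] --> h x.
Proof.
have [Dx|nDx] := pselect (D x).
  have -> : v ^~ x = u ^~ x by apply/funext => n; rewrite /v indicE mem_set// mulr1.
  exact: cvg_u.
have -> : v ^~ x = cst 0 by apply/funext => n; rewrite /v indicE memNset// mulr0.
by rewrite /h memNset//; exact: cvg_cst.
Qed.

Let mh : measurable_fun setT h.
Proof.
apply: (@measurable_fun_cvg _ _ _ setT v) => // n.
by apply: measurable_funM => //; exact: measurable_indic.
Qed.

Let bound x := (`|u 0%N x| + fine (G x)) * \1_D x.

Let v_bound n x : `|v n x| <= bound x.
Proof.
rewrite /v /bound; have [Dx|nDx] := pselect (D x); last first.
  by rewrite indicE memNset// !mulr0 normr0.
rewrite indicE mem_set// !mulr1.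
have -> : u n x = u 0%N x + \sum_(0 <= k < n) (u k.+1 x - u k x).
  by rewrite telescope_sumr// addrC subrK.
rewrite (le_trans (ler_normD _ _))// lerD// (le_trans (ler_norm_sum _ _ _))//.
rewrite -lee_fin fineK; last by rewrite ge0_fin_numE.
by rewrite -sumEFin; exact: nneseries_lim_ge.
Qed.

Let ibound : mu.-integrable setT (EFin \o bound).
Proof.
have i1 : mu.-integrable setT (fun x => `|(u 0%N x)%:E| + G x)%E.
  by apply: integrableD => //; exact: integrable_abse.
apply: le_integrable i1 => //.
  apply/measurable_EFinP; apply: measurable_funM; last exact: measurable_indic.
  apply: measurable_funD; first exact: measurableT_comp.
  exact: measurableT_comp.
move=> x _ /=; have G0x := G0 x.
rewrite [leRHS]gee0_abs ?adde_ge0//.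
rewrite /bound; have [Dx|nDx] := pselect (D x); last first.
  by rewrite indicE memNset// mulr0 normr0 adde_ge0.
rewrite indicE mem_set// mulr1 ger0_norm; last by rewrite addr_ge0// fine_ge0.
by rewrite EFinD fineK// ge0_fin_numE.
Qed.

(** The increments are summable in the mean; their sum is therefore finite almost
    everywhere, and it dominates the sequence. *)
Lemma L1_limit : exists g : T -> R, [/\ measurable_fun setT g,
  mu.-integrable setT (EFin \o g),
  {ae mu, forall x, u n x @[n --> \oo] --> g x} &
  (\int[mu]_x (`|u n x - g x|)%:E @[n --> \oo] --> 0)%E].
Proof.
exists h; split => //.
- apply: le_integrable ibound => //; first exact/measurable_EFinP.
  move=> x _ /=; rewrite lee_fin [leRHS]ger0_norm; last exact: le_trans (v_bound 0 x).
  have : `|v n x| @[n --> \oo] --> `|h x| by apply: cvg_norm; exact: cvg_v.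
  by move=> /cvgr_to_le; apply; near=> n; exact: v_bound.
- exists (~` D); split; [exact: measurableC|exact: muD|].
  by move=> x /= nc Dx; apply: nc; exact: cvg_u.
- have -> : (fun n => \int[mu]_x (`|u n x - h x|)%:E)%E =
      (fun n => \int[mu]_x (`|v n x - h x|)%:E)%E.
    apply/funext => n; apply: ae_eq_integral => //.
    + by apply: measurable_abs_EFin; exact: measurable_funB.
    + apply: measurable_abs_EFin; apply: measurable_funB => //.
      by apply: measurable_funM => //; exact: measurable_indic.
    + exists (~` D); split; [exact: measurableC|exact: muD|].
      by move=> x /= nc Dx; apply: nc => _; rewrite /v indicE mem_set// mulr1.
  have h_bound x : `|h x| <= bound x.
    have : `|v n x| @[n --> \oo] --> `|h x| by apply: cvg_norm; exact: cvg_v.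
    by move=> /cvgr_to_le; apply; near=> n; exact: v_bound.
  apply: (@dominated_cvg_norm0 _ _ _ mu setT (fun n x => v n x - h x) (fun x => bound x + bound x)) => //.
  + move=> n; apply: measurable_funB => //.
    by apply: measurable_funM => //; exact: measurable_indic.
  + exact: (@integrableD _ _ _ mu setT measurableT _ _ ibound ibound).
  + by move=> n x _; rewrite (le_trans (ler_normB _ _))// lerD.
  + move=> x _; rewrite -[X in _ --> X](subrr (h x)).
    by apply: cvgB; [exact: cvg_v|exact: cvg_cst].
Unshelve. all: by end_near. Qed.

End L1_completeness.

(** * Densities with respect to Lebesgue measure *)

Section global_null_sets.
Context {R : realType} {j d : nat}.
Local Notation M := 'M[R]_(j, d).
Local Notation leb := (lebesgue_mx R j d).
Variables (Omega : set M) (oOmega : open Omega).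

Let mO : measurable (Omega : set (borel M)).
Proof. exact: borel_open. Qed.

Lemma sigma_compact_open : exists K : nat -> set M,
  [/\ forall n, compact (K n), forall n, K n `<=` Omega & Omega `<=` \bigcup_n K n].
Proof.
have H n : exists K : set M, [/\ compact K, K `<=` Omega &
    forall x, ~ K x -> exhaustion Omega n x = 0].
  by have [_] := test_exhaustion Omega n.
exists (fun n => sval (cid (H n))); split => [n|n|x Ox].
- by case: cid => K /= [].
- by case: cid => K /= [].
- have [n Hn] := exhaustion_point oOmega Ox; exists n => //.
  case: cid => K /= [_ _ z]; apply: contrapT => /z.
  by rewrite (nbhs_singleton (Hn n (leqnn n))) => /eqP; rewrite oner_eq0.
Qed.

Variable m : {finite_measure set (borel M) -> \bar R}.

(** An open set is a countable union of compact sets, on which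
    [null_of_bounded_derivative_compact] applies. *)
Lemma null_of_bounded_derivative (C : R) : 0 <= C ->
  (forall phi ik, test Omega phi -> (forall x, `|phi x| <= 1) ->
    `|\int[m]_x partial ik phi x| <= C) ->
  m (~` Omega) = 0%E ->
  forall A : set (borel M), measurable A -> leb A = 0%E -> m A = 0%E.
Proof.
move=> C0 HC mCO A mA lA.
have [K [cK KO OK]] := sigma_compact_open.
have mK n : measurable (K n : set (borel M)) by exact: (measurable_closed (compact_mx_closed (cK n))).
apply/negligibleP => //.
apply: (@negligibleS _ _ _ m (~` Omega `|` \bigcup_n (A `&` K n))).
  move=> x Ax; have [Ox|nOx] := pselect (Omega x); last by left.
  by right; have [n _ Kx] := OK x Ox; exists n.
apply: negligibleU; first by apply/negligibleP => //; exact: measurableC.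
apply: negligible_bigcup => n; apply/negligibleP; first exact: measurableI.
apply: (@null_of_bounded_derivative_compact R j d m Omega oOmega (K n) (cK n) (KO n) C C0 HC).
- exact: measurableI.
- exact: subIsetr.
- by apply: (@subset_measure0 _ _ _ leb (A `&` K n) A) => //; exact: measurableI.
Qed.

Lemma weak_derivative_null (g : M -> R) ik (Z : set (borel M)) :
  leb.-integrable (Omega : set (borel M)) (EFin \o g) ->
  (forall phi, test Omega phi ->
    \int[m]_x partial ik phi x = - \int[leb]_(x in Omega) (g x * phi x)) ->
  measurable Z -> m Z = 0%E ->
  {ae leb, forall x, Omega x -> Z x -> g x = 0}.
Proof.
move=> ig weak mZ Z0.
have [K [cK KO OK]] := sigma_compact_open.
have mK n : measurable (K n : set (borel M)) by exact: (measurable_closed (compact_mx_closed (cK n))).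
have H n : {ae leb, forall x, (Z `&` K n) x -> (g x)%:E = cst 0%E x}.
  have mZK : measurable (Z `&` K n) by exact: measurableI.
  have sub : Z `&` K n `<=` Omega by move=> x [_ /KO].
  have iZ : leb.-integrable (Z `&` K n) (EFin \o g) by exact: integrableS ig.
  apply: (@integral_ae_eq _ _ _ leb (Z `&` K n) mZK (cst 0%E) (EFin \o g) iZ) => //.
  move=> E EZ mE; rewrite integral0.
  have E0 : m E = 0%E.
    by apply/eqP; rewrite eq_le measure_ge0 andbT -Z0 le_measure ?inE// => x /EZ[].
  have EK : E `<=` K n by move=> x /EZ[].
  have EO : E `<=` Omega by move=> x /EK/KO.
  have := @weak_derivative_null_compact R j d m Omega oOmega (K n) (cK n) (KO n) g ik ig weak E mE EK E0.
  rewrite /Rintegral => H0; rewrite -(@fineK _ (\int[leb]_(x in E) (EFin \o g) x)%E).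
    by congr (_%:E).
  by apply: integrable_fin_num => //; exact: integrableS ig.
have := ae_foralln H; apply: filterS => x Hx Ox Zx.
have [n _ Kx] := OK x Ox.
by have /(_ (conj Zx Kx))[] := Hx n.
Qed.

End global_null_sets.

Section density.
Context {R : realType} {j d : nat}.
Local Notation M := 'M[R]_(j, d).
Local Notation leb := (lebesgue_mx R j d).
Variable m : {finite_measure set (borel M) -> \bar R}.
Hypothesis dom : forall A : set (borel M), measurable A -> leb A = 0%E -> m A = 0%E.

Let domN : m `<< (@lebesgue_sf R j d).
Proof. by apply/null_content_dominatesP => A mA lA; exact: dom. Qed.

Let q0 : borel M -> \bar R := Radon_Nikodym_SigmaFinite.f m (@lebesgue_sf R j d).

(** The Radon-Nikodym derivative, read in the real numbers. *)
Definition dens (x : M) : R := fine (q0 x).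

Lemma densE x : (dens x)%:E = q0 x.
Proof. by rewrite /dens fineK//; exact: Radon_Nikodym_SigmaFinite.f_fin_num. Qed.

Lemma dens_ge0 x : 0 <= dens x.
Proof. by rewrite -lee_fin densE; exact: Radon_Nikodym_SigmaFinite.f_ge0. Qed.

Lemma measurable_dens : measurable_fun [set: borel M] (dens : borel M -> R).
Proof.
apply/measurable_EFinP; rewrite (_ : EFin \o dens = q0); last by apply/funext => x; exact: densE.
exact/measurable_int/Radon_Nikodym_SigmaFinite.f_integrable.
Qed.

Lemma integrable_dens : leb.-integrable setT (EFin \o dens).
Proof.
rewrite (_ : EFin \o dens = q0); last by apply/funext => x; exact: densE.
exact: (Radon_Nikodym_SigmaFinite.f_integrable domN).
Qed.

Lemma dens_measure (A : set (borel M)) : measurable A ->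
  m A = (\int[leb]_(x in A) (dens x)%:E)%E.
Proof.
move=> mA; under eq_integral do rewrite densE.
exact: Radon_Nikodym_SigmaFinite.f_integral.
Qed.

Lemma ge0_integral_dens (D : set (borel M)) (u : M -> R) : measurable D ->
  measurable_fun [set: borel M] (u : borel M -> R) -> (forall x, 0 <= u x) ->
  (\int[m]_(x in D) (u x)%:E = \int[leb]_(x in D) (u x * dens x)%:E)%E.
Proof.
move=> mD mu_ u0.
transitivity (\int[leb]_(x in D) ((u x)%:E * q0 x))%E.
  apply/esym; apply: (@Radon_Nikodym_SigmaFinite.change_of_variables _ _ _ m lebesgue_sf domN
    (fun x => (u x)%:E) D) => //.
  by apply: measurable_funTS; exact/measurable_EFinP.
by apply: eq_integral => x _; rewrite EFinM densE.
Qed.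

Lemma integrable_mul_dens (D : set (borel M)) (u : M -> R) : measurable D ->
  measurable_fun [set: borel M] (u : borel M -> R) ->
  m.-integrable D (EFin \o u) -> leb.-integrable D (EFin \o (fun x => u x * dens x)).
Proof.
move=> mD mu_ /integrableP[_ iu]; apply/integrableP; split.
  apply/measurable_EFinP/measurable_funTS; apply: measurable_funM => //; exact: measurable_dens.
apply: le_lt_trans iu; rewrite le_eqVlt; apply/orP; left; apply/eqP.
rewrite -(_ : \int[m]_(x in D) (`|u x|)%:E = \int[m]_(x in D) `|(EFin \o u) x|)%E//.
rewrite ge0_integral_dens//; last exact: measurableT_comp.
by apply: eq_integral => x _; rewrite /= normrM (ger0_norm (dens_ge0 x)).
Qed.

Lemma integral_dens (D : set (borel M)) (u : M -> R) : measurable D ->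
  measurable_fun [set: borel M] (u : borel M -> R) ->
  m.-integrable D (EFin \o u) ->
  \int[m]_(x in D) u x = \int[leb]_(x in D) (u x * dens x).
Proof.
move=> mD mu_ iu.
have mu0 : measurable_fun D (EFin \o (u : borel M -> R)) by apply/measurable_EFinP/measurable_funTS.
pose up x := Num.max (u x) 0; pose un x := Num.max (- u x) 0.
have mup : measurable_fun [set: borel M] (up : borel M -> R) by apply: measurable_maxr.
have mun : measurable_fun [set: borel M] (un : borel M -> R).
  by apply: measurable_maxr => //; exact: measurableT_comp.
have up0 x : 0 <= up x by rewrite le_max lexx orbT.
have un0 x : 0 <= un x by rewrite le_max lexx orbT.
have uE x : u x = up x - un x.
  by rewrite /up /un !maxEle; case: ifP => h1; case: ifP => h2; move: h1 h2; rewrite ?oppr_le0; lra.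
have iup : m.-integrable D (EFin \o up).
  apply: (le_integrable mD _ _ iu); first by apply/measurable_EFinP/measurable_funTS.
  move=> x _ /=; rewrite lee_fin ger0_norm// /up; case: (lerP (u x) 0) => h; first exact: normr_ge0.
  exact: ler_norm.
have iun : m.-integrable D (EFin \o un).
  apply: (le_integrable mD _ _ iu); first by apply/measurable_EFinP/measurable_funTS.
  move=> x _ /=; rewrite lee_fin ger0_norm// /un; case: (lerP (- u x) 0) => h; first exact: normr_ge0.
  by rewrite -normrN ler_norm.
have -> : \int[m]_(x in D) u x = \int[m]_(x in D) up x - \int[m]_(x in D) un x.
  by rewrite -RintegralB//; apply: eq_Rintegral => x _.
have -> : \int[leb]_(x in D) (u x * dens x) =
    \int[leb]_(x in D) (up x * dens x) - \int[leb]_(x in D) (un x * dens x).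
  rewrite -RintegralB//; [|exact: integrable_mul_dens|exact: integrable_mul_dens].
  by apply: eq_Rintegral => x _; rewrite uE mulrBl.
by rewrite /Rintegral !ge0_integral_dens.
Qed.

End density.

(** * The dual functional *)

Section Rintegral_sum.
Context {disp : measure_display} {T : measurableType disp} {R : realType}.
Variable mu : {measure set T -> \bar R}.

Lemma integrable_sumR (I : Type) (s : seq I) (F : I -> T -> R) (D : set T) : measurable D ->
  (forall i, mu.-integrable D (EFin \o F i)) ->
  mu.-integrable D (EFin \o (fun x => \sum_(i <- s) F i x)).
Proof.
move=> mD iF; rewrite (_ : EFin \o _ = fun x => (\sum_(i <- s) (EFin \o F i) x)%E).
  exact: integrable_sum.
by apply/funext => x /=; rewrite sumEFin.
Qed.

Lemma Rintegral_sum (I : Type) (s : seq I) (F : I -> T -> R) (D : set T) : measurable D ->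
  (forall i, mu.-integrable D (EFin \o F i)) ->
  \int[mu]_(x in D) (\sum_(i <- s) F i x) = \sum_(i <- s) \int[mu]_(x in D) F i x.
Proof.
move=> mD iF; elim: s => [|i s ih].
  rewrite big_nil; under eq_Rintegral do rewrite big_nil.
  by rewrite /Rintegral integral0.
rewrite big_cons -ih; under eq_Rintegral do rewrite big_cons.
by rewrite RintegralD//; exact: integrable_sumR.
Qed.

Lemma Rintegral_support (D : set T) (u : T -> R) : (forall x, ~ D x -> u x = 0) ->
  \int[mu]_x u x = \int[mu]_(x in D) u x.
Proof.
move=> u0; rewrite [RHS]Rintegral_mkcond; apply: eq_Rintegral => x _.
by rewrite patchE; case: ifPn => //; rewrite notin_setE => /u0.
Qed.

End Rintegral_sum.

Section dual_functional.
Context {R : realType} {j d : nat}.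
Local Notation M := 'M[R]_(j, d).
Local Notation I := ('I_j * 'I_d)%type.

Definition field : Type := I -> M -> R.
Implicit Types (psi a b : field) (Omega : set M) (x : M).

Definition test_field Omega psi := forall ik, test Omega (psi ik).

Definition diverg psi x : R := \sum_(ik : I) partial ik (psi ik) x.
Definition dot a b x : R := \sum_(ik : I) a ik x * b ik x.

(** The integrand of the dual formula: its integral against a density f with
    gradient g is the integral of g . psi - f |psi|^2 / 4, which is at most the
    integral of |g|^2 / f, with equality for psi = 2 g / f. *)
Definition dual_integrand psi x : R := - diverg psi x - dot psi psi x / 4.

Definition field_addZ a (t : R) b : field := fun ik x => a ik x + t * b ik x.

Lemma test_field_addZ Omega a t b : test_field Omega a -> test_field Omega b ->
  test_field Omega (field_addZ a t b).
Proof. by move=> Ha Hb ik; apply: testD => //; exact: testZ. Qed.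

Lemma test_field0 Omega : test_field Omega (fun _ _ => 0).
Proof. by move=> ik; exact: test0. Qed.

Lemma test_diverg Omega psi : test_field Omega psi -> test Omega (diverg psi).
Proof. by move=> Hpsi; apply: test_sum => ik; exact: test_partial. Qed.

Lemma test_dot Omega a b : test_field Omega a -> test_field Omega b -> test Omega (dot a b).
Proof. by move=> Ha Hb; apply: test_sum => ik; apply: testMl => //; exact: test_smooth (Hb ik). Qed.

Lemma test_dual_integrand Omega psi : test_field Omega psi -> test Omega (dual_integrand psi).
Proof.
move=> Hpsi; apply: testB; first by apply: testN; exact: test_diverg.
by apply: testMl; [exact: test_dot|exact: smooth_cst].
Qed.

Lemma diverg_addZ Omega a t b x : test_field Omega a -> test_field Omega b ->
  diverg (field_addZ a t b) x = diverg a x + t * diverg b x.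
Proof.
move=> Ha Hb; rewrite /diverg mulr_sumr -big_split/=; apply: eq_bigr => ik _.
have sa := test_smooth (Ha ik); have sb := test_smooth (Hb ik).
by rewrite /field_addZ partialD ?partialZ//; exact: smoothZ.
Qed.

Lemma dot_addZ a t b x :
  dot (field_addZ a t b) (field_addZ a t b) x =
  dot a a x + 2 * t * dot a b x + t ^+ 2 * dot b b x.
Proof.
rewrite /dot !mulr_sumr -!big_split/=; apply: eq_bigr => ik _.
by rewrite /field_addZ; ring.
Qed.

Lemma dual_integrand_addZ Omega a t b x : test_field Omega a -> test_field Omega b ->
  dual_integrand (field_addZ a t b) x =
  dual_integrand a x - t * (diverg b x + dot a b x / 2) - t ^+ 2 * (dot b b x / 4).
Proof.
by move=> Ha Hb; rewrite /dual_integrand (diverg_addZ t x Ha Hb) dot_addZ; field.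
Qed.

Section quadratic.
Variable m : {finite_measure set (borel M) -> \bar R}.
Variable Omega : set M.

Definition dual psi : R := \int[m]_x dual_integrand psi x.
Definition dual_diff a b : R := \int[m]_x (diverg b x + dot a b x / 2).
Definition energy b : R := \int[m]_x dot b b x.

Lemma dual_addZ a t b : test_field Omega a -> test_field Omega b ->
  dual (field_addZ a t b) = dual a - t * dual_diff a b - t ^+ 2 / 4 * energy b.
Proof.
move=> Ha Hb.
have ia : m.-integrable setT (EFin \o dual_integrand a).
  exact: test_integrable (test_dual_integrand Ha).
have tD : test Omega (fun x => diverg b x + dot a b x / 2).
  apply: testD; first exact: test_diverg.
  by apply: testMl; [exact: test_dot|exact: smooth_cst].
have iD := test_integrable m tD.
have iE := test_integrable m (test_dot Hb Hb).
have iD' := test_integrable m (testZ t tD).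
have iE' := test_integrable m (testZ (t ^+ 2 / 4) (test_dot Hb Hb)).
rewrite /dual /dual_diff /energy.
rewrite -[t * _]RintegralZl// -[t ^+ 2 / 4 * _]RintegralZl//.
rewrite -RintegralB// -RintegralB//; last first.
  exact: (test_integrable m (testB (test_dual_integrand Ha) (testZ t tD))).
apply: eq_Rintegral => x _; rewrite (dual_integrand_addZ t x Ha Hb).
by congr (_ - _); rewrite mulrA mulrAC.
Qed.

Lemma dual_diff_self a : test_field Omega a -> dual_diff a a = energy a / 4 - dual a.
Proof.
move=> Ha; rewrite /dual_diff /dual /energy.
have iE := test_integrable m (test_dot Ha Ha).
have iJ := test_integrable m (test_dual_integrand Ha).
have -> : (\int[m]_x dot a a x) / 4 = \int[m]_x (4^-1 * dot a a x).
  by rewrite RintegralZl// mulrC.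
rewrite -RintegralB//; last exact: (test_integrable m (testZ 4^-1 (test_dot Ha Ha))).
by apply: eq_Rintegral => x _; rewrite /dual_integrand; field.
Qed.

Lemma dual0 : dual (fun _ _ => 0) = 0.
Proof.
have E x : dual_integrand (fun _ _ => 0) x = 0 :> R.
  rewrite /dual_integrand /diverg /dot !big1 => [|ik _|ik _].
  - by rewrite oppr0 mul0r subrr.
  - by rewrite mulr0.
  - by rewrite partial_cst.
rewrite /dual; under eq_Rintegral do rewrite E.
by rewrite Rintegral_cst// mul0r.
Qed.

Section near_maximizers.
Variables (S : R) (HS : forall psi, test_field Omega psi -> dual psi <= S).

(** Compare with the midpoint, as in the proof that a strictly concave function has at
    most one maximizer. *)
Lemma near_max_close a b (e : R) : test_field Omega a -> test_field Omega b ->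
  S - e <= dual a -> S - e <= dual b ->
  energy (field_addZ b (-1) a) <= 16 * e.
Proof.
move=> Ha Hb ea eb.
have Hc := test_field_addZ (-1) Hb Ha.
have H1 := dual_addZ 1 Ha Hc.
have H2 := HS (test_field_addZ 2^-1 Ha Hc).
rewrite (dual_addZ _ Ha Hc) in H2.
have Eb : field_addZ a 1 (field_addZ b (-1) a) = b.
  by apply/funext => ik; apply/funext => x; rewrite /field_addZ; ring.
by rewrite Eb in H1; lra.
Qed.

(** The Euler-Lagrange equation, approximately: compare with a + e b and with a - e b. *)
Lemma near_max_diff a b (e : R) : test_field Omega a -> test_field Omega b -> 0 < e ->
  S - e ^+ 2 <= dual a -> `|dual_diff a b| <= e * (1 + energy b / 4).
Proof.
move=> Ha Hb e0 ea.
have H1 := HS (test_field_addZ e Ha Hb).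
have H2 := HS (test_field_addZ (- e) Ha Hb).
rewrite (dual_addZ _ Ha Hb) in H1; rewrite (dual_addZ _ Ha Hb) in H2.
rewrite -(ler_pM2l e0) -[X in X * `|_|](gtr0_norm e0) -normrM ler_norml.
by apply/andP; split; nra.
Qed.

(** Compare with (1 - e) a. *)
Lemma near_max_energy a (e : R) : test_field Omega a -> 0 < e -> e < 1 ->
  S - e ^+ 2 <= dual a -> (1 - e) * (energy a / 4) <= S + e.
Proof.
move=> Ha e0 e1 ea; have H := HS (test_field_addZ (- e) Ha Ha).
rewrite (dual_addZ _ Ha Ha) dual_diff_self// in H.
rewrite -(ler_pM2l e0).
have S0 : 0 <= S by rewrite -dual0; apply: HS; exact: test_field0.
nra.
Qed.

End near_maximizers.

End quadratic.

End dual_functional.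

(** * Measures on which the dual functional is bounded *)

Section integrable_addR.
Context {disp : measure_display} {T : measurableType disp} {R : realType}.
Variables (mu : {measure set T -> \bar R}) (D : set T) (mD : measurable D).

Lemma integrable_addR (f g : T -> R) : mu.-integrable D (EFin \o f) ->
  mu.-integrable D (EFin \o g) -> mu.-integrable D (EFin \o (fun x => f x + g x)).
Proof. exact: integrableD. Qed.

Lemma integrable_subR (f g : T -> R) : mu.-integrable D (EFin \o f) ->
  mu.-integrable D (EFin \o g) -> mu.-integrable D (EFin \o (fun x => f x - g x)).
Proof. exact: integrableB. Qed.

End integrable_addR.

Section limn_einf_bounds.
Context {R : realType}.
Implicit Types (u : nat -> \bar R).

Lemma limn_einf_le u (c : \bar R) : (forall n, u n <= c)%E -> (limn_einf u <= c)%E.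
Proof.
move=> uc; rewrite limn_einf_lim; apply: lime_le; first exact: is_cvg_einfs.
near=> n; apply: le_trans (uc n).
by apply: ereal_inf_lbound; exists n => /=.
Unshelve. all: by end_near. Qed.

Lemma limn_einf_ge u (c : \bar R) N : (forall n, (N <= n)%N -> c <= u n)%E ->
  (c <= limn_einf u)%E.
Proof.
move=> uc; rewrite limn_einf_lim; apply: lime_ge; first exact: is_cvg_einfs.
near=> n; apply: le_ereal_inf_tmp => _ [k /= nk <-]; apply: uc.
by apply: leq_trans nk; near: n; exact: nbhs_infty_ge.
Unshelve. all: by end_near. Qed.

Lemma fatou_ae {disp : measure_display} {T : measurableType disp}
    (mu : {measure set T -> \bar R}) (v : nat -> T -> R) (g : T -> R) (c : \bar R) :
  (forall n, measurable_fun setT (v n)) -> measurable_fun setT g ->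
  (forall n x, 0 <= v n x) -> (forall x, 0 <= g x) ->
  {ae mu, forall x, v n x @[n --> \oo] --> g x} ->
  (forall n, \int[mu]_x (v n x)%:E <= c)%E -> (\int[mu]_x (g x)%:E <= c)%E.
Proof.
move=> mv mg v0 g0 [N [mN N0 HN]] vc.
pose w n x := v n x * \1_(~` N) x.
have mC : measurable_fun setT (\1_(~` N) : T -> R) by apply: measurable_indic; exact: measurableC.
have w0 n x : 0 <= w n x by rewrite mulr_ge0// indicE ler0n.
have cw x : (w n x)%:E @[n --> \oo] --> (g x * \1_(~` N) x)%:E.
  apply: cvg_EFin; first by near=> n.
  have [Nx|nNx] := pselect (N x).
    have E0 : \1_(~` N) x = 0 :> R by rewrite indicE memNset//= => /(_ Nx).
    by rewrite E0 mulr0; apply: cvg_near_cst; near=> n; rewrite /= /w E0 mulr0.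
  apply: cvgM; last exact: cvg_cst.
  by apply: contrapT => nc; apply: nNx; exact: HN.
have -> : (\int[mu]_x (g x)%:E = \int[mu]_x (g x * \1_(~` N) x)%:E)%E.
  apply: ae_eq_integral => //; first exact/measurable_EFinP.
    by apply/measurable_EFinP; exact: measurable_funM.
  exists N; split => // x /= H; apply: contrapT => nNx; apply: H => _.
  by rewrite indicE mem_set// mulr1.
have -> : (\int[mu]_x (g x * \1_(~` N) x)%:E = \int[mu]_x limn_einf (fun n => (w n x)%:E))%E.
  apply: eq_integral => x _; have cwx := cw x.
  by rewrite (cvg_limn_einf_sup cwx).1.
apply: le_trans (fatou mu measurableT _ _) _.
- by move=> n; apply/measurable_EFinP; exact: measurable_funM.
- by move=> n x _; rewrite lee_fin.
apply: limn_einf_le => n; apply: le_trans (vc n).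
apply: ge0_le_integral => //.
- by move=> x _; rewrite lee_fin.
- by apply/measurable_EFinP; exact: measurable_funM.
- exact/measurable_EFinP.
- by move=> x _; rewrite lee_fin /w indicE ler_piMr//; case: (_ \in _); rewrite ?ler01.
Unshelve. all: by end_near. Qed.

End limn_einf_bounds.

Section riesz.
Context {R : realType} {j d : nat}.
Local Notation M := 'M[R]_(j, d).
Local Notation I := ('I_j * 'I_d)%type.
Variable m : {finite_measure set (borel M) -> \bar R}.
Variable Omega : set M.

Let mT : R := fine (m setT).

Let mTE : m setT = mT%:E.
Proof. by rewrite fineK// fin_num_measure. Qed.

Let mT0 : 0 <= mT. Proof. exact: fine_ge0. Qed.

Definition single (ik : I) (phi : M -> R) : @field R j d :=
  fun il x => (il == ik)%:R * phi x.

Lemma test_single ik phi : test Omega phi -> test_field Omega (single ik phi).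
Proof. by move=> t il; exact: testZ. Qed.

Lemma sum_single (F : I -> R) ik : \sum_il (il == ik)%:R * F il = F ik.
Proof.
rewrite (bigD1 ik)//= eqxx mul1r big1 ?addr0// => il /negbTE ->.
by rewrite mul0r.
Qed.

Lemma diverg_single ik phi x : test Omega phi -> diverg (single ik phi) x = partial ik phi x.
Proof.
move=> t; rewrite /diverg -[RHS](sum_single (fun il => partial il phi x) ik).
by apply: eq_bigr => il _; rewrite /single partialZ//; exact: test_smooth t.
Qed.

Lemma dot_single (a : @field R j d) ik phi x : dot a (single ik phi) x = a ik x * phi x.
Proof.
rewrite /dot -[RHS](sum_single (fun il => a il x * phi x) ik).
by apply: eq_bigr => il _; rewrite /single mulrCA.
Qed.

(** Riesz representation of the distributional gradient H m of m. Near maximizers of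
    the concave functional [dual] are close in mean square, so that a fast maximizing
    sequence converges in the mean; its limit satisfies the Euler-Lagrange equation,
    which says that it is 2 H. *)
Lemma dual_bounded_gradient (K : R) : (forall psi, test_field Omega psi -> dual m psi <= K) ->
  exists H : I -> M -> R, [/\ forall ik, measurable_fun [set: borel M] (H ik : borel M -> R),
    forall ik, m.-integrable setT (EFin \o H ik),
    (forall ik phi, test Omega phi ->
      \int[m]_x partial ik phi x = - \int[m]_x (H ik x * phi x)) &
    (\int[m]_x (\sum_ik H ik x ^+ 2)%:E <= K%:E)%E].
Proof.
move=> HK.
pose E : set R := [set dual m psi | psi in test_field Omega].
have E0 : E !=set0 by exists (dual m (fun _ _ => 0)); exists (fun _ _ => 0) => //; exact: test_field0.
have hE : has_sup E by split => //; exists K => _ [psi Hpsi <-]; exact: HK.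
pose S := sup E.
have HS psi : test_field Omega psi -> dual m psi <= S.
  by move=> Hpsi; apply: sup_upper_bound => //; exists psi.
have SK : S <= K by apply: ge_sup => // _ [psi Hpsi <-]; exact: HK.
(* psi n is optimal up to del n ^+ 2, so that psi n.+1 - psi n is of the order of
   del n in the mean. *)
pose del n : R := 2^-1 ^+ n.+1.
have del0 n : 0 < del n by rewrite exprn_gt0.
have del1 n : del n < 1 by rewrite exprn_ilt1// ?invr_ge0// invf_lt1// ltr1n.
have delS n : del n.+1 <= del n by rewrite /del [leLHS]exprS ler_piMl// ?invf_le1// ?ler1n// ltW.
have del_cvg : del n @[n --> \oo] --> 0.
  have : (2^-1 : R) ^+ n @[n --> \oo] --> (0 : R).
    by apply: cvg_expr; rewrite ger0_norm// invf_lt1// ltr1n.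
  by rewrite -cvg_shiftS.
have Hseq n : exists psi : @field R j d, test_field Omega psi /\ S - del n ^+ 2 <= dual m psi.
  have [_ [psi Hpsi <-] Hlt] := sup_adherent (exprn_gt0 2 (del0 n)) hE.
  by exists psi; split => //; exact: ltW.
pose psi n : @field R j d := sval (cid (Hseq n)).
have tpsi n : test_field Omega (psi n) by rewrite /psi; case: cid => ? [].
have max n : S - del n ^+ 2 <= dual m (psi n) by rewrite /psi; case: cid => ? [].
have mpsi n ik : measurable_fun [set: borel M] (psi n ik : borel M -> R).
  exact: measurable_test (tpsi n ik).
have fast ik n : (\int[m]_x (`|psi n.+1 ik x - psi n ik x|)%:E <= ((mT + 16) / 2 / 2 ^+ n)%:E)%E.
  have Hc := test_field_addZ (-1) (tpsi n.+1) (tpsi n).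
  have Hen : energy m (field_addZ (psi n.+1) (-1) (psi n)) <= 16 * del n ^+ 2.
    apply: (near_max_close HS (tpsi n) (tpsi n.+1)) => //.
    apply: le_trans (max n.+1); rewrite lerD2l lerN2 lerXn2r// nnegrE ltW//.
  set c := field_addZ _ _ _ in Hc Hen.
  have iE := test_integrable m (test_dot Hc Hc).
  have ic : m.-integrable setT (EFin \o (fun x => `|c ik x|)).
    by apply: integrable_norm; exact: (test_integrable m (Hc ik)).
  have le : \int[m]_x `|c ik x| <= \int[m]_x (del n / 2 + (2 * del n)^-1 * dot c c x).
    apply: le_Rintegral => //.
      apply: (@integrable_addR _ _ _ m setT measurableT (fun=> del n / 2)).
        exact: finite_measure_integrable_cst.
      exact: (test_integrable m (testZ (2 * del n)^-1 (test_dot Hc Hc))).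
    (* z <= del / 2 + z ^+ 2 / (2 * del) turns the bound in mean square into one in the
       mean. *)
    move=> x _; apply: (@le_trans _ _ (del n / 2 + (2 * del n)^-1 * (c ik x) ^+ 2)).
      have h : 0 <= (`|c ik x| - del n) ^+ 2 by exact: sqr_ge0.
      have dn := del0 n.
      rewrite -[c ik x ^+ 2]real_normK ?num_real// -subr_ge0.
      have -> : del n / 2 + (2 * del n)^-1 * `|c ik x| ^+ 2 - `|c ik x| =
          (2 * del n)^-1 * (`|c ik x| - del n) ^+ 2 by field; rewrite gt_eqF.
      by rewrite mulr_ge0// invr_ge0 mulr_ge0// ltW.
    rewrite lerD2l ler_wpM2l ?invr_ge0 ?mulr_ge0 ?(ltW (del0 n))//.
    rewrite /dot (bigD1 ik)//= -expr2 lerDl sumr_ge0// => il _.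
    by rewrite -expr2 sqr_ge0.
  have -> : (\int[m]_x (`|psi n.+1 ik x - psi n ik x|)%:E = (\int[m]_x `|c ik x|)%:E)%E.
    rewrite /Rintegral fineK; last by apply: integrable_fin_num.
    by apply: eq_integral => x _; rewrite /c /field_addZ mulN1r.
  rewrite lee_fin; apply: le_trans le _.
  rewrite RintegralD//; last 2 first.
  - exact: finite_measure_integrable_cst.
  - exact: (test_integrable m (testZ _ (test_dot Hc Hc))).
  rewrite Rintegral_cst// RintegralZl// -/(energy m c).
  rewrite -/mT.
  have h1 : (2 * del n)^-1 * energy m c <= 8 * del n.
    rewrite ler_pdivrMl; last by rewrite mulr_gt0.
    by apply: le_trans Hen _; nra.
  have h2 : del n <= (2 ^+ n)^-1.
    by rewrite /del exprS exprVn ler_piMl// ?invr_ge0 ?exprn_ge0// invf_le1// ler1n.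
  apply: (@le_trans _ _ ((mT + 16) / 2 * del n)); first by nra.
  by apply: ler_wpM2l h2; rewrite divr_ge0// addr_ge0.
have lim ik : exists g : M -> R, [/\ measurable_fun [set: borel M] (g : borel M -> R),
    m.-integrable setT (EFin \o g),
    {ae m, forall x : borel M, psi n ik x @[n --> \oo] --> g x} &
    (\int[m]_x (`|psi n ik x - g x|)%:E @[n --> \oo] --> 0)%E].
  have i0 := test_integrable m (tpsi 0%N ik).
  have [g [? ? ? ?]] := @L1_limit _ (borel M) R m (fun n => psi n ik) _ (fun n => mpsi n ik) i0 (fast ik).
  by exists g.
pose h ik : M -> R := sval (cid (lim ik)).
have hP ik : [/\ measurable_fun [set: borel M] (h ik : borel M -> R),
    m.-integrable setT (EFin \o h ik),
    {ae m, forall x : borel M, psi n ik x @[n --> \oo] --> h ik x} &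
    (\int[m]_x (`|psi n ik x - h ik x|)%:E @[n --> \oo] --> 0)%E].
  by rewrite /h; case: cid.
have mh ik : measurable_fun [set: borel M] (h ik : borel M -> R) by have [] := hP ik.
have ih ik : m.-integrable setT (EFin \o h ik) by have [] := hP ik.
exists (fun ik x => 2^-1 * h ik x); split.
- by move=> ik; apply: measurable_funM.
- by move=> ik; apply: (@integrableZl _ _ _ m setT measurableT 2^-1 _ (ih ik)).
- move=> ik phi tphi.
  have [mg ig _ cg] := hP ik.
  have [B B0 HB] := test_bounded tphi.
  have ihphi : m.-integrable setT (EFin \o (fun x => h ik x * phi x)).
    have mphi : measurable_fun [set: borel M] (phi : borel M -> R) by exact: measurable_test tphi.
    apply: (@le_integrable _ _ _ m setT measurableT _ (EFin \o (fun x => B * h ik x))).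
    - by apply/measurable_EFinP; exact: measurable_funM.
    - move=> x _; rewrite /= lee_fin !normrM mulrC ler_wpM2r// (le_trans (HB x))//.
      exact: ler_norm.
    - exact: (@integrableZl _ _ _ m setT measurableT B _ ig).
  have iphi := test_integrable m (test_partial ik tphi).
  have ihphi2 : m.-integrable setT (EFin \o (fun x => 2^-1 * h ik x * phi x)).
    have := @integrableZl _ _ _ m setT measurableT 2^-1 _ ihphi.
    by apply: eq_integrable => // x _ /=; rewrite -EFinM mulrA.
  pose D := \int[m]_x partial ik phi x + \int[m]_x (2^-1 * h ik x * phi x).
  suff : `|D| <= 0.
    by rewrite normr_le0 addr_eq0 => /eqP.
  pose a n : R := \int[m]_x `|psi n ik x - h ik x|.
  have a0 : a n @[n --> \oo] --> 0.
    by have := fine_cvg cg; apply.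
  pose C := 1 + energy m (single ik phi) / 4.
  have dl : del n * C + B / 2 * a n @[n --> \oo] --> 0.
    rewrite -[X in _ --> X](_ : 0 * C + B / 2 * 0 = 0); last by rewrite mul0r mulr0 addr0.
    apply: cvgD; apply: cvgM => //; try exact: cvg_cst.
  apply: (cvgr_to_ge dl); near=> n.
  have H := near_max_diff HS (tpsi n) (test_single ik tphi) (del0 n) (max n).
  have ipsi := test_integrable m (testMl (tpsi n ik) (test_smooth tphi)).
  have ipsi2 : m.-integrable setT (EFin \o (fun x => 2^-1 * (psi n ik x * phi x))).
    exact: (test_integrable m (testZ 2^-1 (testMl (tpsi n ik) (test_smooth tphi)))).
  have E1 : dual_diff m (psi n) (single ik phi) =
     \int[m]_x partial ik phi x + \int[m]_x (2^-1 * (psi n ik x * phi x)).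
    rewrite -RintegralD//; apply: eq_Rintegral => x _.
    by rewrite (diverg_single _ _ tphi) dot_single mulrC.
  have iabs : m.-integrable setT (EFin \o (fun x => `|psi n ik x - h ik x|)).
    apply: integrable_norm.
    exact: (@integrableB _ _ _ m setT measurableT _ _ (test_integrable m (tpsi n ik)) ig).
  have E2 : `|\int[m]_x (2^-1 * h ik x * phi x) - \int[m]_x (2^-1 * (psi n ik x * phi x))| <= B / 2 * a n.
    rewrite -RintegralB// /a -RintegralZl//.
    apply: le_trans (le_normr_Rintegral measurableT _) _.
      exact: (@integrableB _ _ _ m setT measurableT _ _ ihphi2 ipsi2).
    apply: le_Rintegral => //.
    - apply: integrable_norm.
      exact: (@integrableB _ _ _ m setT measurableT _ _ ihphi2 ipsi2).
    - exact: (@integrableZl _ _ _ m setT measurableT (B / 2) _ iabs).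
    - move=> x _.
      have -> : 2^-1 * h ik x * phi x - 2^-1 * (psi n ik x * phi x) =
        - (phi x / 2 * (psi n ik x - h ik x)) by field.
      rewrite normrN normrM ler_wpM2r// normrM (_ : `|2^-1| = 2^-1); last by rewrite ger0_norm.
      by rewrite ler_wpM2r.
  have -> : D = dual_diff m (psi n) (single ik phi) +
     (\int[m]_x (2^-1 * h ik x * phi x) - \int[m]_x (2^-1 * (psi n ik x * phi x))).
    by rewrite E1 /D; ring.
  by rewrite (le_trans (ler_normD _ _))// lerD.
- apply/lee_addgt0Pr => e e0.
  have [N HN] : exists N, forall n, (N <= n)%N -> energy m (psi n) / 4 <= S + e.
    have dl : (S + del n) / (1 - del n) @[n --> \oo] --> (S + 0) / (1 - 0).
      apply: cvgM; first by apply: cvgD => //; exact: cvg_cst.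
      apply: cvgV; first by rewrite subr0 oner_neq0.
      by apply: cvgB => //; exact: cvg_cst.
    rewrite addr0 subr0 divr1 in dl.
    have [N _ HN] : \forall n \near \oo, (S + del n) / (1 - del n) <= S + e.
      by apply: (cvgr_le S dl); rewrite ltrDl.
    exists N => n Nn; apply: le_trans (HN n Nn).
    rewrite ler_pdivlMr; last by rewrite subr_gt0.
    by rewrite mulrC; exact: (near_max_energy HS (tpsi n) (del0 n) (del1 n) (max n)).
  have le : (\int[m]_x (\sum_ik (2^-1 * h ik x) ^+ 2)%:E <= (S + e)%:E)%E.
    apply: (@fatou_ae _ _ _ m (fun n x => 4^-1 * dot (psi (n + N)%N) (psi (n + N)%N) x)) => //.
    - move=> n; apply: (@measurable_test R j d Omega); apply: testZ; exact: test_dot.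
    - by apply: measurable_sum => ik; apply: measurable_funX; exact: measurable_funM.
    - move=> n x; rewrite mulr_ge0// sumr_ge0// => ik _.
      by rewrite -expr2 sqr_ge0.
    - by move=> x; rewrite sumr_ge0// => ik _; rewrite sqr_ge0.
    - have : {ae m, forall x : borel M, forall ik, psi n ik x @[n --> \oo] --> h ik x}.
        apply: filter_forall => ik; by have [] := hP ik.
      apply: filterS => x Hx.
      rewrite (_ : (fun n => _) = (fun n => \sum_ik (2^-1 * psi (n + N)%N ik x) ^+ 2)); last first.
        apply/funext => n; rewrite /dot mulr_sumr; apply: eq_bigr => ik _; by field.
      apply: (@cvg_big _ _ +%R 0 xpredT add_continuous) => ik _.
      under eq_fun do rewrite expr2; rewrite expr2.
      have Hs : 2^-1 * psi (n + N)%N ik x @[n --> \oo] --> 2^-1 * h ik x.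
        apply: cvgM; first exact: cvg_cst.
        by rewrite (cvg_shiftn N (fun n => psi n ik x)); exact: Hx.
      exact: cvgM.
    - move=> n.
      have t4 := test_integrable m (testZ 4^-1 (test_dot (tpsi (n + N)%N) (tpsi (n + N)%N))).
      rewrite -(@fineK _ (\int[m]_x _)%E); last exact: integrable_fin_num.
      rewrite lee_fin; apply: le_trans (HN (n + N)%N (leq_addl _ _)).
      rewrite /energy mulrC -RintegralZl//.
      exact: test_integrable (test_dot _ _).
  by apply: le_trans le _; rewrite -EFinD lee_fin lerD2r.
Unshelve. all: by end_near. Qed.

End riesz.

(** * The dual formula for the Fisher information *)

Lemma test_out {R : realType} {j d : nat} (Omega : set 'M[R]_(j, d)) phi x :
  test Omega phi -> ~ Omega x -> phi x = 0.
Proof. by move=> /testP[_ [K [_ KO phi0]]] nOx; apply: phi0 => /KO. Qed.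

Section ambient.
Context {R : realType} {j d : nat}.
Local Notation M := 'M[R]_(j, d).
Local Notation I := ('I_j * 'I_d)%type.
Local Notation leb := (lebesgue_mx R j d).
Context {Omega : set M} {Omega0 : Omega !=set0}.

Lemma measurable_pts_val :
  measurable_fun [set: borel (pts Omega0)] (@pts_val _ Omega Omega0 : borel (pts Omega0) -> borel M).
Proof. by apply: continuous_borel; exact: pts_val_continuous. Qed.

(** A law on Omega as a measure on the whole space of matrices, where the test functions
    live. *)
Definition amb (F : Prob R (pts Omega0)) : probability (borel M) R :=
  ppush measurable_pts_val (F : probability (borel (pts Omega0)) R).

Variable F : Prob R (pts Omega0).
Local Notation m := (amb F).

Lemma amb_compl : m (~` Omega) = 0%E.
Proof.
rewrite /amb /ppush /= /mpush /= /pushforward (_ : _ @^-1` _ = set0) ?measure0//.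
by apply/seteqP; split => // x /=; apply; exact: set_valP.
Qed.

Hypothesis oOmega : open Omega.

Let mO : measurable (Omega : set (borel M)).
Proof. exact: borel_open. Qed.

Lemma amb_setI (A : set (borel M)) : measurable A -> m A = m (Omega `&` A).
Proof.
move=> mA; rewrite -[A in LHS]setIT -(setUv Omega) setIUr measureU//.
- rewrite [X in (_ + X)%E](_ : _ = 0%E) ?adde0 1?setIC//.
  apply: (@subset_measure0 _ _ _ m _ (~` Omega)) => //.
  + by apply: measurableI => //; exact: measurableC.
  + exact: measurableC.
  + exact: amb_compl.
- exact: measurableI.
- by apply: measurableI => //; exact: measurableC.
- by rewrite setIACA setICr setI0.
Qed.

Section admissible.
Variables (f : M -> R) (g : M -> M).
Hypotheses (Ff : has_density F f) (Wfg : W11 Omega f g).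

Lemma amb_dominated (A : set (borel M)) : measurable A -> leb A = 0%E -> m A = 0%E.
Proof.
move=> mA A0; rewrite [m A]Ff//.
apply: null_set_integral.
- exact: measurableI.
- by apply: (measurable_int leb); apply: (integrableS mO _ _ Wfg.1) => //; exact: measurableI.
- by apply: (@subset_measure0 _ _ _ leb _ A) => //; exact: measurableI.
Qed.

Let mdens : measurable_fun [set: borel M] (dens m : borel M -> R).
Proof. exact: (@measurable_dens R j d m amb_dominated). Qed.

Let dens0 x : 0 <= dens m x.
Proof. exact: dens_ge0 amb_dominated x. Qed.

Lemma density_dens : {ae leb, forall x : borel M, Omega x -> f x = dens m x}.
Proof.
have [iF _] := Wfg.
have H : {ae leb, forall x : borel M, Omega x -> (EFin \o f) x = (EFin \o dens m) x}.
  apply: (integral_ae_eq mO iF).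
    by apply/measurable_EFinP; apply: (measurable_funTS mdens).
  move=> A AO mA; have [->|A0] := eqVneq A set0; first by rewrite !integral_set0.
  transitivity (m A); last first.
    have E := dens_measure amb_dominated mA; exact: E.
  rewrite [RHS]Ff//; by congr (integral _ _ _); apply/esym/setIidPr.
by apply: filterS H => x Hx Ox; have [] := Hx Ox.
Qed.

Lemma weak_gradient phi ik : test Omega phi ->
  \int[m]_x partial ik phi x = - \int[leb]_(x in Omega) (g x ik.1 ik.2 * phi x).
Proof.
move=> tphi; have tp := test_partial ik tphi.
have [iF /(_ ik.1 ik.2)[_ /(_ phi)]] := Wfg.
rewrite -surjective_pairing => <-; last exact/testP.
rewrite (@integral_dens _ _ _ m amb_dominated)//; last 2 first.
- exact: measurable_test tp.
- exact: test_integrable tp.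
rewrite (@Rintegral_support _ _ _ _ (Omega : set (borel M))); last first.
  by move=> x nOx; rewrite (test_out tp)// mul0r.
congr fine; apply: ae_eq_integral => //.
- apply/measurable_EFinP/measurable_funTS/measurable_funM; last exact: mdens.
  exact: measurable_test tp.
- apply/measurable_EFinP/measurable_funM; last first.
    by apply: measurable_funTS; exact: measurable_test tp.
  by apply/measurable_EFinP; exact: (measurable_int _ Wfg.1).
- by apply: filterS density_dens => x Hx Ox; rewrite /= Hx// mulrC.
Qed.

(** Where the density vanishes so does the measure, and [weak_derivative_null] applies. *)
Lemma gradient_null : {ae leb, forall x : borel M, Omega x -> dens m x = 0 -> forall i k, g x i k = 0}.
Proof.
have mZ : measurable ([set x | dens m x = 0] : set (borel M)).
  have := mdens measurableT (measurable_set1 0); rewrite setTI.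
  exact.
have H (ik : I) : {ae leb, forall x : borel M, Omega x -> [set x | dens m x = 0] x -> g x ik.1 ik.2 = 0}.
  apply: (@weak_derivative_null R j d Omega oOmega m _ ik [set x | dens m x = 0]) => //.
  - by have [_ /(_ ik.1 ik.2)[]] := Wfg.
  - by move=> phi tphi; exact: weak_gradient.
  - rewrite (dens_measure amb_dominated mZ) integral0_eq// => x /= Zx.
    by rewrite Zx.
have : {ae leb, forall x : borel M, forall ik : I, Omega x -> [set x | dens m x = 0] x -> g x ik.1 ik.2 = 0}.
  exact: filter_forall.
by apply: filterS => x Hx Ox Zx i k; exact: (Hx (i, k)).
Qed.

Let fi x : R := (\sum_i \sum_k g x i k ^+ 2) / f x.
Let di x : R := (\sum_i \sum_k g x i k ^+ 2) / dens m x.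

Let di0 x : 0 <= di x.
Proof.
rewrite divr_ge0 ?dens0//; apply: sumr_ge0 => i _; apply: sumr_ge0 => k _; exact: sqr_ge0.
Qed.

Let mg i k : measurable_fun (Omega : set (borel M)) (fun x : borel M => g x i k).
Proof. by apply/measurable_EFinP; have [_ /(_ i k)[/measurable_int]] := Wfg. Qed.

Let ms : measurable_fun (Omega : set (borel M)) (fun x : borel M => \sum_i \sum_k g x i k ^+ 2).
Proof. by apply: measurable_sum => i; apply: measurable_sum => k; exact: measurable_funX. Qed.

Let mdi : measurable_fun (Omega : set (borel M)) (di : borel M -> R).
Proof.
apply: measurable_funM => //; apply: (measurableT_comp measurable_invr).
by exact: (measurable_funTS mdens).
Qed.

Let fidi : (\int[leb]_(x in Omega) (fi x)%:E = \int[leb]_(x in Omega) (di x)%:E)%E.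
Proof.
apply: ae_eq_integral => //.
- apply/measurable_EFinP; apply: measurable_funM => //; apply: (measurableT_comp measurable_invr).
  by apply/measurable_EFinP; exact: (measurable_int _ Wfg.1).
- exact/measurable_EFinP.
- by apply: filterS density_dens => x Hx Ox; rewrite /fi /di /= Hx.
Qed.

(** Integrate by parts and apply Young's inequality pointwise:
    g . psi - f |psi|^2 / 4 <= |g|^2 / f. *)
Lemma dual_le_admissible psi : test_field Omega psi ->
  ((dual m psi)%:E <= \int[leb]_(x in Omega) ((\sum_i \sum_k g x i k ^+ 2) / f x)%:E)%E.
Proof.
move=> tpsi; rewrite fidi.
pose w x : R := \sum_(ik : I) g x ik.1 ik.2 * psi ik x - dot psi psi x / 4 * dens m x.
have tpp := test_dot tpsi tpsi.
have tq : test Omega (fun x => dot psi psi x / 4) by apply: testMl => //; exact: smooth_cst.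
have igp (ik : I) : leb.-integrable (Omega : set (borel M)) (EFin \o (fun x => g x ik.1 ik.2 * psi ik x)).
  have [B B0 HB] := test_bounded (tpsi ik).
  have [_ /(_ ik.1 ik.2)[ig _]] := Wfg.
  apply: (@integrable_mul_bounded R j d (fun x => g x ik.1 ik.2) (psi ik) Omega mO ig).
    exact: (measurable_funTS (measurable_test (tpsi ik))).
  by exists B => x _; exact: HB.
have iqd : leb.-integrable (Omega : set (borel M)) (EFin \o (fun x => dot psi psi x / 4 * dens m x)).
  apply: (@integrable_mul_dens _ _ _ m amb_dominated) => //; first exact: measurable_test tq.
  by apply: integrableS (test_integrable m tq).
have isg : leb.-integrable (Omega : set (borel M))
    (EFin \o (fun x => \sum_(ik : I) g x ik.1 ik.2 * psi ik x)).
  by apply: integrable_sumR.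
have iw : leb.-integrable (Omega : set (borel M)) (EFin \o w) by exact: integrable_subR.
have -> : dual m psi = \int[leb]_(x in Omega) w x.
  rewrite /w RintegralB// Rintegral_sum//.
  rewrite -(@integral_dens _ _ _ m amb_dominated)//; last 2 first.
  - exact: measurable_test tq.
  - by apply: integrableS (test_integrable m tq).
  rewrite /dual /dual_integrand RintegralB//; last 2 first.
  - exact: (test_integrable m (testN (test_diverg tpsi))).
  - exact: (test_integrable m tq).
  congr (_ - _); last first.
    by apply: Rintegral_support => x nOx; rewrite (test_out tq).
  rewrite (_ : \int[m]_x _ = \sum_(ik : I) \int[m]_x (- partial ik (psi ik) x)).
    apply: eq_bigr => ik _; rewrite -[RHS]opprK -weak_gradient//.
    rewrite -[RHS]mulN1r -RintegralZl//; last exact: test_integrable (test_partial ik (tpsi ik)).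
    by apply: eq_Rintegral => x _; rewrite mulN1r.
  rewrite -Rintegral_sum//; last first.
    by move=> ik; exact: (test_integrable m (testN (test_partial ik (tpsi ik)))).
  by apply: eq_Rintegral => x _; rewrite sumrN.
rewrite /Rintegral fineK; last exact: integrable_fin_num.
apply: (@le_trans _ _ (\int[leb]_(x in Omega) (Num.max (w x) 0)%:E)%E).
  apply: le_integral => //.
  - apply: (le_integrable mO _ _ iw).
      apply/measurable_EFinP; apply: measurable_maxr => //.
      by apply/measurable_EFinP; exact: measurable_int iw.
    move=> x _ /=; rewrite lee_fin ger0_norm ?le_max ?lexx ?orbT// ge_max normr_ge0 andbT.
    exact: ler_norm.
  - by move=> x _; rewrite lee_fin le_max lexx.
apply: ae_ge0_le_integral => //.
- by move=> x _; rewrite lee_fin le_max lexx orbT.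
- apply/measurable_EFinP; apply: measurable_maxr => //.
  by apply/measurable_EFinP; exact: measurable_int iw.
- by move=> x _; rewrite lee_fin.
- exact/measurable_EFinP.
apply: filterS gradient_null => x Hx Ox.
rewrite lee_fin ge_max di0 andbT /w /di.
rewrite (pair_big xpredT xpredT (fun i k => g x i k ^+ 2))/=.
rewrite mulr_suml /dot !mulr_suml -sumrB; apply: ler_sum => ik _.
have [q0|q0] := eqVneq (dens m x) 0.
  by rewrite (Hx Ox q0) q0 mul0r mulr0 invr0 mulr0 subrr.
have {}q0 : 0 < dens m x by rewrite lt_neqAle eq_sym q0 dens0.
rewrite ler_pdivlMr// -subr_ge0.
have -> : g x ik.1 ik.2 ^+ 2 - (g x ik.1 ik.2 * psi ik x - psi ik x * psi ik x / 4 * dens m x) * dens m x =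
  (g x ik.1 ik.2 - psi ik x * dens m x / 2) ^+ 2 by field.
exact: sqr_ge0.
Qed.

End admissible.


(** Multiples of fields with a single entry bound the distributional derivatives, hence
    there is a density by [null_of_bounded_derivative], and [dual_bounded_gradient]
    gives its weak gradient. *)
Lemma admissible_of_dual_le (K : R) : (forall psi, test_field Omega psi -> dual m psi <= K) ->
  exists f g, [/\ has_density F f, W11 Omega f g &
    (\int[leb]_(x in Omega) ((\sum_i \sum_k g x i k ^+ 2) / f x)%:E <= K%:E)%E].
Proof.
move=> HK.
have K0 : 0 <= K by rewrite -(dual0 m); apply: HK; exact: test_field0.
have dom : forall A : set (borel M), measurable A -> leb A = 0%E -> m A = 0%E.
  apply: (@null_of_bounded_derivative R j d Omega oOmega m (K + 4^-1)).
  - by rewrite addr_ge0// invr_ge0.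
  - move=> phi ik tphi phi1.
    (* Test with the field whose entry ik is - s phi; s is 1 or - 1. *)
    have H (s : R) : s ^+ 2 = 1 -> s * \int[m]_x partial ik phi x <= K + 4^-1.
      move=> s1.
      have ts : test_field Omega (single ik (fun x => - s * phi x)).
        by apply: test_single; exact: testZ.
      have := HK _ ts; rewrite -lerBlDr => HKs; apply: le_trans HKs.
      have tp := test_partial ik tphi.
      have -> : s * \int[m]_x partial ik phi x - 4^-1 = \int[m]_x (s * partial ik phi x - 4^-1).
        rewrite RintegralB//.
        + rewrite RintegralZl//; last exact: test_integrable tp.
          by rewrite Rintegral_cst// [fine _](_ : _ = 1) ?mulr1// probability_setT.
        + exact: (test_integrable m (testZ s tp)).
        + exact: finite_measure_integrable_cst.
      apply: le_Rintegral => //.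
      + apply: integrable_subR => //; first exact: (test_integrable m (testZ s tp)).
        exact: finite_measure_integrable_cst.
      + exact: (test_integrable m (test_dual_integrand ts)).
      move=> x _; rewrite /dual_integrand (diverg_single ik x (testZ (- s) tphi)).
      rewrite dot_single /single eqxx mul1r partialZ; last exact: test_smooth tphi.
      rewrite mulNr opprK lerD2l lerN2 -[leRHS]mul1r ler_wpM2r ?invr_ge0//.
      rewrite mulNr mulrN mulNr opprK mulrACA -expr2 s1 mul1r -expr2.
      by rewrite -[leLHS]real_normK ?num_real// expr_le1.
    rewrite ler_norml; apply/andP; split.
      by rewrite lerNl -mulN1r; apply: H; rewrite sqrrN expr1n.
    by rewrite -[leLHS]mul1r; apply: H; rewrite expr1n.
  - exact: amb_compl.
have [H [mH iH weakH leH]] := dual_bounded_gradient HK.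
exists (dens m), (fun x => \matrix_(i, k) (H (i, k) x * dens m x)).
have mq : measurable_fun [set: borel M] (dens m : borel M -> R) by exact: measurable_dens.
have q0 x : 0 <= dens m x by exact: dens_ge0.
split.
- move=> A mA; transitivity (m A) => //; rewrite amb_setI//.
  by have E := dens_measure dom (measurableI _ _ mO mA); exact: E.
- split.
    by apply: (integrableS measurableT mO) => //; exact: integrable_dens.
  move=> i k; split.
    under eq_fun do rewrite mxE.
    apply: (@integrable_mul_dens _ _ _ m dom) => //.
    exact: (integrableS measurableT mO).
  move=> phi /testP tphi; have tp := test_partial (i, k) tphi.
  under [X in _ = - X]eq_Rintegral do rewrite mxE mulrAC.
  have [B B0 HB] := test_bounded tphi.
  have mphi : measurable_fun [set: borel M] (phi : borel M -> R) by exact: measurable_test tphi.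
  have ihphi : m.-integrable setT (EFin \o (fun x => H (i, k) x * phi x)).
    apply: (@le_integrable _ _ _ m setT measurableT _ (EFin \o (fun x => B * H (i, k) x))).
    - by apply/measurable_EFinP; exact: measurable_funM.
    - move=> x _; rewrite /= lee_fin !normrM mulrC ler_wpM2r// (le_trans (HB x))//.
      exact: ler_norm.
    - exact: (@integrableZl _ _ _ m setT measurableT B _ (iH (i, k))).
  have := weakH (i, k) phi tphi.
  rewrite (@integral_dens _ _ _ m dom)//; last 2 first.
  - exact: measurable_test tp.
  - exact: test_integrable tp.
  rewrite (@integral_dens _ _ _ m dom)//; last exact: measurable_funM.
  rewrite (@Rintegral_support _ _ _ _ (Omega : set (borel M))); last first.
    by move=> x nOx; rewrite (test_out tp)// mul0r.
  rewrite [in X in _ = X -> _](@Rintegral_support _ _ _ _ (Omega : set (borel M))); last first.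
    by move=> x nOx; rewrite (test_out tphi)// mulr0 mul0r.
  by move=> <-; apply: eq_Rintegral => x _; rewrite mulrC.
- apply: le_trans leH.
  have mH2 : measurable_fun [set: borel M] (fun x : borel M => \sum_ik H ik x ^+ 2).
    by apply: measurable_sum => ik; exact: measurable_funX.
  have H20 x : 0 <= \sum_ik H ik x ^+ 2 by apply: sumr_ge0 => ik _; exact: sqr_ge0.
  rewrite (ge0_integral_dens dom measurableT mH2 H20).
  apply: (@le_trans _ _ (\int[leb]_(x in Omega) ((\sum_ik H ik x ^+ 2) * dens m x)%:E)%E).
    rewrite le_eqVlt; apply/orP; left; apply/eqP; apply: eq_integral => x _; congr EFin.
    rewrite (pair_big xpredT xpredT (fun i k => (\matrix_(i, k) (H (i, k) x * dens m x)) i k ^+ 2))/=.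
    rewrite !mulr_suml; apply: eq_bigr => -[i k] _ /=; rewrite mxE exprMn -mulrA; congr (_ * _).
    by have [->|q1] := eqVneq (dens m x) 0; [rewrite invr0 mulr0|rewrite expr2 mulfK].
  apply: ge0_subset_integral => //.
  - by apply/measurable_EFinP; exact: measurable_funM.
  - by move=> x _; rewrite lee_fin mulr_ge0.
Qed.

(** The densities agree almost everywhere, and so do the weak gradients: their difference
    is the weak gradient of the zero measure. *)
Lemma fisher_integral_unique f g f' g' : has_density F f -> W11 Omega f g ->
  has_density F f' -> W11 Omega f' g' ->
  (\int[leb]_(x in Omega) ((\sum_i \sum_k g x i k ^+ 2) / f x)%:E =
   \int[leb]_(x in Omega) ((\sum_i \sum_k g' x i k ^+ 2) / f' x)%:E)%E.
Proof.
move=> Ff W Ff' W'.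
have ms (h : M -> M) : (forall i k, leb.-integrable Omega (fun x => (h x i k)%:E)) ->
    measurable_fun (Omega : set (borel M)) (fun x : borel M => \sum_i \sum_(k < d) (h x : M) i k ^+ 2).
  move=> ih; apply: measurable_sum => i; apply: measurable_sum => k; apply: measurable_funX.
  by apply/measurable_EFinP; exact: measurable_int (ih i k).
have mi f1 g1 : W11 Omega f1 g1 -> measurable_fun (Omega : set (borel M))
    (fun x : borel M => ((\sum_i \sum_k (g1 x : M) i k ^+ 2) / f1 x)%:E).
  move=> [if1 ig1]; apply/measurable_EFinP/measurable_funM.
    by apply: ms => i k; have [] := ig1 i k.
  apply: (measurableT_comp measurable_invr).
  by apply/measurable_EFinP; exact: (measurable_int _ if1).
apply: ae_eq_integral => //; [exact: mi|exact: mi|].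
have H (ik : I) : {ae leb, forall x : borel M, Omega x -> [set: borel M] x ->
    g x ik.1 ik.2 - g' x ik.1 ik.2 = 0}.
  have [_ /(_ ik.1 ik.2)[ig wg]] := W; have [_ /(_ ik.1 ik.2)[ig' wg']] := W'.
  apply: (@weak_derivative_null R j d Omega oOmega mzero (fun x => g x ik.1 ik.2 - g' x ik.1 ik.2) ik setT) => //.
    exact: integrable_subR.
  move=> phi tphi; rewrite [LHS](_ : _ = 0); last first.
    by rewrite /Rintegral integral_measure_zero.
  have [B B0 HB] := test_bounded tphi.
  have igp (h : M -> M) : leb.-integrable Omega (fun x => (h x ik.1 ik.2)%:E) ->
      leb.-integrable (Omega : set (borel M)) (EFin \o (fun x => h x ik.1 ik.2 * phi x)).
    move=> ih; apply: (@integrable_mul_bounded R j d (fun x => h x ik.1 ik.2) phi Omega mO ih).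
      exact: (measurable_funTS (measurable_test tphi)).
    by exists B => x _; exact: HB.
  under [X in _ = - X]eq_Rintegral do rewrite mulrBl.
  rewrite RintegralB//; [|exact: igp|exact: igp].
  rewrite opprB -[X in X - _]opprK -(weak_gradient Ff' W' ik tphi).
  by rewrite (weak_gradient Ff W ik tphi) opprK subrr.
have : {ae leb, forall x : borel M, forall ik : I, Omega x -> [set: borel M] x ->
    g x ik.1 ik.2 - g' x ik.1 ik.2 = 0} by exact: filter_forall.
apply: filterS3 (density_dens Ff W) (density_dens Ff' W') => x Hf Hf' Hg Ox.
rewrite Hf// Hf'//; congr (_ / _)%:E; apply: eq_bigr => i _; apply: eq_bigr => k _.
by have /eqP := Hg (i, k) Ox Logic.I; rewrite subr_eq0 => /eqP ->.
Qed.

(** [dual_le_admissible] and [admissible_of_dual_le] are the two inequalities;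
    [fisher_integral_unique] relates the density and the gradient built in the second
    one to those selected by the definition of [fisher]. *)
Theorem fisher_dual : (0 < j)%N ->
  fisher F = ((j%:R^-1)%:E * ereal_sup [set (dual m psi)%:E | psi in test_field Omega])%E.
Proof.
move=> j0.
set S := ereal_sup _.
have S0 : (0 <= S)%E.
  apply: ereal_sup_ubound; exists (fun _ _ => 0); first exact: test_field0.
  by rewrite dual0.
have HS : S \is a fin_num -> forall psi, test_field Omega psi -> dual m psi <= fine S.
  move=> fS psi tpsi; rewrite -lee_fin (fineK fS).
  by apply: (@ereal_sup_ubound R [set (dual m psi)%:E | psi in test_field Omega]); exists psi.
rewrite /fisher; case: pselect => [h|h].
  case: cid => -[f g] /= [Ff W]; rewrite /fisher_integral; congr (_ * _)%E.
  apply/eqP; rewrite eq_le; apply/andP; split; last first.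
    by apply: ge_ereal_sup => _ [psi tpsi <-]; exact: dual_le_admissible.
  have [->|Soo] := eqVneq S +oo%E; first by rewrite leey.
  have fS : S \is a fin_num by rewrite ge0_fin_numE// ltey.
  have [f' [g' [Ff' W' le]]] := admissible_of_dual_le (HS fS).
  by rewrite (fisher_integral_unique Ff W Ff' W') -(fineK fS).
have [->|Soo] := eqVneq S +oo%E.
  by rewrite gt0_muley// lte_fin invr_gt0 ltr0n.
have fS : S \is a fin_num by rewrite ge0_fin_numE// ltey.
have [f [g [Ff W _]]] := admissible_of_dual_le (HS fS).
by exfalso; apply: h; exists (f, g).
Qed.

End ambient.

(** * A dense sequence of test fields *)

Section separability.
Context {R : realType} {j d : nat}.
Local Notation M := 'M[R]_(j, d).
Local Notation code := (('M[rat]_(j, d) * rat) * rat)%type.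

Definition in_code (c : code) (x : M) : Prop :=
  0 < code_radius (R := R) c.1 /\
  forall i k, `|x i k - code_center (R := R) c.1 i k| < code_radius (R := R) c.1.

(** A step function with rational data: the first ball of the list that contains the
    point decides the value. *)
Fixpoint step (q : seq code) (x : M) : R :=
  if q is c :: q' then if `[< in_code c x >] then ratr c.2 else step q' x else 0.

Lemma open_in_code c : open (in_code c).
Proof.
have [r0|r0] := ltP 0 (code_radius (R := R) c.1).
  rewrite (_ : in_code c = ball (code_center (R := R) c.1) (code_radius (R := R) c.1)).
    exact: ball_open.
  by apply/seteqP; split=> x; [move=> [_ h]; exact/ball_coordP|move=> /(ball_coordP _ _ r0)].
rewrite (_ : in_code c = set0); first exact: open0.
by apply/seteqP; split=> x // [h]; rewrite ltNge r0 in h.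
Qed.

Lemma step_cases (v : M -> R) e q x :
  (forall c, c \in q -> forall y, in_code c y -> `|v y - ratr c.2| <= e) ->
  `|v x - step q x| <= e \/ step q x = 0 /\ forall c, c \in q -> ~ in_code c x.
Proof.
elim: q => [|c q ih] H /=; first by right.
case: asboolP => cx; first by left; apply: H => //; rewrite mem_head.
have [|//|[-> nx]] := ih; first by move=> c' qc'; apply: H; rewrite inE qc' orbT.
  by left.
by right; split => // c'; rewrite inE => /predU1P[->|/nx].
Qed.

(** Finitely many balls with rational data, on each of which v is nearly constant, cover
    the support. *)
Lemma step_approximation (v : M -> R) (K : set M) (e : R) : continuous v ->
  compact K -> (forall x, ~ K x -> v x = 0) -> 0 < e ->
  exists q, forall x, `|v x - step q x| <= e.
Proof.
move=> cv cK v0 e0.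
pose D : set code := [set c | forall y, in_code c y -> `|v y - ratr c.2| <= e].
have cov : K `<=` \bigcup_(c in D) in_code c.
  move=> x _.
  have [r rE] := @ratr_close R (v x) (e / 2) ltac:(lra).
  have /nbhs_ballP[s /= s0 Hs] : nbhs x [set y | `|v x - v y| < e / 2].
    by have /cvgrPdist_lt := cv x; apply; lra.
  have /rat_in_itvoo[t] : s / 4 < s / 2 by lra.
  rewrite in_itv/= => /andP[t1 t2].
  have hc i k : exists q : rat, `|x i k - ratr q| < s / 16 by apply: ratr_close; lra.
  pose c : code := ((\matrix_(i, k) sval (cid (hc i k)), t), r).
  have xc i k : `|x i k - code_center (R := R) c.1 i k| < s / 16 by rewrite !mxE; case: cid.
  exists c; last by split=> [|i k]; [|apply: lt_trans (xc i k) _]; rewrite /code_radius/=; lra.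
  move=> y [_ yc].
  have : `|v x - v y| < e / 2.
    apply: Hs; apply/ball_coordP => // i k.
    have := xc i k; have := yc i k; rewrite /code_radius /= distrC => h1 h2.
    rewrite distrC -(subrK (code_center (R := R) c.1 i k) (x i k)) -addrA.
    rewrite (le_lt_trans (ler_normD _ _))//; lra.
  move=> h; rewrite -(subrK (v x) (v y)) -addrA.
  rewrite (le_trans (ler_normD _ _))// distrC /=; lra.
rewrite compact_cover in cK.
have [D' D'D KD'] := cK code D in_code (fun c _ => @open_in_code c) cov.
exists (finmap.enum_fset D') => x.
have [//|[-> nx]] := @step_cases v e (finmap.enum_fset D') x (fun c cD => set_mem (D'D c cD)).
rewrite v0 ?subrr ?normr0 ?ltW// => Kx.
by have [c cD'] := KD' x Kx; exact: nx.
Qed.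

Variable Omega : set M.

Let good (qp : seq code * nat) (psi : @field R j d) :=
  test_field Omega psi /\ forall x, `|dual_integrand psi x - step qp.1 x| <= qp.2.+1%:R^-1.

(** Step functions with rational data are countably many and come uniformly close to the
    dual integrand of any test field; each of them selects, at each precision, a test
    field whose dual integrand is that close to it, if there is one. *)
Lemma dense_fields : exists psi : nat -> @field R j d,
  [/\ forall n, test_field Omega (psi n), psi 0%N = (fun _ _ => 0) &
    forall a e, test_field Omega a -> 0 < e ->
      exists n, forall x, `|dual_integrand a x - dual_integrand (psi n) x| <= e].
Proof.
pose pick (n : nat) : @field R j d :=
  if @unpickle (seq code * nat)%type n is Some qp then
    if pselect (exists psi, good qp psi) is left h then sval (cid h) else fun _ _ => 0
  else fun _ _ => 0.
exists (fun n => if n is n'.+1 then pick n' else fun _ _ => 0); split => //.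
- case=> [|n]; first exact: test_field0.
  rewrite /pick; case: unpickle => [qp|]; last exact: test_field0.
  by case: pselect => [h|_]; [case: cid => ? []|exact: test_field0].
- move=> a e ta e0.
  have /testP[sa [K [cK _ a0]]] := test_dual_integrand ta.
  pose p := Num.truncn (2 / e).
  have pe : p.+1%:R^-1 <= e / 2.
    rewrite -[e / 2]invrK lef_pV2 ?posrE ?invr_gt0 ?divr_gt0// invf_div.
    by rewrite ltW// truncnS_gt.
  have p0 : 0 < p.+1%:R^-1 :> R by rewrite invr_gt0.
  have [q Hq] := step_approximation (test_continuous (test_dual_integrand ta)) cK a0 p0.
  exists (pickle ((q, p) : seq code * nat)).+1 => x.
  rewrite /pick pickleK; case: pselect => [h|[]]; last by exists a.
  case: cid => b /= [tb Hb].
  rewrite -(subrK (step q x) (dual_integrand a x)) -addrA.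
  rewrite (le_trans (ler_normD _ _))// [X in _ + X]distrC (splitr e) lerD//.
    exact: le_trans (Hq x) pe.
  exact: le_trans (Hb x) pe.
Qed.

End separability.

(** * The mean Fisher information as an increasing limit *)

Lemma continuous_bigmax {R : realType} (T : topologicalType) (n : nat) (f : nat -> T -> R) :
  (forall k, continuous (f k)) -> continuous (fun x => \big[Num.max/0]_(k < n) f k x).
Proof.
move=> cf; apply: (@continuous_big R _ Num.max 0 xpredT) => // -[x y].
by apply: continuous_max; [exact: cvg_fst|exact: cvg_snd].
Qed.

Section probability_bounds.
Context {disp : measure_display} {T : measurableType disp} {R : realType}.
Variable P : probability T R.

Lemma prob_integrable (u : T -> R) (B : R) : measurable_fun setT u ->
  (forall x, `|u x| <= B) -> P.-integrable setT (EFin \o u).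
Proof.
by move=> mu_ uB; apply: (@bounded_integrable _ _ _ P setT u B) => //;
  rewrite ?probability_setT ?ltry.
Qed.

Lemma prob_integral_cst (B : R) : \int[P]_x B = B.
Proof. by rewrite Rintegral_cst// [fine _](_ : _ = 1) ?mulr1// probability_setT. Qed.

Lemma prob_integral_norm_le (u : T -> R) (B : R) : measurable_fun setT u ->
  (forall x, `|u x| <= B) -> `|\int[P]_x u x| <= B.
Proof.
move=> mu_ uB; have iu := prob_integrable mu_ uB.
apply: le_trans (le_normr_Rintegral measurableT iu) _.
rewrite -[leRHS]prob_integral_cst; apply: le_Rintegral => //.
- exact: integrable_norm.
- exact: finite_measure_integrable_cst.
Qed.

End probability_bounds.

Section mean_fisher_semicontinuous.
Context {R : realType} {d : nat}.
Local Notation M := 'rV[R]_d.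
Variables (E : set M) (E0 : E !=set0) (oE : open E).
Variable psi : nat -> @field R 1 d.
Hypothesis tpsi : forall n, test_field E (psi n).
Hypothesis dense : forall a (e : R), test_field E a -> 0 < e ->
  exists n, forall x, `|dual_integrand a x - dual_integrand (psi n) x| <= e.

Let theta n : M -> R := dual_integrand (psi n).

Let ttheta n : test E (theta n).
Proof. exact: test_dual_integrand. Qed.

Lemma bounded_continuous_theta n : continuous (theta n \o pts_val (A0 := E0)) /\
  exists B : R, forall x, `|(theta n \o pts_val (A0 := E0)) x| <= B.
Proof.
split.
  move=> x; apply: continuous_comp; first exact: pts_val_continuous.
  exact: (test_continuous (ttheta n)).
by have [B _ HB] := test_bounded (ttheta n); exists B => x; exact: HB.
Qed.

Definition theta_bc n : bcfun (R := R) (pts E0) := exist _ _ (bounded_continuous_theta n).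

Definition theta_mean n (rho : Prob R (pts E0)) : R := \int[rho]_x sval (theta_bc n) x.

Lemma theta_mean_dual n rho : theta_mean n rho = dual (amb rho) (psi n).
Proof.
rewrite /theta_mean /dual /Rintegral; congr fine.
rewrite /amb (integral_mpush (@measurable_pts_val R 1 d E E0))//.
  exact: (measurable_test (ttheta n)).
have [B _ HB] := test_bounded (ttheta n).
apply: (@prob_integrable _ _ _ rho _ B) => [|x]; last exact: HB.
by apply: continuous_borelR; have [] := bounded_continuous_theta n.
Qed.

(** Maxima of finitely many of the bounded continuous functionals whose supremum
    is the Fisher information; they increase to it. *)
Definition lower_fisher n (rho : Prob R (pts E0)) : R :=
  \big[Num.max/0]_(k < n) theta_mean k rho.

Lemma lower_fisher_ge0 n rho : 0 <= lower_fisher n rho.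
Proof. exact: bigmax_ge_id. Qed.

Lemma lower_fisher_mono rho : {homo lower_fisher^~ rho : n m / (n <= m)%N >-> n <= m}.
Proof. by move=> n m nm; exact: (@le_bigmax_ord _ _ 0 n m xpredT (theta_mean^~ rho)). Qed.

Lemma continuous_lower_fisher n : continuous (lower_fisher n).
Proof. by apply: continuous_bigmax => k; exact: continuous_bc_eval. Qed.

Lemma lower_fisher_bounded n : exists B : R, forall rho, `|lower_fisher n rho| <= B.
Proof.
have [B HB] : exists B : nat -> R, forall k x, `|theta k x| <= B k.
  have ex k : exists b : R, forall x, `|theta k x| <= b.
    by have [b _ Hb] := test_bounded (ttheta k); exists b.
  by exists (fun k => sval (cid (ex k))) => k; case: cid.
exists (\big[Num.max/0]_(k < n) B k) => rho; rewrite ger0_norm ?lower_fisher_ge0//.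
apply: bigmax_le => [|k _]; first exact: bigmax_ge_id.
apply: le_trans (le_bigmax _ (fun k : 'I_n => B k) k).
apply: le_trans (ler_norm _) _; apply: prob_integral_norm_le.
  by apply: continuous_borelR; have [] := bounded_continuous_theta k.
by move=> x; exact: HB.
Qed.

Lemma fisher_ge0 (rho : Prob R (pts E0)) : (0 <= fisher rho)%E.
Proof.
rewrite (fisher_dual rho oE)// invr1 mul1e; apply: ereal_sup_ubound.
by exists (fun _ _ => 0); [exact: test_field0|rewrite dual0].
Qed.

(** The dual formula, restricted to a dense sequence of dual integrands. *)
Lemma lower_fisher_cvg rho : (lower_fisher n rho)%:E @[n --> \oo] --> fisher rho.
Proof.
have mono : {homo (fun n => (lower_fisher n rho)%:E) : n m / (n <= m)%N >-> (n <= m)%E}.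
  by move=> n m nm; rewrite lee_fin; exact: lower_fisher_mono.
rewrite (_ : fisher rho = ereal_sup (range (fun n => (lower_fisher n rho)%:E))).
  exact: ereal_nondecreasing_cvgn.
have fE := fisher_dual rho oE (ltn0Sn 0); rewrite invr1 mul1e in fE.
apply/eqP; rewrite eq_le; apply/andP; split; last first.
  apply: ge_ereal_sup => _ [n _ <-].
  have [->|H] := eqVneq (fisher rho) +oo%E; first by rewrite leey.
  have ff : fisher rho \is a fin_num by rewrite ge0_fin_numE ?fisher_ge0// ltey.
  rewrite -(fineK ff) lee_fin; apply: bigmax_le; first by rewrite fine_ge0// fisher_ge0.
  move=> k _; rewrite -lee_fin (fineK ff) fE theta_mean_dual.
  by apply: ereal_sup_ubound; exists (psi k).
rewrite fE; apply: ge_ereal_sup => _ [a ta <-].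
apply/lee_addgt0Pr => e e0; have [n Hn] := dense ta e0.
apply: (@le_trans _ _ ((theta_mean n rho)%:E + e%:E)%E); last first.
  rewrite leeD2r//; apply: le_trans (ereal_sup_ubound _); last by exists n.+1.
  by rewrite lee_fin; exact: (le_bigmax _ _ (@ord_max n)).
rewrite theta_mean_dual -EFinD lee_fin -[leRHS](_ : \int[amb rho]_x (dual_integrand (psi n) x + e) = _).
  apply: le_Rintegral => //.
  - exact: (test_integrable (amb rho) (test_dual_integrand ta)).
  - apply: integrable_addR => //; first exact: (test_integrable (amb rho) (ttheta n)).
    exact: finite_measure_integrable_cst.
  - by move=> x _; rewrite -lerBlDl (le_trans (ler_norm _))//; exact: Hn.
rewrite RintegralD//.
- by rewrite Rintegral_cst// [fine _](_ : _ = 1) ?mulr1// probability_setT.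
- exact: (test_integrable (amb rho) (ttheta n)).
- exact: finite_measure_integrable_cst.
Qed.

Lemma measurable_lower_fisher n : measurable_fun [set: borel (Prob R (pts E0))] (lower_fisher n).
Proof. by apply: continuous_borelR; exact: continuous_lower_fisher. Qed.

Lemma measurable_fisher : measurable_fun [set: borel (Prob R (pts E0))]
  (fun rho : Prob R (pts E0) => fisher rho).
Proof.
apply: (@emeasurable_fun_cvg _ _ R setT (fun n (rho : borel (Prob R (pts E0))) => (lower_fisher n rho)%:E)).
  by move=> n; apply/measurable_EFinP; exact: measurable_lower_fisher.
by move=> rho _; exact: lower_fisher_cvg.
Qed.

Lemma mean_fisher_ge0 (pi : Prob R (Prob R (pts E0))) : (0 <= mean_fisher pi)%E.
Proof. by apply: integral_ge0 => rho _; exact: fisher_ge0. Qed.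

(** Both sides are the integral of [fisher] against the same measure. *)
Lemma mean_fisher_affine (t : R) (pi0 pi1 pi : Prob R (Prob R (pts E0))) : 0 <= t <= 1 ->
  (forall A : set (borel (Prob R (pts E0))), measurable A ->
     pi A = ((1 - t)%:E * pi0 A + t%:E * pi1 A)%E) ->
  mean_fisher pi = ((1 - t)%:E * mean_fisher pi0 + t%:E * mean_fisher pi1)%E.
Proof.
move=> /andP[t0 t1] piE; have s0 : 0 <= 1 - t by rewrite subr_ge0.
rewrite /mean_fisher.
rewrite (eq_measure_integral (measure_add (mscale (NngNum s0) pi0) (mscale (NngNum t0) pi1))).
  rewrite ge0_integral_measure_add//; [|by move=> rho _; exact: fisher_ge0|exact: measurable_fisher].
  by rewrite !ge0_integral_mscale//; try exact: measurable_fisher; move=> rho _; exact: fisher_ge0.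
by move=> A mA _; rewrite piE// [RHS]measure_addE.
Qed.

Lemma lower_fisher_bc n : continuous (lower_fisher n) /\
  exists B : R, forall rho, `|lower_fisher n rho| <= B.
Proof. by split; [exact: continuous_lower_fisher|exact: lower_fisher_bounded]. Qed.

Lemma mean_lower_fisherE n (pi : Prob R (Prob R (pts E0))) :
  (\int[pi]_rho (lower_fisher n rho)%:E = (\int[pi]_rho lower_fisher n rho)%:E)%E.
Proof.
rewrite /Rintegral fineK//; apply: integrable_fin_num => //.
have [B HB] := lower_fisher_bounded n.
apply: (@le_integrable _ _ _ _ _ _ _ (EFin \o cst B)) => //=.
- by apply/measurable_EFinP; exact: measurable_lower_fisher.
- by move=> x _; rewrite /= lee_fin (le_trans (HB x))// ler_norm.
- exact: finite_measure_integrable_cst.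
Qed.

Lemma mean_lower_fisher_le n (pi : Prob R (Prob R (pts E0))) : ((\int[pi]_rho lower_fisher n rho)%:E <= mean_fisher pi)%E.
Proof.
rewrite -mean_lower_fisherE; apply: ge0_le_integral => //.
- by move=> rho _; rewrite lee_fin lower_fisher_ge0.
- by apply/measurable_EFinP; exact: measurable_lower_fisher.
- exact: measurable_fisher.
- move=> rho _; have mono : {homo (fun n => (lower_fisher n rho)%:E) : n m / (n <= m)%N >-> (n <= m)%E}.
    by move=> k m km; rewrite lee_fin; exact: lower_fisher_mono.
  rewrite (cvg_unique _ (lower_fisher_cvg (rho := rho)) (ereal_nondecreasing_cvgn mono))//.
  by apply: ereal_sup_ubound; exists n.
Qed.

Lemma mean_lower_fisher_cvg (pi : Prob R (Prob R (pts E0))) :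
  (\int[pi]_rho lower_fisher n rho)%:E @[n --> \oo] --> mean_fisher pi.
Proof.
under eq_fun do rewrite -mean_lower_fisherE.
rewrite /mean_fisher.
have -> : (\int[pi]_rho fisher rho = \int[pi]_rho limn (fun n => (lower_fisher n rho)%:E))%E.
  by apply: eq_integral => rho _; apply/esym/cvg_lim => //; exact: lower_fisher_cvg.
apply: cvg_monotone_convergence => //.
- by move=> n; apply/measurable_EFinP; exact: measurable_lower_fisher.
- by move=> n rho _; rewrite lee_fin lower_fisher_ge0.
- by move=> rho _ k m km; rewrite lee_fin; exact: lower_fisher_mono.
Qed.

(** A supremum of continuous functionals: the integrals of the bounded continuous
    functions [lower_fisher n]. *)
Lemma mean_fisher_lsc :
  lower_semicontinuous (fun pi : Prob R (Prob R (pts E0)) => mean_fisher pi).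
Proof.
move=> pi a api.
have [n an] : exists n, a < \int[pi]_rho lower_fisher n rho.
  apply: contrapT => /forallNP H; move: api; rewrite ltNge => /negP; apply.
  have Hc := @mean_lower_fisher_cvg pi; rewrite -(cvg_lim _ Hc)//; apply: lime_le.
    by apply/cvg_ex; exists (mean_fisher pi); exact: Hc.
  by apply: nearW => n; rewrite lee_fin leNgt; exact/negP/H.
pose f : bcfun (R := R) (Prob R (pts E0)) := exist _ _ (lower_fisher_bc n).
exists [set pi' : Prob R (Prob R (pts E0)) | a < \int[pi']_rho sval f rho].
  exact: (cvgr_gt _ (@continuous_bc_eval R _ f pi) _ an).
move=> pi' /= api'; apply: lt_le_trans (mean_lower_fisher_le n pi').
by rewrite lte_fin.
Qed.

End mean_fisher_semicontinuous.

(** * Resampling one point of a product law *)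

Section tuple_resampling.
Context {R : realType} {disp : measure_display} {T : measurableType disp}.
Variable P : probability T R.

Definition tset n (i : 'I_n) (x : T) (t : n.-tuple T) : n.-tuple T :=
  [tuple (if k == i then x else tnth t k) | k < n].

Lemma tset0 n x (y : T * n.-tuple T) : tset ord0 x (tcons y) = tcons (x, y.2).
Proof.
apply: eq_from_tnth => k; rewrite tnth_mktuple.
have [->|] := eqVneq k ord0; first by rewrite /tcons /= tnth0.
by case: (unliftP ord0 k) => [k' ->|->]; rewrite ?eqxx// => _; rewrite /tcons/= !tnthS.
Qed.

Lemma tsetS n (i : 'I_n) x (y : T * n.-tuple T) :
  tset (lift ord0 i) x (tcons y) = tcons (y.1, tset i x y.2).
Proof.
apply: eq_from_tnth => k; rewrite tnth_mktuple.
case: (unliftP ord0 k) => [k' ->|->]; last by rewrite /tcons /= !tnth0.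
by rewrite (inj_eq lift_inj) /tcons/= !tnthS tnth_mktuple.
Qed.

Lemma measurable_tset n (i : 'I_n) :
  measurable_fun [set: (n.-tuple T * T)%type] (fun y => tset i y.2 y.1).
Proof.
apply/measurable_fun_tnthP => k; have [->|ki] := eqVneq k i.
  by rewrite (_ : _ \o _ = snd)//; apply/funext => y /=; rewrite tnth_mktuple eqxx.
rewrite (_ : _ \o _ = (fun t => tnth t k) \o fst).
  by apply: measurableT_comp => //; exact: measurable_tnth.
by apply/funext => y /=; rewrite tnth_mktuple (negbTE ki).
Qed.

Lemma tpower_cons n (v : n.+1.-tuple T -> \bar R) :
  measurable_fun setT v -> (forall t, 0 <= v t)%E ->
  (\int[tpower P n.+1]_t v t = \int[P]_x \int[tpower P n]_t v (tcons (x, t)))%E.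
Proof.
move=> mv v0.
transitivity (\int[(P \x tpower P n)%E]_y v (tcons y))%E.
  exact: (ge0_integral_mpush (@measurable_tcons _ T n)).
apply: (@fubini_tonelli1 _ _ _ _ _ P (tpower P n) (v \o @tcons _ T n)) => //; last by move=> y; exact: v0.
by apply: measurableT_comp mv _; exact: measurable_tcons.
Qed.

(** By induction on n: for the first coordinate, exchange the integrals; for another one,
    argue under the integral over the first. *)
Lemma tpower_resample n (i : 'I_n) (v : n.-tuple T -> \bar R) :
  measurable_fun setT v -> (forall t, 0 <= v t)%E ->
  (\int[tpower P n]_t v t = \int[tpower P n]_t \int[P]_x v (tset i x t))%E.
Proof.
elim: n i v => [[]//|n ih] i v mv v0.
have mw k (j : 'I_k) (w : k.-tuple T -> \bar R) : measurable_fun setT w -> (forall t, 0 <= w t)%E ->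
    measurable_fun setT (fun t => \int[P]_x w (tset j x t))%E.
  move=> mw w0; apply: (@measurable_fun_fubini_tonelli_F _ _ _ _ _ P (fun y => w (tset j y.2 y.1))) => //.
  by apply: measurableT_comp mw _; exact: measurable_tset.
rewrite [RHS]tpower_cons; [|exact: mw|by move=> t; apply: integral_ge0].
rewrite [LHS]tpower_cons//.
case: (unliftP ord0 i) => [i' ->|->].
- apply: eq_integral => x _; under [RHS]eq_integral do under eq_integral do rewrite tsetS.
  apply: (ih i' (fun t => v (tcons (x, t)))) => //.
  apply: measurableT_comp mv _; apply: measurableT_comp (@measurable_tcons _ T n) _.
  exact: measurable_pair1.
- under [RHS]eq_integral do under eq_integral do under eq_integral do rewrite tset0/=.
  rewrite [RHS]integral_cst// [P setT]probability_setT mule1.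
  apply: (@fubini_tonelli _ _ _ _ _ P (tpower P n) (v \o @tcons _ T n)) => //; last by move=> y; exact: v0.
  by apply: measurableT_comp mv _; exact: measurable_tcons.
Qed.

End tuple_resampling.

Section tensor_resampling.
Context {R : realType} {d : nat} {E : set 'rV[R]_d} (E0 : E !=set0).
Variables (rho : Prob R (pts E0)) (j : nat).
Local Notation M := 'M[R]_(j, d).

Definition set_row (i : 'I_j) (x : 'rV[R]_d) (X : M) : M :=
  \matrix_(k, l) if k == i then x 0 l else X k l.

Lemma row_set_row i x X : row i (set_row i x X) = x.
Proof. by apply/rowP => l; rewrite !mxE eqxx. Qed.

Let mx (t : j.-tuple (borel (pts E0))) : borel M :=
  \matrix_k pts_val (tnth t k : pts E0).

Let mx_set i (x : borel (pts E0)) t : mx (tset i x t) = set_row i (pts_val (x : pts E0)) (mx t).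
Proof.
apply/matrixP => k l; rewrite !mxE tnth_mktuple; by case: eqP => // ->.
Qed.

Let mmx : measurable_fun setT mx.
Proof.
exact: (measurableT_comp (@measurable_pts_val R j d _ (powE0 E0 j)) (@measurable_tuple_powE _ _ _ E0 j)).
Qed.

Let int_mx (V : M -> \bar R) : measurable_fun [set: borel M] (V : borel M -> \bar R) ->
  (forall X, 0 <= V X)%E ->
  (\int[amb (tensor_prob rho j)]_X V X = \int[tpower rho j]_t V (mx t))%E.
Proof.
move=> mV V0.
rewrite (ge0_integral_mpush (@measurable_pts_val R j d _ (powE0 E0 j)) (tensor_prob rho j))//.
rewrite (ge0_integral_mpush (@measurable_tuple_powE _ _ _ E0 j) (tpower rho j))//.
exact: (measurableT_comp mV (@measurable_pts_val R j d _ (powE0 E0 j))).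
Qed.

Lemma measurable_set_row i :
  measurable_fun [set: (borel 'rV[R]_d * borel M)%type] (fun y => set_row i y.1 y.2 : borel M).
Proof.
apply: measurable_mx => k l; under eq_fun do rewrite mxE.
have [_|_] := eqVneq k i.
  apply: (measurableT_comp (f := fun x : borel 'rV[R]_d => (x : 'rV[R]_d) 0 l)) => //.
  by apply: continuous_borelR; exact: coord_continuous.
apply: (measurableT_comp (f := fun x : borel M => (x : M) k l)) => //.
by apply: continuous_borelR; exact: coord_continuous.
Qed.

Lemma measurable_set_row_slice i X :
  measurable_fun [set: borel 'rV[R]_d] (fun x => set_row i x X : borel M).
Proof.
apply: measurable_mx => k l; under eq_fun do rewrite mxE.
have [_|_] := eqVneq k i; last exact: measurable_cst.
by apply: continuous_borelR; exact: coord_continuous.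
Qed.

Lemma ge0_tensor_resample i (V : M -> \bar R) :
  measurable_fun [set: borel M] (V : borel M -> \bar R) -> (forall X, 0 <= V X)%E ->
  (\int[amb (tensor_prob rho j)]_X V X =
   \int[amb (tensor_prob rho j)]_X \int[amb rho]_x V (set_row i x X))%E.
Proof.
move=> mV V0.
have mW : measurable_fun [set: (borel 'rV[R]_d * borel M)%type] (fun y => V (set_row i y.1 y.2)).
  exact: measurableT_comp mV (measurable_set_row i).
have mG : measurable_fun [set: borel M] (fun X : borel M => \int[amb rho]_x V (set_row i x X))%E.
  exact: (@measurable_fun_fubini_tonelli_G _ _ _ _ _ (amb rho) _ mW).
rewrite [RHS]int_mx//; last by move=> X; apply: integral_ge0.
rewrite [LHS]int_mx// (@tpower_resample R _ _ rho j i (V \o mx))//; last 2 first.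
- exact: measurableT_comp mV mmx.
- by move=> t; exact: V0.
apply: eq_integral => t _.
rewrite (ge0_integral_mpush (@measurable_pts_val R 1 d _ E0) rho)//.
  by apply: eq_integral => x _; rewrite -mx_set.
exact: (measurableT_comp mV (measurable_set_row_slice i _)).
Qed.

Lemma measurable_resample i (V : M -> R) (B : R) :
  measurable_fun [set: borel M] (V : borel M -> R) -> (forall X, `|V X| <= B) ->
  measurable_fun [set: borel M] (fun X : borel M => \int[amb rho]_x V (set_row i x X)).
Proof.
move=> mV VB.
have mVi (X : M) : measurable_fun [set: borel 'rV[R]_d] (fun x : borel 'rV[R]_d => V (set_row i x X)).
  exact: (measurableT_comp mV (measurable_set_row_slice i _)).
have mW : measurable_fun [set: (borel 'rV[R]_d * borel M)%type]
    (fun y => (V (set_row i y.1 y.2) + B)%:E).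
  apply/measurable_EFinP; apply: measurable_funD => //.
  exact: measurableT_comp mV (measurable_set_row i).
have W0 y : (0 <= (V (set_row i y.1 y.2) + B)%:E)%E.
  by rewrite lee_fin -lerBlDr sub0r lerNl (le_trans _ (VB (set_row i y.1 y.2)))// -normrN ler_norm.
have := @measurable_fun_fubini_tonelli_G _ _ _ _ _ (amb rho) _ mW W0.
rewrite /fubini_G => mG.
have {mG} : measurable_fun [set: borel M]
    (EFin \o (fun X : borel M => \int[amb rho]_x V (set_row i x X) + B)).
  apply: eq_measurable_fun mG => X _; rewrite [RHS]/=.
  have iV := prob_integrable (amb rho) (mVi X) (fun x => VB _).
  rewrite -[B in RHS](prob_integral_cst (amb rho)) -RintegralD//; last exact: finite_measure_integrable_cst.
  rewrite /Rintegral fineK//; apply: integrable_fin_num => //.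
  by apply: integrable_addR => //; exact: finite_measure_integrable_cst.
move=> /measurable_EFinP mG.
have := measurable_funB mG (measurable_cst B).
by apply: eq_measurable_fun => X _ /=; rewrite addrK.
Qed.

(** [tpower_resample] for functions of a matrix whose rows are independent with law rho. *)
Lemma tensor_resample i (V : M -> R) (B : R) :
  measurable_fun [set: borel M] (V : borel M -> R) -> (forall X, `|V X| <= B) ->
  \int[amb (tensor_prob rho j)]_X V X =
  \int[amb (tensor_prob rho j)]_X \int[amb rho]_x V (set_row i x X).
Proof.
move=> mV VB.
have mVi (X : M) : measurable_fun [set: borel 'rV[R]_d] (fun x : borel 'rV[R]_d => V (set_row i x X)).
  exact: (measurableT_comp mV (measurable_set_row_slice i _)).
have mR := measurable_resample i mV VB.
set m := amb (tensor_prob rho j).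
have iV := prob_integrable m mV VB.
have iVi X := prob_integrable (amb rho) (mVi X) (fun x => VB _).
have iR : m.-integrable setT (EFin \o (fun X : borel M => \int[amb rho]_x V (set_row i x X))).
  by apply: (@prob_integrable _ _ _ m _ B) => // X; apply: prob_integral_norm_le.
have W0 X : 0 <= V X + B.
  by rewrite -lerBlDr sub0r lerNl (le_trans _ (VB X))// -normrN ler_norm.
apply: (addIr B); rewrite -[B in LHS](prob_integral_cst m) -[B in RHS](prob_integral_cst m).
rewrite -!RintegralD//; try exact: finite_measure_integrable_cst.
rewrite /Rintegral; congr fine.
rewrite (@ge0_tensor_resample i (fun X => (V X + B)%:E))//; last first.
  by apply/measurable_EFinP; exact: measurable_funD.
apply: eq_integral => X _.
rewrite -[B in RHS](prob_integral_cst (amb rho)) -RintegralD//; last exact: finite_measure_integrable_cst.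
rewrite /Rintegral fineK//; apply: integrable_fin_num => //.
by apply: integrable_addR => //; exact: finite_measure_integrable_cst.
Qed.

End tensor_resampling.

(** * The Fisher information of a mixture is at most the mean *)

Section affine_change_of_variables.
Context {R : realType} {j d j' d' : nat}.
Local Notation M := 'M[R]_(j, d).
Local Notation M' := 'M[R]_(j', d').
Variables (L : M' -> M) (sigma : 'I_j' * 'I_d' -> option ('I_j * 'I_d)).

Definition dir (o : option ('I_j * 'I_d)) : M :=
  if o is Some ik then delta_mx ik.1 ik.2 else 0.

Hypothesis cL : continuous L.
Hypothesis affine : forall ik (s : R) x,
  L (s *: delta_mx ik.1 ik.2 + x) = s *: dir (sigma ik) + L x.

Lemma is_derive_affine (f : M -> R) ik x : C_infty f ->
  is_derive x (delta_mx ik.1 ik.2) (f \o L)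
    (if sigma ik is Some il then partial il f (L x) else 0).
Proof.
move=> sf; apply/is_derive_line; under eq_fun => s do rewrite /= affine.
case: (sigma ik) => [il|]; first by rewrite /dir; have H := smooth_is_derive il (L x) sf; exact: ((is_derive_line _ _ _ _).1 H).
by under eq_fun do rewrite /= scaler0 add0r; exact: is_derive_cst.
Qed.

(** L sends the direction ik to the direction sigma ik of the target, or to 0: this
    covers the insertion of a row and the extraction of a row. *)
Lemma partial_affine (f : M -> R) ik : C_infty f -> partial ik (f \o L) =
  (fun x => if sigma ik is Some il then partial il f (L x) else 0).
Proof. by move=> sf; apply: partialE => x; exact: is_derive_affine. Qed.

Lemma smooth_affine (f : M -> R) : C_infty f -> C_infty (f \o L).
Proof.
move=> sf; apply/C_infty_upto => n; elim: n f sf => [|n ih] f sf.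
  by split=> // x; apply: continuous_comp; [exact: cL|exact: smooth_continuous].
apply: (@diff_uptoSP _ _ _ _ _ (fun ik x => if sigma ik is Some il then partial il f (L x) else 0)).
- by move=> x; apply: continuous_comp; [exact: cL|exact: smooth_continuous].
- by move=> ik x; exact: is_derive_affine.
- move=> ik; case: (sigma ik) => [il|]; last exact: diff_upto_cst.
  by apply: (ih (partial il f)); exact: smooth_partial.
Qed.

End affine_change_of_variables.

Section rows.
Context {R : realType} {j d : nat}.
Local Notation M := 'M[R]_(j, d).
Implicit Types (i : 'I_j).

Lemma continuous_row i : continuous (row i : M -> 'rV[R]_d).
Proof.
apply: matrix_continuous => k l; under eq_fun do rewrite mxE.
exact: coord_continuous.
Qed.

Lemma continuous_set_row i (X : M) : continuous (fun x => set_row i x X).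
Proof.
apply: matrix_continuous => k l; under eq_fun do rewrite mxE.
by have [_|_] := eqVneq k i; [exact: coord_continuous|exact: cst_continuous].
Qed.

Lemma set_row_affine i (X : M) (zl : 'I_1 * 'I_d) (s : R) x :
  set_row i (s *: delta_mx zl.1 zl.2 + x) X = s *: dir (Some (i, zl.2)) + set_row i x X.
Proof.
apply/matrixP => k l; rewrite /set_row !mxE /=; have [_|ki] := eqVneq k i.
  by rewrite (ord1 zl.1).
by rewrite mulr0 add0r.
Qed.

Lemma row_affine i (kl : 'I_j * 'I_d) (s : R) (X : M) :
  row i (s *: delta_mx kl.1 kl.2 + X) =
  s *: dir (if i == kl.1 then Some (ord0 : 'I_1, kl.2) else None) + row i X.
Proof.
apply/rowP => l; rewrite !mxE; case: (i == kl.1) => /=; first by rewrite mxE eqxx.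
by rewrite mxE.
Qed.

Variables (E : set 'rV[R]_d) (psi : @field R j d).
Hypothesis tpsi : test_field (powE E j) psi.

(** Freezing the other points turns the i-th block of a field on E^j into a field on E. *)
Definition slice i (X : M) : @field R 1 d := fun zl x => psi (i, zl.2) (set_row i x X).

Lemma test_slice i X : test_field E (slice i X).
Proof.
move=> zl; have /testP[_ [K [cK KO psi0]]] := tpsi (i, zl.2).
split.
  apply: (@smooth_affine _ _ _ _ _ (fun x => set_row i x X) (fun zl => Some (i, zl.2))).
  - exact: continuous_set_row.
  - by move=> *; exact: set_row_affine.
  - exact: test_smooth (tpsi _).
(* The support of the slice lies in the projection of that of psi. *)
exists (row i @` K); split.
- by apply: continuous_compact => //; apply: continuous_subspaceT; exact: continuous_row.
- by move=> _ [Y KY <-]; exact: KO.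
- move=> x nKx; apply: psi0 => KX; apply: nKx; exists (set_row i x X) => //.
  exact: row_set_row.
Qed.

Lemma sum_row (F : 'I_1 * 'I_d -> R) : \sum_zl F zl = \sum_l F (ord0, l).
Proof.
transitivity (\sum_(z < 1) \sum_(l < d) F (z, l)); last by rewrite big_ord1.
by rewrite pair_big; apply: eq_bigr => -[].
Qed.

(** The part of the dual integrand that differentiates along the i-th point. *)
Definition block_integrand i (X : M) : R :=
  - (\sum_l partial (i, l) (psi (i, l)) X) - (\sum_l psi (i, l) X * psi (i, l) X) / 4.

Lemma block_integrand_slice i (X : M) x :
  block_integrand i (set_row i x X) = dual_integrand (slice i X) x.
Proof.
rewrite /block_integrand /dual_integrand /diverg /dot.
rewrite !sum_row; congr (- _ - _ / 4); apply: eq_bigr => l _.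
have := @partial_affine _ _ _ _ _ (fun x => set_row i x X) (fun zl => Some (i, zl.2))
  (set_row_affine i X) (psi (i, l)) (ord0, l) (test_smooth (tpsi _)).
by move=> ->.
Qed.

Lemma dual_integrand_blocks X : dual_integrand psi X = \sum_i block_integrand i X.
Proof.
rewrite /dual_integrand /diverg /dot /block_integrand big_split/= !sumrN -mulr_suml.
rewrite (pair_big xpredT xpredT (fun i l => partial (i, l) (psi (i, l)) X))/=.
rewrite (pair_big xpredT xpredT (fun i l => psi (i, l) X * psi (i, l) X))/=.
by congr (- _ - _ / 4); apply: eq_bigr => -[].
Qed.

Lemma test_block_integrand i : test (powE E j) (block_integrand i).
Proof.
apply: testB.
  by apply: testN; apply: test_sum => l; exact: test_partial.
apply: testMl; last exact: smooth_cst.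
by apply: test_sum => l; apply: testMl => //; exact: test_smooth (tpsi _).
Qed.

End rows.

Section mixture_integrals.
Context {R : realType} {d : nat} {E : set 'rV[R]_d} (E0 : E !=set0).
Variables (pi : Prob R (Prob R (pts E0))) (j : nat).
Local Notation M := 'M[R]_(j, d).
Local Notation S := (borel (Prob R (pts E0))).

Let g (rho : S) : giry (borel (pts (powE0 E0 j))) R :=
  (tensor_prob (rho : Prob R (pts E0)) j : probability (borel (pts (powE0 E0 j))) R).

Let mg : measurable_fun setT g.
Proof. by apply: measurable_giry_codensity => // B mB; exact: measurable_tensor_prob. Qed.

Let gpi : giry S R := (pi : probability S R).

Lemma ge0_measurable_tensor_integral (V : M -> \bar R) :
  measurable_fun [set: borel M] (V : borel M -> \bar R) -> (forall X, 0 <= V X)%E ->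
  measurable_fun [set: S] (fun rho : S => \int[amb (tensor_prob (rho : Prob R (pts E0)) j)]_X V X)%E.
Proof.
move=> mV V0.
have mVp : measurable_fun [set: borel (pts (powE0 E0 j))] (fun x => V (pts_val (x : pts (powE0 E0 j)))).
  exact: (measurableT_comp mV (@measurable_pts_val R j d _ (powE0 E0 j))).
apply: (eq_measurable_fun (fun rho : S => giry_int (g rho) (fun x => V (pts_val (x : pts (powE0 E0 j)))))).
  move=> rho _; apply/esym.
  exact: (ge0_integral_mpush (@measurable_pts_val R j d _ (powE0 E0 j)) (tensor_prob (rho : Prob R (pts E0)) j)).
apply: (measurableT_comp (measurable_giry_int mVp _) mg) => x; exact: V0.
Qed.

Lemma ge0_mixture_integral (V : M -> \bar R) :
  measurable_fun [set: borel M] (V : borel M -> \bar R) -> (forall X, 0 <= V X)%E ->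
  (\int[amb (mixture pi j)]_X V X = \int[pi]_rho \int[amb (tensor_prob rho j)]_X V X)%E.
Proof.
move=> mV V0.
have mVp : measurable_fun [set: borel (pts (powE0 E0 j))] (fun x => V (pts_val (x : pts (powE0 E0 j)))).
  exact: (measurableT_comp mV (@measurable_pts_val R j d _ (powE0 E0 j))).
rewrite (ge0_integral_mpush (@measurable_pts_val R j d _ (powE0 E0 j)) (mixture pi j))//.
transitivity (giry_int (giry_bind gpi mg) (fun x => V (pts_val (x : pts (powE0 E0 j))))).
  apply: eq_measure_integral => A mA _.
  rewrite /giry_bind /= /giry_join /= /giry_int.
  rewrite (ge0_integral_pushforward mg gpi measurableT)//.
  exact: measurable_giry_ev.
rewrite giry_int_bind//.
apply: eq_integral => rho _; apply/esym.
exact: (ge0_integral_mpush (@measurable_pts_val R j d _ (powE0 E0 j)) (tensor_prob rho j)).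
Qed.

Let shift_ge0 (V : M -> R) (B : R) : (forall X, `|V X| <= B) -> forall X, 0 <= V X + B.
Proof.
by move=> VB X; rewrite -lerBlDr sub0r lerNl (le_trans _ (VB X))// -normrN ler_norm.
Qed.

Let shift_integral (P : probability (borel M) R) (V : M -> R) (B : R) :
  measurable_fun [set: borel M] (V : borel M -> R) -> (forall X, `|V X| <= B) ->
  (\int[P]_X (V X + B)%:E = (\int[P]_X V X + B)%:E)%E.
Proof.
move=> mV VB; have iV := prob_integrable P mV VB.
rewrite -[B in RHS](prob_integral_cst P) -RintegralD//; last exact: finite_measure_integrable_cst.
rewrite /Rintegral fineK//; apply: integrable_fin_num => //.
by apply: integrable_addR => //; exact: finite_measure_integrable_cst.
Qed.

Lemma measurable_tensor_integral (V : M -> R) (B : R) :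
  measurable_fun [set: borel M] (V : borel M -> R) -> (forall X, `|V X| <= B) ->
  measurable_fun [set: S] (fun rho : S => \int[amb (tensor_prob (rho : Prob R (pts E0)) j)]_X V X).
Proof.
move=> mV VB.
have mVB : measurable_fun [set: borel M] (fun X : borel M => (V X + B)%:E).
  by apply/measurable_EFinP; exact: measurable_funD.
have := ge0_measurable_tensor_integral mVB (fun X => shift_ge0 VB X).
move=> H.
have {H} : measurable_fun [set: S]
    (EFin \o (fun rho : S => \int[amb (tensor_prob (rho : Prob R (pts E0)) j)]_X V X + B)).
  by apply: eq_measurable_fun H => rho _; rewrite shift_integral.
move=> /measurable_EFinP H.
have := measurable_funB H (measurable_cst B).
by apply: eq_measurable_fun => X _ /=; rewrite addrK.
Qed.

Lemma mixture_integral (V : M -> R) (B : R) :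
  measurable_fun [set: borel M] (V : borel M -> R) -> (forall X, `|V X| <= B) ->
  \int[amb (mixture pi j)]_X V X = \int[pi]_rho \int[amb (tensor_prob rho j)]_X V X.
Proof.
move=> mV VB.
have mT := measurable_tensor_integral mV VB.
have mVB : measurable_fun [set: borel M] (fun X : borel M => (V X + B)%:E).
  by apply/measurable_EFinP; exact: measurable_funD.
apply: (addIr B); apply: EFin_inj; rewrite -shift_integral//.
rewrite ge0_mixture_integral//; last by move=> X; rewrite lee_fin shift_ge0.
have iT := @prob_integrable _ _ _ pi _ B mT (fun rho => prob_integral_norm_le _ mV VB).
rewrite -[B in RHS](prob_integral_cst pi) -RintegralD//; last exact: finite_measure_integrable_cst.
rewrite /Rintegral fineK; last first.
  apply: integrable_fin_num => //.
  by apply: integrable_addR => //; exact: finite_measure_integrable_cst.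
by apply: eq_integral => rho _; rewrite shift_integral.
Qed.

End mixture_integrals.

Section subadditivity.
Context {R : realType} {d : nat} {E : set 'rV[R]_d} (E0 : E !=set0) (oE : open E).
Variables (j : nat) (j0 : (0 < j)%N).
Local Notation M := 'M[R]_(j, d).

Lemma open_powE : open (powE E j).
Proof.
rewrite openE => X EX; rewrite /interior /=.
have H i : \forall Y \near X, E (row i Y).
  by apply: continuous_row; apply: open_nbhs_nbhs; split; [exact: oE|exact: EX].
exact: (filter_forall _ H).
Qed.

(** Resample the i-th point: conditionally on the other points, the block of a test field
    along that point is a test field for rho. *)
Lemma dual_tensor_le (rho : Prob R (pts E0)) psi : test_field (powE E j) psi ->
  ((dual (amb (tensor_prob rho j)) psi)%:E <= (j%:R)%:E * fisher rho)%E.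
Proof.
move=> tpsi.
have [->|H] := eqVneq (fisher rho) +oo%E; first by rewrite gt0_muley ?leey// lte_fin ltr0n.
have ff : fisher rho \is a fin_num by rewrite ge0_fin_numE ?fisher_ge0// ltey.
have fE := fisher_dual rho oE (ltn0Sn 0); rewrite invr1 mul1e in fE.
have Hle a : test_field E a -> dual (amb rho) a <= fine (fisher rho).
  move=> ta; rewrite -lee_fin (fineK ff) fE.
  by apply: (@ereal_sup_ubound R [set (dual (amb rho) a)%:E | a in test_field E]); exists a.
rewrite -(fineK ff) -EFinM lee_fin /dual.
under eq_Rintegral do rewrite dual_integrand_blocks.
have tb i := test_block_integrand tpsi i.
rewrite Rintegral_sum//; last by move=> i; exact: (test_integrable _ (tb i)).
rewrite -[j in leRHS]card_ord mulr_natl -sumr_const; apply: ler_sum => i _.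
have [B B0 HB] := test_bounded (tb i).
rewrite (tensor_resample rho i (measurable_test (tb i)) HB).
rewrite -[leRHS](prob_integral_cst (amb (tensor_prob rho j))); apply: le_Rintegral => //.
- apply: prob_integrable (measurable_resample rho i (measurable_test (tb i)) HB) _ => X.
  apply: prob_integral_norm_le => [|x]; last exact: HB.
  exact: (measurableT_comp (measurable_test (tb i)) (measurable_set_row_slice i _)).
- exact: finite_measure_integrable_cst.
- move=> X _; under eq_Rintegral do rewrite (block_integrand_slice tpsi).
  by apply: Hle; exact: test_slice.
Qed.

(** The dual functional is linear in the measure: integrate [dual_tensor_le] against pi. *)
Lemma fisher_mixture_le (pi : Prob R (Prob R (pts E0))) :
  (fisher (mixture pi j) <= mean_fisher pi)%E.
Proof.
have jR : (0 < j%:R^-1 :> R) by rewrite invr_gt0 ltr0n.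
rewrite (fisher_dual _ open_powE j0).
have [->|H] := eqVneq (mean_fisher pi) +oo%E; first by rewrite leey.
have mf0 : (0 <= mean_fisher pi)%E by apply: integral_ge0 => rho _; exact: fisher_ge0.
have ff : mean_fisher pi \is a fin_num by rewrite ge0_fin_numE// ltey.
rewrite -lee_pdivlMl//.
apply: ge_ereal_sup => _ [psi tpsi <-].
have tt := test_dual_integrand tpsi.
have [B B0 HB] := test_bounded tt.
rewrite /dual (mixture_integral _ (measurable_test tt) HB).
have mT := measurable_tensor_integral (E0 := E0) (measurable_test tt) HB.
have iT := @prob_integrable _ _ _ pi _ B mT (fun rho => prob_integral_norm_le _ (measurable_test tt) HB).
have [ps [tps _ dps]] := dense_fields E.
have mF := measurable_fisher (E0 := E0) oE tps dps.
have mjF : measurable_fun [set: borel (Prob R (pts E0))]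
    (fun rho : borel (Prob R (pts E0)) => ((j%:R)%:E * fisher (rho : Prob R (pts E0)))%E).
  exact: measurable_funeM.
rewrite /Rintegral fineK; last exact: integrable_fin_num.
rewrite invrK -ge0_integralZl//; last by move=> rho _; exact: fisher_ge0.
apply: (@le_trans _ _ (\int[pi]_rho (Num.max (\int[amb (tensor_prob rho j)]_X dual_integrand psi X) 0)%:E)%E).
  apply: le_integral => //.
  - apply: (le_integrable measurableT _ _ iT).
      by apply/measurable_EFinP; exact: measurable_maxr.
    move=> x _ /=; rewrite lee_fin ger0_norm ?le_max ?lexx ?orbT// ge_max normr_ge0 andbT.
    exact: ler_norm.
  - by move=> x _; rewrite lee_fin le_max lexx.
apply: ge0_le_integral => //.
- by move=> rho _; rewrite lee_fin le_max lexx orbT.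
- by apply/measurable_EFinP; exact: measurable_maxr.
move=> rho _; rewrite EFin_max ge_max dual_tensor_le//=.
by rewrite mule_ge0 ?lee_fin// fisher_ge0.
Qed.

End subadditivity.

(** * Smooth maxima and functions of the rows *)

Section softmax.
Context {R : realType} {n : nat}.
Variables (lam : R) (lam0 : 0 < lam).
Implicit Types (u a : 'I_n -> R).

Definition softmax u (k : 'I_n) : R := expR (lam * u k) / \sum_p expR (lam * u p).

Lemma softmax_denom_gt0 u (k : 'I_n) : 0 < \sum_p expR (lam * u p).
Proof.
apply: lt_le_trans (expR_gt0 (lam * u k)) _.
by rewrite (bigD1 k)//= lerDl sumr_ge0// => p _; exact: expR_ge0.
Qed.

Lemma softmax_ge0 u k : 0 <= softmax u k.
Proof. by rewrite divr_ge0 ?expR_ge0// sumr_ge0// => p _; exact: expR_ge0. Qed.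

Lemma sum_softmax u : (0 < n)%N -> \sum_k softmax u k = 1.
Proof.
move=> n0; rewrite -mulr_suml divff// gt_eqF//.
exact: softmax_denom_gt0 (Ordinal n0).
Qed.

(** The weight of an entry that is t below u p is at most expR (- lam t), and
    t expR (- lam t) is at most 1 / lam; sum over the n entries. *)
Lemma softmax_average u p : u p - n%:R / lam <= \sum_k softmax u k * u k.
Proof.
have n0 : (0 < n)%N by case: p => p; exact: leq_trans.
rewrite lerBlDr -lerBlDl.
have -> : u p - \sum_k softmax u k * u k = \sum_k softmax u k * (u p - u k).
  under [RHS]eq_bigr do rewrite mulrBr.
  by rewrite sumrB -mulr_suml sum_softmax// mul1r.
have -> : n%:R / lam = \sum_(k < n) lam^-1 by rewrite sumr_const card_ord mulr_natl.
apply: ler_sum => k _.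
have [h|h] := leP (u p) (u k).
  apply: (@le_trans _ _ 0); last by rewrite invr_ge0 ltW.
  by rewrite mulr_ge0_le0 ?softmax_ge0// subr_le0.
have H : softmax u k <= expR (- (lam * (u p - u k))).
  rewrite ler_pdivrMr ?(softmax_denom_gt0 u p)//.
  apply: (@le_trans _ _ (expR (- (lam * (u p - u k))) * expR (lam * u p))).
    by rewrite -expRD ler_expR; lra.
  rewrite ler_wpM2l ?expR_ge0// (bigD1 p)//= lerDl sumr_ge0// => q _; exact: expR_ge0.
rewrite -(ler_pM2l lam0) mulfV ?gt_eqF// mulrC mulrAC -mulrA.
have t0 : 0 <= lam * (u p - u k) by rewrite mulr_ge0 ?(ltW lam0)// subr_ge0 ltW.
apply: le_trans (ler_wpM2r t0 H) _.
rewrite -(ler_pM2l (expR_gt0 (lam * (u p - u k)))) mulrA -expRD subrr expR0 mul1r mulr1.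
by rewrite (le_trans _ (expR_ge1Dx _))// lerDr.
Qed.

Lemma softmax_jensen u a : (0 < n)%N ->
  (\sum_k softmax u k * a k) ^+ 2 <= \sum_k softmax u k * a k ^+ 2.
Proof.
move=> n0.
have H (m : R) : \sum_k softmax u k * (a k - m) ^+ 2 =
    (\sum_k softmax u k * a k ^+ 2) - 2 * m * (\sum_k softmax u k * a k) + m ^+ 2.
  have -> : m ^+ 2 = \sum_k m ^+ 2 * softmax u k by rewrite -mulr_sumr sum_softmax// mulr1.
  by rewrite mulr_sumr -sumrB -big_split/=; apply: eq_bigr => k _; ring.
have := H (\sum_k softmax u k * a k); set m := \sum_k softmax u k * a k => Hm.
have : 0 <= \sum_k softmax u k * (a k - m) ^+ 2.
  by apply: sumr_ge0 => k _; rewrite mulr_ge0 ?softmax_ge0 ?sqr_ge0.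
by rewrite Hm; nra.
Qed.

End softmax.

Section smooth_softmax.
Context {R : realType} {j d n : nat}.
Local Notation M := 'M[R]_(j, d).
Variables (lam : R) (U : 'I_n -> M -> R).
Hypothesis sU : forall k, C_infty (U k).

Let Z (X : M) : R := \sum_p expR (lam * U p X).

Let sZ : C_infty Z.
Proof. by apply: smooth_sum => p; apply: smooth_expR; exact: smoothZ. Qed.

Let Z0 (k : 'I_n) X : Z X != 0.
Proof. by rewrite gt_eqF// (softmax_denom_gt0 lam (U^~ X) k). Qed.

Lemma smooth_softmax k : C_infty (fun X => softmax lam (U^~ X) k).
Proof.
apply: smoothM; first by apply: smooth_expR; exact: smoothZ.
exact: smoothV (Z0 k) sZ.
Qed.

Lemma partial_softmax k ik X : partial ik (fun X => softmax lam (U^~ X) k) X =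
  lam * softmax lam (U^~ X) k *
    (partial ik (U k) X - \sum_p softmax lam (U^~ X) p * partial ik (U p) X).
Proof.
have se p : C_infty (fun X => expR (lam * U p X)) by apply: smooth_expR; exact: smoothZ.
rewrite (partialM ik (se k) (smoothV (Z0 k) sZ)) partial_expR; last exact: smoothZ.
rewrite (partialV ik (Z0 k) sZ) partialZ// partial_sum//.
have -> : \sum_p softmax lam (U^~ X) p * partial ik (U p) X =
    (Z X)^-1 * \sum_p expR (lam * U p X) * partial ik (U p) X.
  by rewrite mulr_sumr; apply: eq_bigr => p _; rewrite /softmax -/(Z X); ring.
have -> : \sum_p partial ik (fun x => expR (lam * U p x)) X =
    lam * \sum_p expR (lam * U p X) * partial ik (U p) X.
  rewrite mulr_sumr; apply: eq_bigr => p _; rewrite partial_expR; last exact: smoothZ.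
  by rewrite partialZ//; ring.
by rewrite /softmax -/(Z X); ring.
Qed.

End smooth_softmax.

Section functions_of_rows.
Context {R : realType} {N d : nat}.
Local Notation M := 'M[R]_(N, d).
Implicit Types (u : 'rV[R]_d -> R) (i : 'I_N).

Lemma smooth_row i u : C_infty u -> C_infty (fun X : M => u (row i X)).
Proof.
exact: (smooth_affine (@continuous_row R N d i) (row_affine i)).
Qed.

Lemma partial_row i u kl (X : M) : C_infty u -> partial kl (fun X : M => u (row i X)) X =
  if i == kl.1 then partial (ord0, kl.2) u (row i X) else 0.
Proof.
move=> su; have := partial_affine (row_affine i) kl su; rewrite /comp => ->.
by case: ifP.
Qed.

Definition avg u (X : M) : R := N%:R^-1 * \sum_i u (row i X).

Lemma smooth_avg u : C_infty u -> C_infty (avg u).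
Proof. by move=> su; apply: smoothZ; apply: smooth_sum => i; exact: smooth_row. Qed.

Lemma partial_avg u kl (X : M) : C_infty u ->
  partial kl (avg u) X = N%:R^-1 * partial (ord0, kl.2) u (row kl.1 X).
Proof.
move=> su; rewrite partialZ; last by apply: smooth_sum => i; exact: smooth_row.
rewrite partial_sum; last by move=> i; exact: smooth_row.
congr (_ * _); rewrite (bigD1 kl.1)//= partial_row// eqxx big1 ?addr0// => i ik.
by rewrite partial_row// (negbTE ik).
Qed.

Lemma avg_bound u B (X : M) : (forall x, `|u x| <= B) -> `|avg u X| <= B.
Proof.
move=> uB; have B0 : 0 <= B by exact: le_trans (uB 0).
rewrite /avg normrM ger0_norm ?invr_ge0//.
case: N X => [|n] X; first by rewrite invr0 mul0r.
rewrite ler_pdivrMl ?ltr0n//; apply: le_trans (ler_norm_sum _ _ _) _.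
have -> : n.+1%:R * B = \sum_(i < n.+1) B by rewrite sumr_const card_ord mulr_natl.
by apply: ler_sum => i _; exact: uB.
Qed.

Definition rows_cutoff (eta : 'rV[R]_d -> R) (X : M) : R := \prod_i eta (row i X).

Lemma test_rows_cutoff (E : set 'rV[R]_d) eta : test E eta -> test (powE E N) (rows_cutoff eta).
Proof.
move=> /testP[/C_inftyP seta [K [cK KE eta0]]]; split.
  by apply: smooth_prod => i; exact: smooth_row.
exists [set X : M | forall i, K (row i X)]; split.
- have [r [_ Kr]] := compact_bounded cK.
  apply: (@bounded_closed_compact_mx _ _ _ _ 0 (`|r| + 2)).
    rewrite (_ : [set X | _] = \bigcap_(i in [set: 'I_N]) (row i @^-1` K)); last first.
      by apply/seteqP; split=> [X HX i _|X HX i]; exact: HX.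
    apply: closed_bigI => i _; apply: closed_comp; last exact: compact_mx_closed.
    by move=> X _; exact: continuous_row.
  move=> X HX i k.
  have : `|row i X| <= `|r| + 1.
    by apply: Kr => //; rewrite (le_lt_trans (ler_norm r))// ltrDl.
  move=> h; have : ball (0 : 'rV[R]_d) (`|r| + 2) (row i X).
    by rewrite -ball_normE /= sub0r normrN (le_lt_trans h)// ltrD2l ltr1n.
  have r0 : 0 < `|r| + 2 by rewrite ltr_wpDl.
  move=> /(ball_coordP _ _ r0)/(_ ord0 k); rewrite !mxE => /ltW; exact.
- by move=> X HX i; exact: KE.
- move=> X /existsNP[i nK]; by rewrite /rows_cutoff (bigD1 i)//= eta0// mul0r.
Qed.

Lemma rows_cutoff01 eta X : (forall x, 0 <= eta x <= 1) -> 0 <= rows_cutoff eta X <= 1.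
Proof. by move=> eta01; apply: prodr01 => i; exact: eta01. Qed.

(** Moving one point where eta is locally 1 does not change the product. *)
Lemma partial_rows_cutoff eta kl (X : M) : C_infty eta ->
  (\forall y \near row kl.1 X, eta y = 1) -> partial kl (rows_cutoff eta) X = 0.
Proof.
move=> seta eta1.
pose g (Y : M) := \prod_(i | i != kl.1) eta (row i Y).
rewrite (@near_partial _ _ _ _ g); last first.
  have H : \forall Y \near X, eta (row kl.1 Y) = 1 by exact: (@continuous_row R N d kl.1 X _ eta1).
  by apply: filterS H => Y eY; rewrite /rows_cutoff (bigD1 kl.1)//= eY mul1r.
have dg Y : is_derive Y (delta_mx kl.1 kl.2) g 0.
  have gE : (fun s : R => g (s *: delta_mx kl.1 kl.2 + Y)) = fun=> g Y.
    apply/funext => s; apply: eq_bigr => i ik.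
    by rewrite row_affine (negbTE ik) scaler0 add0r.
  by apply/is_derive_line; rewrite gE; exact: is_derive_cst.
by have /funeqP/(_ X) := partialE dg.
Qed.

End functions_of_rows.

(** * A lower bound by empirical means *)

Lemma uniform_bound {R : realType} (I : finType) (T : Type) (f : I -> T -> R) :
  (forall i, exists B : R, forall x, `|f i x| <= B) ->
  exists2 B : R, 0 <= B & forall i x, `|f i x| <= B.
Proof.
move=> H; pose B i := sval (cid (H i)).
have HB i x : `|f i x| <= `|B i|.
  by apply: le_trans (ler_norm _); rewrite /B; case: cid.
exists (\sum_i `|B i|); first exact: sumr_ge0.
move=> i x; apply: le_trans (HB i x) _.
by rewrite (bigD1 i)//= lerDl sumr_ge0.
Qed.

Lemma integral_amb {R : realType} {j d : nat} {Omega : set 'M[R]_(j, d)} {Omega0 : Omega !=set0}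
    (F : Prob R (pts Omega0)) (V : 'M[R]_(j, d) -> R) (B : R) :
  measurable_fun [set: borel 'M[R]_(j, d)] (V : borel 'M[R]_(j, d) -> R) ->
  (forall X, `|V X| <= B) ->
  \int[amb F]_X V X = \int[F]_x V (pts_val (x : pts Omega0)).
Proof.
move=> mV VB; rewrite /Rintegral; congr fine.
rewrite /amb (integral_mpush (@measurable_pts_val R j d Omega Omega0))//.
apply: (@prob_integrable _ _ _ F _ B) => [|x]; last exact: VB.
exact: (measurableT_comp mV (@measurable_pts_val R j d Omega Omega0)).
Qed.

Section softmax_field.
Context {R : realType} {d n : nat}.
Variables (E : set 'rV[R]_d) (psi : 'I_n -> @field R 1 d).
Hypotheses (n0 : (0 < n)%N) (tpsi : forall k, test_field E (psi k)).
Variables (lam : R) (lam0 : 0 < lam).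

Let theta k : 'rV[R]_d -> R := dual_integrand (psi k).

Let stheta k : C_infty (theta k).
Proof. exact: test_smooth (test_dual_integrand (tpsi k)). Qed.

Variables (N : nat) (N0 : (0 < N)%N) (eta : 'rV[R]_d -> R).
Local Notation M := 'M[R]_(N, d).
Hypotheses (teta : test E eta) (eta01 : forall x, 0 <= eta x <= 1).
Hypothesis eta1 : forall x, (forall k l, psi k (ord0, l) x = 0) \/ \forall y \near x, eta y = 1.

Let U k : M -> R := avg (theta k).
Let chi k (X : M) : R := softmax lam (U^~ X) k.

Let sU k : C_infty (U k). Proof. exact: smooth_avg. Qed.

Let schi k : C_infty (chi k). Proof. exact: smooth_softmax. Qed.

Let blend (il : 'I_N * 'I_d) (X : M) : R :=
  \sum_k chi k X * psi k (ord0, il.2) (row il.1 X).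

(** The field that follows, in every point, the field psi k for which the empirical
    mean of its dual integrand is largest; the choice is made by smooth weights. *)
Definition softmax_field : @field R N d := fun il X => rows_cutoff eta X * blend il X.

Let spsi k l i : C_infty (fun X : M => psi k (ord0, l) (row i X)).
Proof. by apply: smooth_row; exact: test_smooth (tpsi k _). Qed.

Let sblend il : C_infty (blend il).
Proof. by apply: smooth_sum => k; exact: smoothM. Qed.

Lemma test_softmax_field : test_field (powE E N) softmax_field.
Proof. by move=> il; apply: testMl; [exact: test_rows_cutoff|exact: sblend]. Qed.

Variable (B : R).
Hypotheses (B0 : 0 <= B) (psiB : forall k l x, `|psi k (ord0, l) x| <= B)
  (thetaB : forall k l x, `|partial (ord0, l) (theta k) x| <= B).

Let chi0 k X : 0 <= chi k X. Proof. exact: softmax_ge0. Qed.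

Let chi1 X : \sum_k chi k X = 1. Proof. exact: sum_softmax. Qed.

(** Moving one point changes an empirical mean over N points by a multiple of 1 / N. *)
Lemma partial_softmax_weight_bound k il X :
  `|partial il (chi k) X| <= chi k X * (2 * lam * B / N%:R).
Proof.
have NR : 0 < N%:R :> R by rewrite ltr0n.
have D p : `|partial il (U p) X| <= B / N%:R.
  rewrite partial_avg// normrM ger0_norm ?invr_ge0// mulrC.
  by rewrite ler_wpM2r ?invr_ge0.
rewrite partial_softmax// -/(chi k X) normrM normrM (ger0_norm (ltW lam0)) (ger0_norm (chi0 k X)).
rewrite [leRHS](_ : _ = lam * chi k X * (B / N%:R + B / N%:R)); last by ring.
have lc : 0 <= lam * chi k X by rewrite mulr_ge0 ?(ltW lam0).
rewrite ler_wpM2l// (le_trans (ler_normB _ _))// lerD//.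
apply: le_trans (ler_norm_sum _ _ _) _.
rewrite [leRHS](_ : _ = \sum_p chi p X * (B / N%:R)); last by rewrite -mulr_suml chi1 mul1r.
apply: ler_sum => p _.
by rewrite -/(chi p X) normrM (ger0_norm (chi0 p X)) ler_wpM2l.
Qed.

Lemma partial_softmax_field il X : partial il (softmax_field il) X =
  rows_cutoff eta X * \sum_k (chi k X * partial (ord0, il.2) (psi k (ord0, il.2)) (row il.1 X) +
    psi k (ord0, il.2) (row il.1 X) * partial il (chi k) X).
Proof.
rewrite (partialM il (test_smooth (test_rows_cutoff teta)) (sblend il)).
rewrite [X in _ + X](_ : _ = 0) ?addr0; last first.
  have [psi0|e1] := eta1 (row il.1 X).
    by rewrite /blend big1 ?mul0r// => k _; rewrite psi0 mulr0.
  by rewrite partial_rows_cutoff ?mulr0//; exact: test_smooth teta.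
congr (_ * _); rewrite partial_sum; last by move=> k; exact: smoothM.
apply: eq_bigr => k _; rewrite partialM// partial_row; last exact: test_smooth (tpsi k _).
by rewrite eqxx.
Qed.

(** Differentiating the fields psi k produces the average of the empirical means of the
    dual integrands with the weights chi, and Jensen's inequality takes care of the
    square; differentiating the weights costs a term of order 1 / N for each of the
    N d entries. *)
Lemma softmax_field_lower X : (exists k, forall x, theta k x = 0) ->
  rows_cutoff eta X * (N%:R * \big[Num.max/0]_k U k X) - N%:R * (n%:R / lam) - 2 * d%:R * lam * B ^+ 2
  <= dual_integrand softmax_field X.
Proof.
move=> [k0 theta0].
have NR : 0 < N%:R :> R by rewrite ltr0n.
set H := rows_cutoff eta X.
have /andP[H0 H1] : 0 <= H <= 1 by apply: rows_cutoff01.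
have maxU : \big[Num.max/0]_k U k X - n%:R / lam <= \sum_k chi k X * U k X.
  rewrite lerBlDr; apply: bigmax_le => [|k _]; last first.
    by rewrite -lerBlDr; exact: (softmax_average lam0 (U^~ X) k).
  rewrite -lerBlDr; have := softmax_average lam0 (U^~ X) k0.
  by rewrite [U k0 X](_ : _ = 0)// /U /avg big1 ?mulr0// => i _; exact: theta0.
have sumU : N%:R * (\sum_k chi k X * U k X) = \sum_k \sum_i chi k X * theta k (row i X).
  rewrite mulr_sumr; apply: eq_bigr => k _; rewrite /U /avg mulrCA [N%:R * _]mulrA mulfV ?gt_eqF// mul1r.
  by rewrite mulr_sumr.
pose a (i : 'I_N) (l : 'I_d) := \sum_k chi k X * partial (ord0, l) (psi k (ord0, l)) (row i X).
pose b (i : 'I_N) (l : 'I_d) := \sum_k psi k (ord0, l) (row i X) * partial (i, l) (chi k) X.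
pose c (i : 'I_N) (l : 'I_d) := \sum_k chi k X * psi k (ord0, l) (row i X) ^+ 2.
have E1 : \sum_k \sum_i chi k X * theta k (row i X) = \sum_i \sum_l (- a i l - c i l / 4).
  rewrite exchange_big; apply: eq_bigr => i _ /=.
  rewrite /theta /dual_integrand /diverg /dot.
  under eq_bigr do rewrite !sum_row.
  under eq_bigr do rewrite mulr_suml -sumrN -sumrB mulr_sumr.
  rewrite exchange_big; apply: eq_bigr => l _ /=.
  rewrite /a /c mulr_suml -sumrN -sumrB; apply: eq_bigr => k _.
  by rewrite expr2; ring.
have E2 : dual_integrand softmax_field X =
    \sum_i \sum_l (- (H * (a i l + b i l)) - H ^+ 2 * blend (i, l) X ^+ 2 / 4).
  rewrite /dual_integrand /diverg /dot mulr_suml -sumrN -sumrB pair_big.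
  apply: eq_bigr => -[i l] _ /=; rewrite partial_softmax_field -/H big_split/= -/(a i l) -/(b i l).
  by congr (_ - _); rewrite /softmax_field -/H; ring.
have bB i l : `|b i l| <= B * (2 * lam * B / N%:R).
  apply: le_trans (ler_norm_sum _ _ _) _.
  apply: (@le_trans _ _ (\sum_k chi k X * (B * (2 * lam * B / N%:R)))).
    apply: ler_sum => k _; rewrite normrM mulrCA ler_pM//.
    exact: partial_softmax_weight_bound.
  by rewrite -mulr_suml chi1 mul1r.
have cB i l : blend (i, l) X ^+ 2 <= c i l by exact: softmax_jensen.
have c0 i l : 0 <= c i l by apply: sumr_ge0 => k _; rewrite mulr_ge0// sqr_ge0.
rewrite E2; apply: (@le_trans _ _ (\sum_(i < N) \sum_(l < d)
    (H * (- a i l - c i l / 4) - 2 * lam * B ^+ 2 / N%:R))); last first.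
  apply: ler_sum => i _; apply: ler_sum => l _.
  have h1 : H * b i l <= 2 * lam * B ^+ 2 / N%:R.
    apply: le_trans (ler_norm _) _; rewrite normrM (ger0_norm H0).
    apply: (@le_trans _ _ `|b i l|); first by rewrite ler_piMl.
    by apply: le_trans (bB i l) _; rewrite expr2 le_eqVlt; apply/orP; left; apply/eqP; ring.
  have h2 : H ^+ 2 * blend (i, l) X ^+ 2 <= H * c i l.
    by rewrite expr2 -mulrA ler_wpM2l// (le_trans _ (cB i l))// ler_piMl// sqr_ge0.
  rewrite mulrDr; lra.
rewrite (_ : \sum_(i < N) _ = H * (\sum_i \sum_l (- a i l - c i l / 4)) - 2 * d%:R * lam * B ^+ 2); last first.
  have -> : 2 * d%:R * lam * B ^+ 2 = \sum_(i < N) \sum_(l < d) (2 * lam * B ^+ 2 / N%:R).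
    have G (x z w : R) : w != 0 -> 2 * x * lam * z = w * (x * (2 * lam * z / w)) by move=> ?; field.
    have -> : \sum_(i < N) \sum_(l < d) (2 * lam * B ^+ 2 / N%:R) =
        N%:R * (d%:R * (2 * lam * B ^+ 2 / N%:R)).
      have S (e : R) k : \sum_(i < k) e = k%:R * e by rewrite sumr_const card_ord mulr_natl.
      by rewrite !S.
    by apply: G; rewrite gt_eqF.
  by rewrite mulr_sumr -sumrB; apply: eq_bigr => i _; rewrite mulr_sumr -sumrB.
rewrite -E1 -sumU lerD2r.
apply: (@le_trans _ _ (H * (N%:R * (\big[Num.max/0]_k U k X - n%:R / lam)))).
  rewrite mulrBr mulrBr lerD2l lerN2 ler_piMl// mulr_ge0 ?(ltW NR)//.
  by rewrite divr_ge0// ltW.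
by rewrite ler_wpM2l// ler_wpM2l// ltW.
Qed.

End softmax_field.

Section fisher_lower_bound.
Context {R : realType} {d n : nat}.
Variables (E : set 'rV[R]_d) (E0 : E !=set0) (oE : open E).
Variables (psi : 'I_n -> @field R 1 d) (tpsi : forall k, test_field E (psi k)).
Hypothesis zero : exists k, forall x, dual_integrand (psi k) x = 0.

Let theta k : 'rV[R]_d -> R := dual_integrand (psi k).

Definition max_avg N (X : 'M[R]_(N, d)) : R := \big[Num.max/0]_k avg (theta k) X.

Lemma max_avg_ge0 N (X : 'M[R]_(N, d)) : 0 <= max_avg X.
Proof. exact: bigmax_ge_id. Qed.

Lemma continuous_max_avg N : continuous (@max_avg N).
Proof.
apply: (@continuous_big R _ Num.max 0 xpredT) => [[x y]|k _].
  by apply: continuous_max; [exact: cvg_fst|exact: cvg_snd].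
apply: smooth_continuous; apply: smooth_avg.
exact: test_smooth (test_dual_integrand (tpsi k)).
Qed.

Lemma max_avg_bounded : exists2 B : R, 0 <= B & forall N (X : 'M[R]_(N, d)), `|max_avg X| <= B.
Proof.
have [B B0 HB] : exists2 B : R, 0 <= B & forall k x, `|theta k x| <= B.
  apply: uniform_bound => k; have [B _ HB] := test_bounded (test_dual_integrand (tpsi k)).
  by exists B.
exists B => // N X; rewrite ger0_norm ?max_avg_ge0//; apply: bigmax_le => // k _.
by apply: le_trans (ler_norm _) _; apply: avg_bound => x; exact: HB.
Qed.

(** Insert the field of smooth maxima, cut off near the boundary of E^N, in the dual
    formula, and let the cutoff tend to 1. *)
Lemma fisher_ge_max_avg (lam : R) : 0 < lam -> exists C : R,
  forall N (F : Prob R (pts (powE0 E0 N))), (0 < N)%N ->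
  ((\int[amb F]_X max_avg X - n%:R / lam - C / N%:R)%:E <= fisher F)%E.
Proof.
move=> lam0.
have n0 : (0 < n)%N by have [[k kn] _] := zero; exact: leq_trans kn.
have [B1 B10 HB1] : exists2 B : R, 0 <= B & forall (kl : 'I_n * 'I_d) x,
    `|psi kl.1 (ord0, kl.2) x| <= B.
  apply: uniform_bound => kl; have [B _ HB] := test_bounded (tpsi kl.1 (ord0, kl.2)).
  by exists B.
have [B2 B20 HB2] : exists2 B : R, 0 <= B & forall (kl : 'I_n * 'I_d) x,
    `|partial (ord0, kl.2) (theta kl.1) x| <= B.
  apply: uniform_bound => kl.
  have [B _ HB] := test_bounded (test_partial (ord0, kl.2) (test_dual_integrand (tpsi kl.1))).
  by exists B.
pose B := Num.max B1 B2.
have B0 : 0 <= B by rewrite le_max B10.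
exists (2 * d%:R * lam * B ^+ 2) => N F N0.
have NR : 0 < N%:R :> R by rewrite ltr0n.
have Hm (kl : 'I_n * 'I_d) : exists m, forall m', (m <= m')%N ->
    forall x, psi kl.1 (ord0, kl.2) x != 0 -> \forall y \near x, exhaustion E m' y = 1.
  have /testP[_ [K [cK KE K0]]] := tpsi kl.1 (ord0, kl.2).
  have [m H] := exhaustion_compact oE cK KE; exists m => m' mm' x x0; apply: H => //.
  by apply: contrapT => /K0 xK; rewrite xK eqxx in x0.
(* From index m0 on, the cutoffs are 1 near the supports of all the psi k. *)
pose m0 := (\sum_kl sval (cid (Hm kl)))%N.
pose eta m := exhaustion E (m0 + m).
have eta1 m x : (forall k l, psi k (ord0, l) x = 0) \/ \forall y \near x, eta m y = 1.
  have [/existsNP[k /existsNP[l kl]]|H] := pselect (~ forall k l, psi k (ord0, l) x = 0); last first.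
    by left; exact: contrapT.
  right; rewrite /eta; move: (leqnn m0); rewrite {1}/m0 (bigD1 (k, l))//=.
  case: cid => mk /= Hmk mk0; apply: Hmk; last exact/eqP.
  by rewrite (leq_trans _ (leq_addr _ _))// (leq_trans _ mk0)// leq_addr.
have teta m : test E (eta m) by exact: test_exhaustion.
have eta01 m x : 0 <= eta m x <= 1 by exact: exhaustion01.
rewrite (fisher_dual F (@open_powE R d E oE N) N0).
set S := ereal_sup _.
rewrite -[X in (_ <= X)%E]muleC -lee_pdivrMr; last by rewrite invr_gt0.
rewrite invrK -EFinM.
set a := (X in (X%:E <= _)%E).
have mmax : measurable_fun [set: borel 'M[R]_(N, d)] (@max_avg N : borel 'M[R]_(N, d) -> R).
  by apply: continuous_borelR; exact: continuous_max_avg.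
have [D D0 HD] := max_avg_bounded.
pose c : R := N%:R * (n%:R / lam) + 2 * d%:R * lam * B ^+ 2.
have HS m : ((N%:R * \int[amb F]_X (rows_cutoff (eta m) X * max_avg X) - c)%:E <= S)%E.
  have tP := @test_softmax_field R d n E psi tpsi lam N (eta m) (teta m).
  have mH := measurable_test (test_rows_cutoff (N := N) (teta m)).
  have iH : (amb F).-integrable setT (EFin \o (fun X => rows_cutoff (eta m) X * max_avg X)).
    apply: (@prob_integrable _ _ _ (amb F) _ D); first exact: measurable_funM.
    move=> X; have /andP[h0 h1] := rows_cutoff01 X (eta01 m).
    by rewrite normrM ger0_norm// (le_trans _ (HD N X))// ler_piMl.
  have iNH : (amb F).-integrable setT (EFin \o (fun X => N%:R * (rows_cutoff (eta m) X * max_avg X))).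
    exact: (@integrableZl _ _ _ (amb F) setT measurableT N%:R _ iH).
  apply: (@le_trans _ _ (dual (amb F) (softmax_field psi lam (eta m)))%:E); last first.
    by apply: ereal_sup_ubound; exists (softmax_field psi lam (eta m)).
  rewrite lee_fin -RintegralZl// -[c](prob_integral_cst (amb F)) -RintegralB//; last exact: finite_measure_integrable_cst.
  apply: le_Rintegral => //.
  - by apply: integrable_subR => //; exact: finite_measure_integrable_cst.
  - exact: test_integrable (test_dual_integrand tP).
  - move=> X _; rewrite /c opprD addrA mulrCA.
    apply: (softmax_field_lower (E := E)) => //.
    + by move=> k l x; rewrite le_max (HB1 (k, l)).
    + by move=> k l x; rewrite le_max (HB2 (k, l)) orbT.
have aE : a = N%:R * \int[amb F]_X max_avg X - c.
  by rewrite /a /c; field; rewrite !gt_eqF.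
have cv : \int[amb F]_X (rows_cutoff (eta m) X * max_avg X) @[m --> \oo] --> \int[amb F]_X max_avg X.
  rewrite (integral_amb F mmax (HD N)).
  have mB m (X : 'M[R]_(N, d)) : `|rows_cutoff (eta m) X * max_avg X| <= D.
    have /andP[h0 h1] := rows_cutoff01 X (eta01 m).
    by rewrite normrM ger0_norm// (le_trans _ (HD N X))// ler_piMl.
  have mR m : measurable_fun [set: borel 'M[R]_(N, d)] (fun X : borel 'M[R]_(N, d) => rows_cutoff (eta m) X * max_avg X).
    by apply: measurable_funM => //; exact: measurable_test (test_rows_cutoff (teta m)).
  under eq_fun do rewrite (integral_amb F (mR _) (mB _)).
  have mV (V : 'M[R]_(N, d) -> R) : measurable_fun [set: borel 'M[R]_(N, d)] (V : borel 'M[R]_(N, d) -> R) ->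
      measurable_fun [set: borel (pts (powE0 E0 N))] (fun x => V (pts_val (x : pts (powE0 E0 N)))).
    by move=> mV; exact: (measurableT_comp mV (@measurable_pts_val R N d _ (powE0 E0 N))).
  apply: fine_cvg; rewrite fineK; last first.
    apply: integrable_fin_num => //; apply: (@prob_integrable _ _ _ F _ D); last by move=> x; exact: HD.
    exact: mV.
  apply: (@dominated_cvg _ _ _ F setT measurableT
    (fun m x => (rows_cutoff (eta m) (pts_val (x : pts (powE0 E0 N))) * max_avg (pts_val (x : pts (powE0 E0 N))))%:E)
    _ (EFin \o cst D)) => //.
  - by move=> m; apply/measurable_EFinP; exact: (mV _ (mR m)).
  - move=> x _; apply: cvg_EFin; first by near=> m.
    have [m1 Hm1] : exists m1, forall m, (m1 <= m)%N -> forall i, eta m (row i (pts_val (x : pts (powE0 E0 N)))) = 1.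
      have Hi i : exists m, forall m', (m <= m')%N -> exhaustion E m' (row i (pts_val (x : pts (powE0 E0 N)))) = 1.
        have Ex : E (row i (pts_val (x : pts (powE0 E0 N)))) by exact: (set_valP (x : pts (powE0 E0 N)) i).
        have [m H] := exhaustion_point oE Ex; exists m => m' mm'; exact: nbhs_singleton (H m' mm').
      exists (\sum_i sval (cid (Hi i)))%N => m mm i; move: mm; rewrite (bigD1 i)//=.
      case: cid => mi /= Hmi mm; apply: Hmi.
      by rewrite (leq_trans _ (leq_addl _ _))// (leq_trans _ mm)// leq_addr.
    apply: cvg_near_cst; exists m1 => // m /= mm.
    by rewrite /rows_cutoff big1 ?mul1r// => i _; exact: Hm1.
  - exact: finite_measure_integrable_cst.
  - by move=> m x _ /=; rewrite lee_fin.
have cva : (N%:R * \int[amb F]_X (rows_cutoff (eta m) X * max_avg X) - c)%:E @[m --> \oo] --> a%:E.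
  apply: cvg_EFin; first by near=> m.
  by rewrite aE; apply: cvgB; [apply: cvgM => //; exact: cvg_cst|exact: cvg_cst].
rewrite -(cvg_lim _ cva)//; apply: lime_le; first by apply/cvg_ex; exists a%:E.
by near=> m; exact: HS.
Unshelve. all: by end_near. Qed.

End fisher_lower_bound.

(** * Symmetric laws and their marginals *)

Lemma sum_ord_cst {R : pzRingType} n (e : R) : \sum_(i < n) e = n%:R * e.
Proof. by rewrite sumr_const card_ord mulr_natl. Qed.

Section symmetric_laws.
Context {R : realType} {d : nat} {E : set 'rV[R]_d} {E0 : E !=set0}.
Variables (N : nat) (F : Prob R (pts (powE0 E0 N))).
Local Notation M := 'M[R]_(N, d).
Hypothesis symF : symmetric_prob F.

Lemma measurable_row_perm (s : 'S_N) :
  measurable_fun [set: borel M] (fun X : borel M => row_perm s (X : M) : borel M).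
Proof.
apply: measurable_mx => i k; under eq_fun do rewrite mxE.
by apply: continuous_borelR; exact: coord_continuous.
Qed.

Lemma integral_row_perm (s : 'S_N) (V : M -> R) (B : R) :
  measurable_fun [set: borel M] (V : borel M -> R) -> (forall X, `|V X| <= B) ->
  \int[amb F]_X V (row_perm s X) = \int[amb F]_X V X.
Proof.
move=> mV VB; rewrite /Rintegral; congr fine.
rewrite -(integral_mpush (measurable_row_perm s) mV).
  by apply: eq_measure_integral => A mA _; exact: symF.
apply: (@prob_integrable _ _ _ (amb F) _ B) => [|X]; last exact: VB.
exact: (measurableT_comp mV (measurable_row_perm s)).
Qed.

Variables (theta : 'rV[R]_d -> R) (B : R).
Hypotheses (mtheta : continuous theta) (thetaB : forall x, `|theta x| <= B).

Let c i l : R := \int[amb F]_X (theta (row i X) * theta (row l X)).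

Let mrow i : measurable_fun [set: borel M] (fun X : borel M => theta (row i X)).
Proof.
apply: continuous_borelR => X.
by apply: continuous_comp; [exact: continuous_row|exact: mtheta].
Qed.

Let prodB i l (X : M) : `|theta (row i X) * theta (row l X)| <= B ^+ 2.
Proof. by rewrite normrM expr2 ler_pM. Qed.

Let mprod i l : measurable_fun [set: borel M] (fun X : borel M => theta (row i X) * theta (row l X)).
Proof. exact: measurable_funM. Qed.

Let c_perm (s : 'S_N) i l : c (s i) (s l) = c i l.
Proof.
rewrite /c -(integral_row_perm s (mprod i l) (prodB i l)).
have rE k (X : M) : row k (row_perm s X) = row (s k) X by apply/rowP => x; rewrite !mxE.
by apply: eq_Rintegral => X _; rewrite !rE.
Qed.

Let c_bound i l : `|c i l| <= B ^+ 2.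
Proof. exact: prob_integral_norm_le. Qed.

Let c_diag i l : c i i = c l l.
Proof. by rewrite -(c_perm (tperm i l)) tpermL. Qed.

Let c_offdiag i l i' l' : i != l -> i' != l' -> c i l = c i' l'.
Proof.
move=> il il'; rewrite -(c_perm (tperm i i')) tpermL.
set l1 := tperm i i' l.
have l1i : l1 != i' by rewrite -[X in l1 != X](tpermL i i') (inj_eq perm_inj) eq_sym.
rewrite -(c_perm (tperm l1 l')) tpermL tpermD//.
by rewrite eq_sym.
Qed.

(** By exchangeability the second moments of the values at the points take two values
    only, on the diagonal and off it, and the second one contributes a multiple of the
    square of the sum of the weights. *)
Lemma exchangeable_variance (w : 'I_N -> R) : \sum_i w i = 0 ->
  \int[amb F]_X (\sum_i w i * theta (row i X)) ^+ 2 <= 2 * B ^+ 2 * \sum_i w i ^+ 2.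
Proof.
move=> w0.
have [c1 [c2 [c1B c2B cE]]] : exists c1 c2, [/\ `|c1| <= B ^+ 2, `|c2| <= B ^+ 2 &
    forall i l, c i l = if i == l then c1 else c2].
  have B2 : `|0 : R| <= B ^+ 2 by rewrite normr0 sqr_ge0.
  have [[i0 [l0 il0]]|H] := pselect (exists i l : 'I_N, i != l).
    exists (c i0 i0), (c i0 l0); split => // i l.
    by case: eqVneq => [->|il]; [exact: c_diag|exact: c_offdiag].
  have [[i0 _]|H'] := pselect (exists i : 'I_N, True).
    exists (c i0 i0), 0; split => // i l; case: eqVneq => [->|il]; first exact: c_diag.
    by exfalso; apply: H; exists i, l.
  by exists 0, 0; split => // i; exfalso; apply: H'; exists i.
have -> : \int[amb F]_X (\sum_i w i * theta (row i X)) ^+ 2 = \sum_i \sum_l w i * w l * c i l.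
  have iprod i l := @prob_integrable _ _ _ (amb F) _ _ (mprod i l) (prodB i l).
  have iw i l : (amb F).-integrable setT
      (EFin \o (fun X : M => w i * w l * (theta (row i X) * theta (row l X)))).
    exact: (@integrableZl _ _ _ (amb F) setT measurableT (w i * w l) _ (iprod i l)).
  transitivity (\int[amb F]_X (\sum_i \sum_l w i * w l * (theta (row i X) * theta (row l X)))).
    apply: eq_Rintegral => X _; rewrite expr2 big_distrlr/=.
    by apply: eq_bigr => i _; apply: eq_bigr => l _; rewrite mulrACA.
  rewrite Rintegral_sum//; last by move=> i; exact: integrable_sumR.
  apply: eq_bigr => i _; rewrite Rintegral_sum//.
  by apply: eq_bigr => l _; rewrite RintegralZl.
have -> : \sum_i \sum_l w i * w l * c i l = (c1 - c2) * \sum_i w i ^+ 2.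
  transitivity (\sum_i (w i ^+ 2 * (c1 - c2) + w i * c2 * \sum_l w l)).
    apply: eq_bigr => i _.
    rewrite (eq_bigr (fun l => (l == i)%:R * (w i * w l * (c1 - c2)) + w i * c2 * w l)); last first.
      by move=> l _; rewrite cE [i == l]eq_sym; case: eqVneq => [->|_] /=; rewrite ?mul1r ?mul0r; ring.
    rewrite big_split/= -mulr_sumr; congr (_ + _).
    rewrite (bigD1 i)//= eqxx big1 ?addr0; first by rewrite mul1r expr2.
    by move=> l /negbTE ->; rewrite mul0r.
  by rewrite w0; under eq_bigr do rewrite mulr0 addr0; rewrite -mulr_suml mulrC.
have s0 : 0 <= \sum_i w i ^+ 2 by apply: sumr_ge0 => i _; exact: sqr_ge0.
rewrite ler_wpM2r//; move: c1B c2B; rewrite !ler_norml => /andP[? ?] /andP[? ?]; lra.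
Qed.

End symmetric_laws.

Section marginal_comparison.
Context {R : realType} {d n : nat}.
Variables (E : set 'rV[R]_d) (E0 : E !=set0).
Variables (psi : 'I_n -> @field R 1 d) (tpsi : forall k, test_field E (psi k)).

Let theta k : 'rV[R]_d -> R := dual_integrand (psi k).

Lemma continuous_usubmx j m : continuous (usubmx : 'M[R]_(j + m, d) -> 'M[R]_(j, d)).
Proof.
by apply: matrix_continuous => i k; under eq_fun do rewrite mxE; exact: coord_continuous.
Qed.

Lemma avg_usubmx_diff u j m (X : 'M[R]_(j + m, d)) :
  avg u (usubmx X) - avg u X =
  \sum_i ((if fintype.split i is inl _ then j%:R^-1 else 0) - (j + m)%:R^-1) * u (row i X).
Proof.
under [RHS]eq_bigr do rewrite mulrBl.
rewrite sumrB /avg -mulr_sumr; congr (_ - _).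
rewrite big_split_ord/= [X in _ + X]big1 ?addr0 => [|i _]; last first.
  by rewrite (unsplitK (inr i : 'I_j + 'I_m)) mul0r.
rewrite mulr_sumr; apply: eq_bigr => i _.
by rewrite (unsplitK (inl i : 'I_j + 'I_m)) row_usubmx.
Qed.

(** Apply [exchangeable_variance] to the difference between the uniform weights on the
    first j points and on all points; |y| is at most delta / 2 + y^2 / (2 delta). *)
Lemma max_avg_marginal : exists2 B : R, 0 <= B &
  forall (delta : R) j m (F : Prob R (pts (powE0 E0 (j + m)))), 0 < delta -> (0 < j)%N ->
  symmetric_prob F ->
  \int[amb (marginal F)]_X max_avg psi X <=
  \int[amb F]_X max_avg psi X + n%:R * (delta / 2 + B / (j%:R * delta)).
Proof.
have [B B0 HB] : exists2 B : R, 0 <= B & forall k x, `|theta k x| <= B.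
  apply: uniform_bound => k; have [B _ HB] := test_bounded (test_dual_integrand (tpsi k)).
  by exists B.
exists (B ^+ 2); first exact: sqr_ge0.
move=> delta j m F delta0 j0 symF.
have jR : 0 < j%:R :> R by rewrite ltr0n.
have NR : 0 < (j + m)%:R :> R by rewrite ltr0n addn_gt0 j0.
have [D D0 HD] := max_avg_bounded tpsi.
have mU N : measurable_fun [set: borel 'M[R]_(N, d)] (@max_avg R d n psi N : borel 'M[R]_(N, d) -> R).
  by apply: continuous_borelR; exact: continuous_max_avg.
have mUs : measurable_fun [set: borel 'M[R]_(j + m, d)] (fun X : borel 'M[R]_(j + m, d) => max_avg psi (usubmx X)).
  apply: continuous_borelR => X; apply: continuous_comp; first exact: continuous_usubmx.
  exact: continuous_max_avg.
have -> : \int[amb (marginal F)]_X max_avg psi X = \int[amb F]_X max_avg psi (usubmx X).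
  rewrite (integral_amb (marginal F) (mU j) (HD j)) (integral_amb F mUs (fun X => HD j (usubmx X))).
  rewrite /Rintegral; congr fine.
  rewrite (integral_mpush (@measurable_first_rows R d E E0 j m))//.
    exact: (measurableT_comp (mU j) (@measurable_pts_val R j d _ (powE0 E0 j))).
  apply: (@prob_integrable _ _ _ F _ D); last by move=> x; exact: HD.
  exact: (measurableT_comp mUs (@measurable_pts_val R (j + m) d _ (powE0 E0 (j + m)))).
pose w (i : 'I_(j + m)) : R := (if fintype.split i is inl _ then j%:R^-1 else 0) - (j + m)%:R^-1.
have w0 : \sum_i w i = 0.
  rewrite /w sumrB big_split_ord/= [X in _ + X - _]big1 => [|i _]; last first.
    by rewrite (unsplitK (inr i : 'I_j + 'I_m)).
  rewrite (eq_bigr (fun=> j%:R^-1)) => [|i _]; last by rewrite (unsplitK (inl i : 'I_j + 'I_m)).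
  by rewrite !sum_ord_cst !mulfV ?gt_eqF// addr0 subrr.
have w2 : \sum_i w i ^+ 2 <= j%:R^-1.
  rewrite /w big_split_ord/=.
  rewrite (eq_bigr (fun=> (j%:R^-1 - (j + m)%:R^-1) ^+ 2)) => [|i _]; last by rewrite (unsplitK (inl i : 'I_j + 'I_m)).
  rewrite [X in _ + X](eq_bigr (fun=> ((j + m)%:R^-1) ^+ 2)) => [|i _]; last by rewrite (unsplitK (inr i : 'I_j + 'I_m)) sub0r sqrrN.
  rewrite !sum_ord_cst.
  have -> : m%:R = (j + m)%:R - j%:R :> R by rewrite natrD addrC addKr.
  move: NR; set N : R := (j + m)%:R => NR.
  have -> : j%:R * (j%:R^-1 - N^-1) ^+ 2 + (N - j%:R) * N^-1 ^+ 2 = j%:R^-1 - N^-1.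
    have G (a b : R) : a != 0 -> b != 0 ->
        a * (a^-1 - b^-1) ^+ 2 + (b - a) * b^-1 ^+ 2 = a^-1 - b^-1.
      by move=> a0 b0; field; rewrite a0 b0.
    by apply: G; rewrite gt_eqF.
  by rewrite lerBlDr lerDl invr_ge0 ltW.
have ct k : continuous (theta k) by exact: (test_continuous (test_dual_integrand (tpsi k))).
pose Q k (X : 'M[R]_(j + m, d)) : R := (\sum_i w i * theta k (row i X)) ^+ 2.
have mQ k : measurable_fun [set: borel 'M[R]_(j + m, d)] (Q k : borel 'M[R]_(j + m, d) -> R).
  apply: measurable_funX; apply: measurable_sum => i; apply: measurable_funM => //.
  apply: continuous_borelR => X; apply: continuous_comp; last exact: ct.
  exact: continuous_row.
have QE k X : Q k X = (avg (theta k) (usubmx X) - avg (theta k) X) ^+ 2.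
  by rewrite avg_usubmx_diff.
have QB k X : `|Q k X| <= (B + B) ^+ 2.
  rewrite QE normrX lerXn2r ?nnegrE ?addr_ge0//.
  by apply: le_trans (ler_normB _ _) _; rewrite lerD// avg_bound.
have iQ k := @prob_integrable _ _ _ (amb F) _ _ (mQ k) (QB k).
have iU := @prob_integrable _ _ _ (amb F) _ _ (mU (j + m)%N) (HD (j + m)%N).
have iUs := @prob_integrable _ _ _ (amb F) _ _ mUs (fun X => HD j (usubmx X)).
have iG k : (amb F).-integrable setT (EFin \o (fun X => delta / 2 + (2 * delta)^-1 * Q k X)).
  apply: (@integrable_addR _ _ _ (amb F) setT measurableT (fun=> delta / 2)).
    exact: finite_measure_integrable_cst.
  exact: (@integrableZl _ _ _ (amb F) setT measurableT (2 * delta)^-1 _ (iQ k)).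
have iSG := @integrable_sumR _ _ _ (amb F) _ (index_enum 'I_n) (fun k X => delta / 2 + (2 * delta)^-1 * Q k X) setT measurableT iG.
apply: (@le_trans _ _ (\int[amb F]_X (max_avg psi X + \sum_k (delta / 2 + (2 * delta)^-1 * Q k X)))).
  apply: le_Rintegral => //; first exact: integrable_addR.
  move=> X _.
  have G0 k : `|avg (theta k) (usubmx X) - avg (theta k) X| <= delta / 2 + (2 * delta)^-1 * Q k X.
    rewrite QE; move: (avg _ _ - _) => y; rewrite -[y ^+ 2]real_normK ?num_real// -subr_ge0.
    move: `|y| => z.
    have -> : delta / 2 + (2 * delta)^-1 * z ^+ 2 - z = (2 * delta)^-1 * (z - delta) ^+ 2.
      by field; rewrite gt_eqF.
    by rewrite mulr_ge0 ?sqr_ge0// invr_ge0 mulr_ge0// ltW.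
  have G1 k : 0 <= delta / 2 + (2 * delta)^-1 * Q k X by exact: le_trans (G0 k).
  apply: bigmax_le => [|k _].
    by rewrite addr_ge0 ?max_avg_ge0// sumr_ge0.
  apply: (@le_trans _ _ (avg (theta k) X + (delta / 2 + (2 * delta)^-1 * Q k X))).
    by rewrite -lerBlDl; apply: le_trans (ler_norm _) (G0 k).
  apply: lerD; first exact: (le_bigmax _ (fun k => avg (theta k) X) k).
  by rewrite [leRHS](bigD1 k)//= lerDl sumr_ge0.
rewrite RintegralD// lerD2l Rintegral_sum//.
have -> : n%:R * (delta / 2 + B ^+ 2 / (j%:R * delta)) = \sum_(k < n) (delta / 2 + B ^+ 2 / (j%:R * delta)).
  by rewrite sum_ord_cst.
apply: ler_sum => k _.
rewrite RintegralD//; last 2 first.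
- exact: finite_measure_integrable_cst.
- exact: (@integrableZl _ _ _ (amb F) setT measurableT (2 * delta)^-1 _ (iQ k)).
rewrite prob_integral_cst lerD2l RintegralZl//.
have H := exchangeable_variance symF (ct k) (HB k) w0.
apply: (@le_trans _ _ ((2 * delta)^-1 * (2 * B ^+ 2 * j%:R^-1))).
  rewrite ler_wpM2l ?invr_ge0 ?mulr_ge0 ?(ltW delta0)//.
  by apply: le_trans H _; rewrite ler_wpM2l// mulr_ge0// sqr_ge0.
by rewrite le_eqVlt; apply/orP; left; apply/eqP; field; rewrite (gt_eqF delta0) (gt_eqF jR).
Qed.

End marginal_comparison.

(** * Conclusion *)

Lemma dual_integrand0 {R : realType} {j d : nat} (x : 'M[R]_(j, d)) :
  dual_integrand (fun _ _ => 0) x = 0 :> R.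
Proof.
rewrite /dual_integrand /diverg /dot !big1 => [|ik _|ik _].
- by rewrite oppr0 mul0r subrr.
- by rewrite mulr0.
- by rewrite partial_cst.
Qed.

Section conclusion.
Context {R : realType} {d : nat}.
Variables (E : set 'rV[R]_d) (E0 : E !=set0) (oE : open E).
Variable psi : nat -> @field R 1 d.
Hypotheses (tpsi : forall n, test_field E (psi n)) (psi0 : psi 0%N = fun _ _ => 0).
Hypothesis dense : forall a (e : R), test_field E a -> 0 < e ->
  exists n, forall x, `|dual_integrand a x - dual_integrand (psi n) x| <= e.

Let psin n (k : 'I_n) : @field R 1 d := psi k.

Let tpsin n k : test_field E (@psin n k). Proof. exact: tpsi. Qed.

Let zero n : exists k, forall x, dual_integrand (@psin n.+1 k) x = 0.
Proof. by exists ord0 => x; rewrite /psin psi0 dual_integrand0. Qed.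

Let mmax n N : measurable_fun [set: borel 'M[R]_(N, d)] (@max_avg R d n (@psin n) N : borel 'M[R]_(N, d) -> R).
Proof. by apply: continuous_borelR; exact: continuous_max_avg. Qed.

(** The mean of a maximum is at least the maximum of the means, and each point has law
    rho. *)
Lemma lower_fisher_le_tensor n j (rho : Prob R (pts E0)) : (0 < j)%N ->
  lower_fisher tpsi n rho <= \int[amb (tensor_prob rho j)]_X max_avg (@psin n) X.
Proof.
move=> j0; have [D D0 HD] := max_avg_bounded (@tpsin n).
have iU := @prob_integrable _ _ _ (amb (tensor_prob rho j)) _ _ (@mmax n j) (HD j).
apply: bigmax_le => [|k _].
  by apply: Rintegral_ge0 => X _; exact: max_avg_ge0.
have tt := test_dual_integrand (tpsi k).
have [B B0 HB] := test_bounded tt.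
have mr i : measurable_fun [set: borel 'M[R]_(j, d)] (fun X : borel 'M[R]_(j, d) => dual_integrand (psi k) (row i X)).
  apply: continuous_borelR => X; apply: continuous_comp; first exact: continuous_row.
  exact: (test_continuous tt).
have ir i := @prob_integrable _ _ _ (amb (tensor_prob rho j)) _ _ (mr i) (fun X => HB (row i X)).
have Ei i : \int[amb (tensor_prob rho j)]_X dual_integrand (psi k) (row i X) = dual (amb rho) (psi k).
  rewrite (tensor_resample rho i (mr i) (fun X => HB (row i X))).
  under eq_Rintegral do under eq_Rintegral do rewrite row_set_row.
  by rewrite prob_integral_cst.
apply: (@le_trans _ _ (\int[amb (tensor_prob rho j)]_X avg (dual_integrand (psi k)) X)).
  rewrite (theta_mean_dual tpsi) /avg RintegralZl//; last exact: integrable_sumR.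
  rewrite Rintegral_sum// (eq_bigr (fun=> dual (amb rho) (psi k))) => [|i _]; last exact: Ei.
  by rewrite sum_ord_cst mulKf// pnatr_eq0 -lt0n.
apply: le_Rintegral => //.
- apply: (@prob_integrable _ _ _ (amb (tensor_prob rho j)) _ B) => [|X]; last exact: avg_bound.
  by apply: continuous_borelR; apply: smooth_continuous; apply: smooth_avg; exact: test_smooth tt.
- by move=> X _; exact: (le_bigmax _ (fun k : 'I_n => avg (dual_integrand (@psin n k)) X) k).
Qed.

Variable pi : Prob R (Prob R (pts E0)).
Local Notation L n := (\int[pi]_rho lower_fisher tpsi n rho).

Lemma mean_lower_fisher_le_mixture n j : (0 < j)%N ->
  L n <= \int[amb (mixture pi j)]_X max_avg (@psin n) X.
Proof.
move=> j0; have [D D0 HD] := max_avg_bounded (@tpsin n).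
rewrite (mixture_integral pi (@mmax n j) (HD j)).
have [B HB] := lower_fisher_bounded E0 tpsi n.
apply: le_Rintegral => //.
- by apply: (@prob_integrable _ _ _ pi _ B) => //; exact: measurable_lower_fisher.
- apply: (@prob_integrable _ _ _ pi _ D); first exact: (measurable_tensor_integral (@mmax n j) (HD j)).
  by move=> rho; exact: prob_integral_norm_le.
- by move=> rho _; exact: lower_fisher_le_tensor.
Qed.

Lemma large_inverse (C e : R) : 0 < e -> exists N0, forall N, (N0 <= N)%N -> C / N%:R <= e.
Proof.
move=> e0; exists (Num.truncn (`|C| / e)).+1 => N NN.
have NR : 0 < N%:R :> R by rewrite ltr0n (leq_trans _ NN).
rewrite ler_pdivrMr//; apply: le_trans (ler_norm C) _.
rewrite mulrC -ler_pdivrMr//; apply: ltW.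
by apply: lt_le_trans (truncnS_gt _) _; rewrite ler_nat.
Qed.

(** [fisher_ge_max_avg] for the mixture, with a softmax parameter that makes the first
    error e / 2 and with j so large that the second is at most e / 2. *)
Lemma fisher_mixture_ge n (e : R) : 0 < e -> exists j0, forall j, (j0 <= j)%N ->
  ((L n.+1 - e)%:E <= fisher (mixture pi j))%E.
Proof.
move=> e0; have lam0 : 0 < n.+1%:R / (e / 2) by rewrite divr_gt0 ?ltr0n// divr_gt0.
have [C HC] := fisher_ge_max_avg E0 oE (@tpsin n.+1) (@zero n) lam0.
have e20 : 0 < e / 2 by rewrite divr_gt0.
have [j0 Hj] := large_inverse C e20.
exists (maxn j0 1) => j; rewrite geq_max => /andP[jj j1].
apply: le_trans (HC j (mixture pi j) j1); rewrite lee_fin.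
have -> : n.+1%:R / (n.+1%:R / (e / 2)) = e / 2.
  by rewrite invfM invrK mulrA mulfV ?mul1r// pnatr_eq0.
have := Hj j jj; have := mean_lower_fisher_le_mixture n.+1 j1; lra.
Qed.

Lemma mean_fisher_le_of_lower (y : \bar R) :
  (forall n (e : R), 0 < e -> ((L n.+1 - e)%:E <= y)%E) -> (mean_fisher pi <= y)%E.
Proof.
move=> H.
have cL := @mean_lower_fisher_cvg _ _ _ E0 oE psi tpsi dense pi.
rewrite -(cvg_lim _ cL)//; apply: lime_le; first by apply/cvg_ex; exists (mean_fisher pi); exact: cL.
exists 1%N => // -[//|n] _ /=.
by apply/lee_subgt0Pr => e e0; rewrite -EFinB; exact: H.
Qed.

Lemma fisher_mixture_cvg : (fun j => fisher (mixture pi j)) @ \oo --> mean_fisher pi.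
Proof.
rewrite -cvg_shiftS.
have up j : (fisher (mixture pi j.+1) <= mean_fisher pi)%E by exact: fisher_mixture_le.
have lo : (mean_fisher pi <= limn_einf (fun j => fisher (mixture pi j.+1)))%E.
  apply: mean_fisher_le_of_lower => n e e0; have [j0 Hj] := fisher_mixture_ge n e0.
  by apply: (@limn_einf_ge _ _ _ j0) => j jj; apply: Hj; exact: leqW.
have : (-%E \o (fun j => fisher (mixture pi j.+1))) @ \oo --> (- mean_fisher pi)%E.
  apply: limn_esup_le_cvg; first by rewrite limn_esupN leeN2.
  by move=> j; rewrite /= leeN2.
by move=> /cvgeN; rewrite oppeK; under eq_fun do rewrite /= oppeK.
Qed.

Lemma fisher_mixture_sup :
  mean_fisher pi = ereal_sup [set fisher (mixture pi j) | j in [set j | (0 < j)%N]].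
Proof.
apply/eqP; rewrite eq_le; apply/andP; split; last first.
  by apply: ge_ereal_sup => _ [j j0 <-]; exact: fisher_mixture_le.
have cL := fisher_mixture_cvg.
rewrite -(cvg_lim _ cL)//; apply: lime_le; first by apply/cvg_ex; exists (mean_fisher pi); exact: cL.
by exists 1%N => // j /= j0; apply: ereal_sup_ubound; exists j.
Qed.

(** By [fisher_ge_max_avg] it is enough to bound below the mean of the largest empirical
    mean over N points; by exchangeability this compares with the first j points, for a
    fixed large j, where the weak convergence applies. *)
Lemma mean_fisher_le_liminf (F : forall N, Prob R (pts (powE0 E0 N))) :
  (forall N, (0 < N)%N -> symmetric_prob (F N)) ->
  (forall j, (0 < j)%N -> (fun m => marginal (F (j + m)%N)) @ \oo --> mixture pi j) ->
  (mean_fisher pi <= limn_einf (fun N => fisher (F N)))%E.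
Proof.
move=> symF cvgF; apply: mean_fisher_le_of_lower => n e e0.
(* The smooth maximum, the term C / N and the weak convergence cost e5 each, the
   comparison with the first j points 3 / 2 e5. *)
pose e5 := e / 5; have e50 : 0 < e5 by rewrite divr_gt0.
have lam0 : 0 < n.+1%:R / e5 by rewrite divr_gt0 ?ltr0n.
have [C HC] := fisher_ge_max_avg E0 oE (@tpsin n.+1) (@zero n) lam0.
have [B B0 HB] := max_avg_marginal E0 (@tpsin n.+1).
pose delta := e5 / n.+1%:R; have delta0 : 0 < delta by rewrite divr_gt0 ?ltr0n.
have [j0 Hj0] := large_inverse (n.+1%:R * (B / delta)) e50.
pose j := maxn j0 1; have jgt : (0 < j)%N by rewrite leq_max orbT.
have [D D0 HD] := max_avg_bounded (@tpsin n.+1).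
have bc : continuous (fun x : pts (powE0 E0 j) => max_avg (@psin n.+1) (pts_val x)) /\
    exists B : R, forall x : pts (powE0 E0 j), `|max_avg (@psin n.+1) (pts_val x)| <= B.
  split; last by exists D => x; exact: HD.
  by move=> x; apply: continuous_comp; [exact: pts_val_continuous|exact: continuous_max_avg].
pose h : bcfun (R := R) (pts (powE0 E0 j)) := exist _ _ bc.
have cont : (fun m => \int[marginal (F (j + m)%N)]_x sval h x) @ \oo --> \int[mixture pi j]_x sval h x.
  exact: (cvg_comp _ _ (cvgF j jgt) (@continuous_bc_eval R _ h (mixture pi j))).
have [m0 _ Hm0] : \forall m \near \oo, \int[mixture pi j]_x sval h x - e5 <= \int[marginal (F (j + m)%N)]_x sval h x.
  by apply: (cvgr_ge _ cont); rewrite ltrBlDr ltrDl.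
have [N0 HN0] := large_inverse C e50.
apply: (@limn_einf_ge _ _ _ (maxn (j + m0) N0)) => N; rewrite geq_max => /andP[jN NN].
have [m mE] : exists m, N = (j + m)%N.
  by exists (N - j)%N; rewrite subnKC// (leq_trans (leq_addr _ _) jN).
have mm : (m0 <= m)%N by move: jN; rewrite mE leq_add2l.
subst N.
have N1 : (0 < j + m)%N by rewrite addn_gt0 jgt.
apply: le_trans (HC _ (F (j + m)%N) N1); rewrite lee_fin.
have -> : n.+1%:R / (n.+1%:R / e5) = e5.
  by rewrite invfM invrK mulrA mulfV ?mul1r// pnatr_eq0.
have h1 := HN0 _ NN.
have h2 := Hm0 m mm.
have h3 := HB delta j m (F (j + m)%N) delta0 jgt (symF _ N1).
have h4 := mean_lower_fisher_le_mixture n.+1 jgt.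
rewrite (integral_amb (mixture pi j) (@mmax n.+1 j) (HD j)) in h4.
rewrite (integral_amb (marginal (F (j + m)%N)) (@mmax n.+1 j) (HD j)) in h3.
have h5 : n.+1%:R * (delta / 2 + B / (j%:R * delta)) <= e5 / 2 + e5.
  rewrite mulrDr; apply: lerD.
    by rewrite /delta mulrA mulrCA mulfV ?mulr1// pnatr_eq0.
  have := Hj0 j (leq_maxl _ _); apply: le_trans.
  by rewrite invfM [X in n.+1%:R * X](_ : _ = B / delta * j%:R^-1) ?mulrA//; ring.
rewrite /= in h2; rewrite /e5 in h1 h2 h5 *; lra.
Qed.

End conclusion.

Theorem theorem7 (R : realType) (d : nat) (E : set 'rV[R]_d) (E0 : E !=set0)
    (hE : E = setT \/
      [/\ open E, connected E, bounded_set E & smooth_boundary E]) :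
  [/\ forall (t : R) (pi0 pi1 pi : Prob R (Prob R (pts E0))), 0 <= t <= 1 ->
        (forall A : set (borel (Prob R (pts E0))), measurable A ->
          pi A = ((1 - t)%:E * pi0 A + t%:E * pi1 A)%E) ->
        mean_fisher pi =
          ((1 - t)%:E * mean_fisher pi0 + t%:E * mean_fisher pi1)%E,
      forall pi : Prob R (Prob R (pts E0)), (0 <= mean_fisher pi)%E,
      lower_semicontinuous
        (fun pi : Prob R (Prob R (pts E0)) => mean_fisher pi) &
      forall pi : Prob R (Prob R (pts E0)),
        mean_fisher pi =
          ereal_sup [set fisher (mixture pi j) | j in [set j | (0 < j)%N]] /\
        (fun j => fisher (mixture pi j)) @ \oo --> mean_fisher pi] /\
  (forall (F : forall N, Prob R (pts (powE0 E0 N)))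
      (pi : Prob R (Prob R (pts E0))),
    (forall N, (0 < N)%N -> symmetric_prob (F N)) ->
    (forall j, (0 < j)%N ->
      (fun m => marginal (F (j + m)%N)) @ \oo --> mixture pi j) ->
    (mean_fisher pi <= limn_einf (fun N => fisher (F N)))%E).
Proof.
have oE : open E by case: hE => [->|[]//]; exact: openT.
have [psi [tpsi psi0 dense]] := dense_fields E.
split; last by move=> F pi; exact: (mean_fisher_le_liminf oE tpsi psi0 dense).
split.
- by move=> t pi0 pi1 pi; exact: (mean_fisher_affine oE tpsi dense).
- by move=> pi; exact: (mean_fisher_ge0 oE).
- exact: (mean_fisher_lsc oE tpsi dense).
- move=> pi; split; first exact: (fisher_mixture_sup oE tpsi psi0 dense).
  exact: (fisher_mixture_cvg oE tpsi psi0 dense).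
Qed.
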